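(* (a) For all finite metric spaces $X$ and $Y$ (arguments $(X,Y)$ omitted): $$\widehat d_{\mathrm I}^{\mathrm{Tri}}\le\widehat d_{\mathrm I}^{\mathrm{Cor}}\le\widehat d_{\mathrm I}^{\mathrm{Map}}\le2\cdot d_{\mathrm{GH}},\qquad \sup_{k\ge0}d_{\mathrm B,k}\le\sup_{k\ge0}\widehat d_{\mathrm B,k}^{\mathrm{Tri}}\le\sup_{k\ge0}\widehat d_{\mathrm B,k}^{\mathrm{Cor}}\le\sup_{k\ge0}\widehat d_{\mathrm B,k}^{\mathrm{Map}},$$ and $\sup_{k\ge0}\widehat d_{\mathrm B,k}^{\square}\le\widehat d_{\mathrm I}^{\square}$ for each $\square\in\{\mathrm{Tri},\mathrm{Cor},\mathrm{Map}\}$. (b) For each of the inequalities $\widehat d_{\mathrm I}^{\mathrm{Map}}\le2\cdot d_{\mathrm{GH}}$, $\ \sup_kd_{\mathrm B,k}\le\sup_k\widehat d_{\mathrm B,k}^{\mathrm{Tri}}$, and $\sup_k\widehat d_{\mathrm B,k}^{\square}\le\widehat d_{\mathrm I}^{\square}$ ($\square\in\{\mathrm{Tri},\mathrm{Cor},\mathrm{Map}\}$), there exist finite metric spaces $X,Y$ for which the inequality is strict. (c) Statements (a) and (b) remain valid if one fixes a degree $k\ge 0$ and replaces the quantities $\sup_kd_{\mathrm B,k}$, $\sup_k\widehat d_{\mathrm B,k}^{\mathrm{Tri}}$, $\sup_k\widehat d_{\mathrm B,k}^{\mathrm{Cor}}$, $\sup_k\widehat d_{\mathrm B,k}^{\mathrm{Map}}$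 by $d_{\mathrm B,k}$, $\widehat d_{\mathrm B,k}^{\mathrm{Tri}}$, $\widehat d_{\mathrm B,k}^{\mathrm{Cor}}$, $\widehat d_{\mathrm B,k}^{\mathrm{Map}}$, respectively.
   Context: Fix a field $\mathbb{F}$. Finite (pseudo-)metric spaces are nonempty. $d_{\mathrm{GH}}$ is the Gromov–Hausdorff distance. Vietoris–Rips FCC. For a finite pseudo-metric space $(X,d_X)$, $C_*(\mathrm{VR}(X))$ is the simplicial chain complex over $\mathbb{F}$ of the full simplex on the vertex set $X$ (points at distance $0$ remain distinct vertices), with filtration function $\ell^X(\sum\lambda_i\sigma_i)=\max_{\lambda_i\ne0}\operatorname{diam}(\sigma_i)$ (distinct simplices $\sigma_i$), $\ell^X(0)=-\infty$. Elements $x_1,\dots,x_r$ are orthogonal if $\ell^X(\sum\lambda_ix_i)=\max_{\lambda_i\ne0}\ell^X(x_i)$ for all scalars. Barcodes. For $k\ge0$, choose orthogonal ordered bases $(y_1,\dots,y_n)$ of $C_{k+1}$ and $(x_1,\dots,x_m)$ of $\ker\partial_k$ such that, with $r=\operatorname{rank}\partial_{k+1}$, $(y_{r+1},\dots,y_n)$ is a basis of $\ker\partial_{k+1}$, $(x_1,\dots,x_r)$ is a basis of $\operatorname{im}\partial_{k+1}$, and $\partial_{k+1}y_i=x_i$ for $i\le r$. The degree-$k$ verbose barcode $\mathcal{B}_{\mathrm{Ver},k}(X)$ is the multiset of pairs $(\ell^X(x_i),\ell^X(y_i))$, $i\le r$, and $(\ell^X(x_i),\infty)$, $r<i\le m$;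 it does not depend on the choices. The concise barcode $\mathcal{B}_{\mathrm{Con},k}(X)$ is its sub-multiset of pairs $(p,q)$ with $p<q$. Matching and bottleneck distances. $\|(p,q)-(p',q')\|_\infty=\max\{|p-p'|,|q-q'|\}$ if $q,q'<\infty$, $|p-p'|$ if $q=q'=\infty$ (with $|\infty-\infty|=0$), $\infty$ otherwise. $d_{\mathrm M}(A,B)=\inf_\phi\sup_{a\in A}\|a-\phi(a)\|_\infty$ over bijections of multisets $\phi:A\to B$ ($\infty$ if there is none, $0$ if both are empty). $d_{\mathrm B}(A,B)=d_{\mathrm M}(A\sqcup\Delta^\infty,B\sqcup\Delta^\infty)$, where $\Delta^\infty$ contains each $(r,r)$, $r\in[0,\infty]$, with countably infinite multiplicity. $d_{\mathrm B,k}(X,Y):=d_{\mathrm B}(\mathcal{B}_{\mathrm{Con},k}(X),\mathcal{B}_{\mathrm{Con},k}(Y))$. Interleaving distance. For filtered chain complexes $(C_*,\ell_C)$, $(D_*,\ell_D)$ put $C_*^t=\{x:\ell_C(x)\le t\}$. They are $\delta$-interleaved if there are chain maps $f_t:C_*^t\to D_*^{t+\delta}$, $g_t:D_*^t\to C_*^{t+\delta}$ ($t\in\mathbb{R}$) commuting with the inclusions, with $g_{t+\delta}f_t$ and $f_{t+\delta}g_t$ equal to the inclusions $C_*^t\hookrightarrow C_*^{t+2\delta}$, $D_*^t\hookrightarrow D_*^{t+2\delta}$; $d_{\mathrm I}$ is the infimum of such $\delta\ge0$. Pullback distances. A finite tripod between $X$ and $Y$ is a finite set $Z$ with surjections $\phi_X:Z\to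 X$, $\phi_Y:Z\to Y$; $Z_X$ denotes $Z$ with the pseudo-metric $(z,z')\mapsto d_X(\phi_X(z),\phi_X(z'))$, similarly $Z_Y$. Define $\widehat d_{\mathrm I}^{\square}(X,Y)=\inf d_{\mathrm I}(C_*(\mathrm{VR}(Z_X)),C_*(\mathrm{VR}(Z_Y)))$ and $\widehat d_{\mathrm B,k}^{\square}(X,Y)=\inf d_{\mathrm M}(\mathcal{B}_{\mathrm{Ver},k}(Z_X),\mathcal{B}_{\mathrm{Ver},k}(Z_Y))$, where the infimum is over: for $\square=\mathrm{Tri}$, all finite tripods; for $\square=\mathrm{Cor}$, tripods given by correspondences $Z=R\subset X\times Y$ (subsets projecting onto both factors) with the two coordinate projections; for $\square=\mathrm{Map}$, correspondences of the form $R=\{(x,f(x)):x\in X\}\cup\{(g(y),y):y\in Y\}$ for arbitrary maps $f:X\to Y$, $g:Y\to X$. *)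

(* Defs.v *)
From HB Require Import structures.
From mathcomp Require Import all_boot all_order all_algebra.
From mathcomp Require Import all_classical all_reals all_analysis.

Set Implicit Arguments.
Unset Strict Implicit.
Unset Printing Implicit Defensive.

Import Order.TTheory GRing.Theory Num.Theory.
Import numFieldNormedType.Exports.

Local Open Scope classical_set_scope.
Local Open Scope ring_scope.

Record fin_pmetric (R : realType) := FinPMetric {
  pm_pt :> finType;
  pm_dist : pm_pt -> pm_pt -> R;
  pm_nonempty : (0 < #|pm_pt|)%N;
  pm_refl : forall x, pm_dist x x = 0;
  pm_sym : forall x y, pm_dist x y = pm_dist y x;
  pm_triangle : forall x y z, pm_dist x z <= pm_dist x y + pm_dist y z }.

Record fin_metric (R : realType) := FinMetric {
  fm_pmetric :> fin_pmetric R;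
  fm_sep : forall x y : fm_pmetric, pm_dist x y = 0 -> x = y }.

Lemma pm_dist_ge0 (R : realType) (X : fin_pmetric R) (x y : X) :
  0 <= pm_dist x y.
Proof.
have := pm_triangle x y x.
by rewrite pm_refl [pm_dist y x]pm_sym -mulr2n pmulrn_lge0.
Qed.

Section Pullback.
Context (R : realType) (X : fin_pmetric R) (Z : finType) (f : Z -> X).
Hypothesis f_surj : forall x, exists z, f z = x.

Let pb_dist z z' := pm_dist (f z) (f z').

Let pb_nonempty : (0 < #|Z|)%N.
Proof.
have /card_gt0P[x _] := pm_nonempty X.
by have [z _] := f_surj x; apply/card_gt0P; exists z.
Qed.

Definition pullback : fin_pmetric R :=
  @FinPMetric R Z pb_dist pb_nonempty (fun z => pm_refl (f z))
    (fun z z' => pm_sym (f z) (f z'))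
    (fun z1 z2 z3 => pm_triangle (f z1) (f z2) (f z3)).
End Pullback.

Definition hausdorff_dist (R : realType) (W : metricType R) (A B : set W)
    : \bar R :=
  maxe
    (ereal_sup [set ereal_inf [set (mdist a b)%:E | b in B] | a in A])
    (ereal_sup [set ereal_inf [set (mdist a b)%:E | a in A] | b in B]).

Definition isometric_emb (R : realType) (X : fin_pmetric R) (W : metricType R)
    (i : X -> W) :=
  forall x x', mdist (i x) (i x') = pm_dist x x'.

(* The ambient space [W] ranges over all metric spaces. *)
Definition dGH (R : realType) (X Y : fin_metric R) : \bar R :=
  ereal_inf [set e | exists (W : metricType R) (i : X -> W) (j : Y -> W),
    [/\ isometric_emb i, isometric_emb j &
        e = hausdorff_dist (range i) (range j)]].

(* Nonnegatively graded.  [ell] is given degreewise: on an inhomogeneous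
   element the filtration function is the maximum over its components, so the
   sublevel complexes are the direct sums of the degreewise sublevel sets. *)
Record fcc (R : realType) (F : fieldType) := Fcc {
  ch : nat -> vectType F;
  bd : forall k, 'Hom(ch k.+1, ch k);
  ell : forall k, ch k -> \bar R;
  bd_bd : forall k (x : ch k.+2), bd k (bd k.+1 x) = 0;
  ell_eqNy : forall k (x : ch k), ell x = -oo%E <-> x = 0;
  ell_lty : forall k (x : ch k), (ell x < +oo)%E;
  ellZ : forall k (a : F) (x : ch k), a != 0 -> ell (a *: x) = ell x;
  ellD : forall k (x y : ch k), (ell (x + y) <= maxe (ell x) (ell y))%E;
  ell_bd : forall k (x : ch k.+1), (ell (bd k x) <= ell x)%E }.

Section Interleaving.
Context (R : realType) (F : fieldType).

Definition in_sublevel {C : fcc R F} (t : R) {k : nat} (x : ch C k) :=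
  (ell x <= t%:E)%E.

(* A map defined on the sublevel complex [C^t] is represented by a function on
   all of [C]; its values outside of [C^t] are irrelevant. *)
Definition chain_map_on (C D : fcc R F) (s t : R)
    (f : forall k, ch C k -> ch D k) :=
  [/\ forall k (x : ch C k), in_sublevel s x -> in_sublevel t (f k x),
      forall k (a : F) (x y : ch C k), in_sublevel s x -> in_sublevel s y ->
        f k (a *: x + y) = a *: f k x + f k y &
      forall k (x : ch C k.+1), in_sublevel s x ->
        f k (bd C k x) = bd D k (f k.+1 x)].

Definition commutes_with_inclusions (C D : fcc R F)
    (f : R -> forall k, ch C k -> ch D k) :=
  forall s t k (x : ch C k), s <= t -> in_sublevel s x -> f s k x = f t k x.

Definition interleaved (C D : fcc R F) (delta : R) :=
  exists (f : R -> forall k, ch C k -> ch D k)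
         (g : R -> forall k, ch D k -> ch C k),
  [/\ (forall t, chain_map_on t (t + delta) (f t)) /\
      (forall t, chain_map_on t (t + delta) (g t)),
      commutes_with_inclusions f /\ commutes_with_inclusions g,
      forall t k (x : ch C k), in_sublevel t x ->
        g (t + delta) k (f t k x) = x &
      forall t k (y : ch D k), in_sublevel t y ->
        f (t + delta) k (g t k y) = y].

Definition dI (C D : fcc R F) : \bar R :=
  ereal_inf [set delta%:E | delta in
    [set delta : R | 0 <= delta /\ interleaved C D delta]].

End Interleaving.

Section VietorisRips.
Context (R : realType) (F : fieldType) (X : fin_pmetric R).

Definition simplex (k : nat) : finType := {s : {set X} | #|s| == k.+1}.

Definition VR_ch (k : nat) : vectType F := {ffun simplex k -> F^o}.

(* Simplices are oriented by the enumeration order of [X]: the vertex [x] of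
   [s] has position [pos s x] in [s]. *)
Definition pos (s : {set X}) (x : X) : nat :=
  #|[set y in s | (enum_rank y < enum_rank x)%N]|.

Definition VR_bd_fun (k : nat) (c : VR_ch k.+1) : VR_ch k :=
  [ffun t => \sum_(s : simplex k.+1)
     \sum_(x in val s | val s :\ x == val t) (-1) ^+ pos (val s) x * c s].

Lemma VR_bd_linear k : linear (@VR_bd_fun k).
Proof.
move=> a c d; apply/ffunP => t; rewrite !ffunE scaler_sumr -big_split /=.
apply: eq_bigr => s _; rewrite scaler_sumr -big_split /=.
by apply: eq_bigr => x _; rewrite !ffunE mulrDr /GRing.scale /= mulrCA.
Qed.

HB.instance Definition _ k :=
  GRing.isLinear.Build F (VR_ch k.+1) (VR_ch k) *:%R (@VR_bd_fun k)
    (@VR_bd_linear k).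

Definition VR_bd (k : nat) : 'Hom(VR_ch k.+1, VR_ch k) :=
  linfun (@VR_bd_fun k).

Definition diam (s : {set X}) : R :=
  \big[Num.max/0]_(x in s) \big[Num.max/0]_(y in s) pm_dist x y.

Definition VR_ell (k : nat) (c : VR_ch k) : \bar R :=
  \big[maxe/-oo%E]_(s : simplex k | c s != 0) (diam (val s))%:E.

Lemma VR_ell_leP k (c : VR_ch k) (e : \bar R) :
  reflect (forall s, c s != 0 -> ((diam (val s))%:E <= e)%E) (VR_ell c <= e)%E.
Proof.
rewrite /VR_ell; apply: (iffP idP) => [h s cs|h].
  by apply: le_trans h; rewrite (bigD1 s) //= le_max lexx.
by elim/big_ind: _ => [|x y hx hy|s /h //]; rewrite ?leNye// ge_max hx hy.
Qed.

Lemma diam_subset (s t : {set X}) : s \subset t -> diam s <= diam t.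
Proof.
move=> /fintype.subsetP st; rewrite /diam.
have bigmax_ub (A : {set X}) (G : X -> R) z : z \in A ->
    G z <= \big[Num.max/0]_(x in A) G x.
  by move=> zA; rewrite (bigD1 z) //= le_max lexx.
have bigmax_ge0 (A : {set X}) (G : X -> R) :
    0 <= \big[Num.max/0]_(x in A) G x.
  by apply: bigmax_ge_id.
apply/bigmax_leP; split=> // x xs; apply/bigmax_leP; split=> // y ys.
apply: le_trans (bigmax_ub _ (fun z => \big[Num.max/0]_(w in t) pm_dist z w)
  x (st _ xs)).
exact: (bigmax_ub t (fun z => pm_dist x z) y (st _ ys)).
Qed.

Lemma VR_ell_eqNy k (c : VR_ch k) : VR_ell c = -oo%E <-> c = 0.
Proof.
split=> [h|->]; last by rewrite /VR_ell big1 // => s; rewrite ffunE eqxx.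
apply/ffunP => s; rewrite ffunE; apply/eqP/negPn/negP => cs.
by have /VR_ell_leP/(_ s cs) : (VR_ell c <= -oo)%E by rewrite h.
Qed.

Lemma VR_ell_lty k (c : VR_ch k) : (VR_ell c < +oo)%E.
Proof.
by rewrite /VR_ell; elim/big_ind: _ => [|x y hx hy|s _];
  rewrite ?ltNyy ?gt_max ?hx ?ltry.
Qed.

Lemma VR_ellZ k (a : F) (c : VR_ch k) : a != 0 -> VR_ell (a *: c) = VR_ell c.
Proof.
move=> a0; apply: eq_bigl => s.
by rewrite ffunE /GRing.scale /= mulf_eq0 (negbTE a0).
Qed.

Lemma VR_ellD k (c d : VR_ch k) :
  (VR_ell (c + d) <= maxe (VR_ell c) (VR_ell d))%E.
Proof.
apply/VR_ell_leP => s; rewrite ffunE le_max => cds.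
have [cs0|cs] := eqVneq (c s) 0; last first.
  by apply/orP; left; have /VR_ell_leP/(_ s cs) := lexx (VR_ell c).
apply/orP; right; have /VR_ell_leP/(_ s) := lexx (VR_ell d); apply.
by move: cds; rewrite cs0 add0r.
Qed.

Lemma VR_ell_bd k (c : VR_ch k.+1) : (VR_ell (VR_bd k c) <= VR_ell c)%E.
Proof.
apply/VR_ell_leP => t; rewrite lfunE /= ffunE => nz.
have [s [ts cs]] : exists s : simplex k.+1, val t \subset val s /\ c s != 0.
  apply: contrapT => no; move/eqP: nz; apply.
  rewrite big1 // => s _; rewrite big1 // => x /andP[xs /eqP sx].
  have [->|cs] := eqVneq (c s) 0; first by rewrite mulr0.
  by exfalso; apply: no; exists s; split=> //; rewrite -sx subsetDl.
have /VR_ell_leP/(_ s cs) := lexx (VR_ell c); apply: le_trans.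
by rewrite lee_fin diam_subset.
Qed.

Let antisym_sum0 (G : X -> X -> F) :
  (forall x, G x x = 0) -> (forall x y, G x y = - G y x) ->
  \sum_x \sum_y G x y = 0.
Proof.
move=> G0 GN.
pose L (x y : X) := (enum_rank x < enum_rank y)%N.
have -> : \sum_x \sum_y G x y =
  \sum_x \sum_(y | L x y) G x y + \sum_x \sum_(y | L y x) G x y.
  rewrite -big_split; apply: eq_bigr => x _ /=.
  rewrite (bigID (fun y => L x y)) /=; congr (_ + _).
  rewrite (bigID (fun y => L y x)) /= [X in _ + X]big1 ?addr0.
    by apply: eq_bigl => y; rewrite /L; case: ltngtP.
  move=> y /andP[]; rewrite /L -!leqNgt => h1 h2.
  suff -> : x = y by exact: G0.
  by apply: enum_rank_inj; apply: val_inj; apply/eqP; rewrite eqn_leq h2 h1.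
have -> : \sum_x \sum_(y | L y x) G x y = \sum_x \sum_(y | L x y) - G x y.
  rewrite (exchange_big_dep xpredT) //=; apply: eq_bigr => x _.
  by apply: eq_bigr => y _; rewrite -GN.
rewrite -big_split big1 //= => x _.
by rewrite -big_split big1 //= => y _; rewrite subrr.
Qed.

Let posD1_lt (u : {set X}) (x y : X) :
  (enum_rank x < enum_rank y)%N -> pos (u :\ y) x = pos u x.
Proof.
move=> xy; apply: eq_card => z; rewrite !inE.
by case: eqVneq => //= ->; rewrite ltnNge (ltnW xy) andbF.
Qed.

Let posD1_gt (u : {set X}) (x y : X) : x \in u ->
  (enum_rank x < enum_rank y)%N -> pos u y = (pos (u :\ x) y).+1.
Proof.
move=> xu xy; rewrite /pos (cardsD1 x) inE xu xy add1n; congr S.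
by apply: eq_card => z; rewrite !inE andbA.
Qed.

Lemma VR_bd_bd k (c : VR_ch k.+2) : VR_bd k (VR_bd k.+1 c) = 0.
Proof.
rewrite !lfunE /=; apply/ffunP => t; rewrite !ffunE.
pose P (u : {set X}) x y :=
  [&& y \in u, x \in u :\ y & (u :\ y) :\ x == val t].
pose T (u : {set X}) x y : F := (-1) ^+ pos (u :\ y) x * (-1) ^+ pos u y.
transitivity (\sum_(u : simplex k.+2) (\sum_x \sum_y
    (if P (val u) x y then T (val u) x y else 0)) * c u); last first.
  apply: big1 => u _; rewrite antisym_sum0 ?mul0r // => [x|x y].
    by rewrite /P !inE eqxx andbF.
  have -> : P (val u) x y = P (val u) y x.
    rewrite /P !inE [x == y]eq_sym.
    have -> : (val u :\ y) :\ x = (val u :\ x) :\ y.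
      by apply/setP => z; rewrite !inE andbCA.
    by case: (x \in _); case: (y \in _); case: (y == x).
  case: ifP => [|_]; last by rewrite oppr0.
  move=> /and3P[xu]; rewrite !inE => /andP[yx yu] _.
  rewrite /T; case: (ltngtP (enum_rank x) (enum_rank y)) => [h|h|h].
  - by rewrite (posD1_lt _ h) (posD1_gt xu h) exprS mulN1r mulrN mulrC.
  - by rewrite (posD1_lt _ h) (posD1_gt yu h) exprS mulN1r mulrN opprK mulrC.
  - by move/val_inj/enum_rank_inj: h yx => ->; rewrite eqxx.
under eq_bigr => s _.
  under eq_bigr => x _.
    rewrite ffunE mulr_sumr.
    under eq_bigr do rewrite mulr_sumr.
    over.
  over.
under [RHS]eq_bigr => u _.
  rewrite mulr_suml; under eq_bigr => x _ do rewrite mulr_suml; over.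
transitivity (\sum_(s : simplex k.+1) \sum_(u : simplex k.+2) \sum_x \sum_y
  (if [&& x \in val s, val s :\ x == val t, y \in val u &
          val u :\ y == val s]
   then T (val u) x y * c u else 0)).
  apply: eq_bigr => s _; rewrite exchange_big /=; apply: eq_bigr => u _.
  rewrite big_mkcond; apply: eq_bigr => x _.
  case: ifP => [/andP[xs sx]|nP]; last first.
    by rewrite big1 // => y _; rewrite andbA nP.
  rewrite big_mkcond; apply: eq_bigr => y _.
  rewrite xs sx /=; case: ifP => // /andP[_ /eqP uy].
  by rewrite /T uy mulrA.
rewrite exchange_big /=; apply: eq_bigr => u _.
rewrite exchange_big /=; apply: eq_bigr => x _.
rewrite exchange_big /=; apply: eq_bigr => y _.
have [yu|yu] := boolP (y \in val u); last first.
  rewrite /P (negbTE yu) mul0r big1 // => s _.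
  by rewrite /= !andbF.
have cu : #|val u :\ y| == k.+2.
  by have := valP u; rewrite (cardsD1 y) yu add1n eqSS.
pose s0 : simplex k.+1 := exist _ (val u :\ y) cu.
rewrite (bigD1 s0) //= [X in _ + X]big1 ?addr0 => [|s ss0].
  by rewrite /P yu eqxx !andbT /=; case: ifP => _; rewrite ?mul0r.
case: ifP => // /and3P[_ _ /eqP us].
by case/eqP: ss0; apply: val_inj; rewrite /= us.
Qed.

Definition VR : fcc R F :=
  @Fcc R F VR_ch VR_bd VR_ell VR_bd_bd VR_ell_eqNy VR_ell_lty VR_ellZ VR_ellD
    VR_ell_bd.

End VietorisRips.

Section Barcodes.
Context (R : realType) (F : fieldType).

Definition orthogonal (C : fcc R F) (k : nat) (x : seq (ch C k)) :=
  forall lam : 'I_(size x) -> F,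
    ell (\sum_i lam i *: x`_i) =
    \big[maxe/-oo%E]_(i | lam i != 0) ell x`_i.

Definition cycles (C : fcc R F) (k : nat) : {vspace ch C k} :=
  if k is k'.+1 then lker (bd C k') else fullv.

(* Finite multisets are represented by sequences. *)
Definition is_verbose_barcode (C : fcc R F) (k : nat)
    (B : seq (\bar R * \bar R)) :=
  exists (y : seq (ch C k.+1)) (x : seq (ch C k)),
  let r := \dim (limg (bd C k)) in
  [/\ basis_of fullv y /\ orthogonal y,
      basis_of (cycles C k) x /\ orthogonal x,
      basis_of (lker (bd C k)) (drop r y) /\
      basis_of (limg (bd C k)) (take r x),
      forall i, (i < r)%N -> bd C k y`_i = x`_i &
      B = [seq (ell x`_i, if (i < r)%N then ell y`_i else +oo%E)
          | i <- iota 0 (size x)]].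

(* Obtained from an arbitrary choice of bases as above: such bases always exist
   and different choices give the same barcode up to permutation. *)
Definition verbose_barcode (C : fcc R F) (k : nat) : seq (\bar R * \bar R) :=
  xget [::] [set B | is_verbose_barcode C k B].

Definition concise_barcode (C : fcc R F) (k : nat) : seq (\bar R * \bar R) :=
  [seq b <- verbose_barcode C k | (b.1 < b.2)%E].

End Barcodes.

(* A possibly infinite multiset is a family: the multiplicity of [v] is the
   cardinality of its fiber. *)
Record multiset (T : Type) := Multiset {
  ms_index : Type;
  ms_elt : ms_index -> T }.

Definition ms_of_seq (T : Type) (s : seq T) : multiset T :=
  @Multiset T 'I_(size s) (tnth (in_tuple s)).

Definition ms_union (T : Type) (A B : multiset T) : multiset T :=
  @Multiset T (ms_index A + ms_index B)
    (fun i => match i with inl a => ms_elt a | inr b => ms_elt b end).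

Section Distances.
Context (R : realType).
Local Open Scope ereal_scope.

Definition edist (p q : \bar R) : \bar R := if p == q then 0 else `|p - q|.

Definition bar_dist (a b : \bar R * \bar R) : \bar R :=
  if (a.2 < +oo) && (b.2 < +oo) then maxe (edist a.1 b.1) (edist a.2 b.2)
  else if (a.2 == +oo) && (b.2 == +oo) then edist a.1 b.1
  else +oo.

(* Distances are nonnegative, so [maxe 0] only matters for empty multisets,
   where [ereal_sup set0] is [-oo]. *)
Definition dM (A B : multiset (\bar R * \bar R)) : \bar R :=
  ereal_inf [set e | exists phi : ms_index A -> ms_index B,
    bijective phi /\
    e = maxe 0 (ereal_sup (range
          (fun i => bar_dist (ms_elt i) (ms_elt (phi i)))))].

Definition diag : multiset (\bar R * \bar R) :=
  @Multiset _ ({r : \bar R | 0 <= r} * nat) (fun i => (val i.1, val i.1)).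

Definition dB (A B : multiset (\bar R * \bar R)) : \bar R :=
  dM (ms_union A diag) (ms_union B diag).

Definition bottleneck (F : fieldType) (k : nat) (X Y : fin_pmetric R)
    : \bar R :=
  dB (ms_of_seq (concise_barcode (VR F X) k))
     (ms_of_seq (concise_barcode (VR F Y) k)).

End Distances.

Record tripod (R : realType) (X Y : fin_pmetric R) := Tripod {
  tri_set : finType;
  tri_l : tri_set -> X;
  tri_r : tri_set -> Y;
  tri_l_surj : forall x, exists z, tri_l z = x;
  tri_r_surj : forall y, exists z, tri_r z = y }.

Definition pull_l (R : realType) (X Y : fin_pmetric R) (T : tripod X Y) :=
  pullback (@tri_l_surj _ _ _ T).

Definition pull_r (R : realType) (X Y : fin_pmetric R) (T : tripod X Y) :=
  pullback (@tri_r_surj _ _ _ T).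

Section Correspondences.
Context (R : realType) (X Y : fin_pmetric R).

Definition is_correspondence (S : {set X * Y}) :=
  (forall x, exists y, (x, y) \in S) /\ (forall y, exists x, (x, y) \in S).

Section CorTripod.
Context (S : {set X * Y}) (corS : is_correspondence S).

Let cor_l_surj x : exists z : {p : X * Y | p \in S}, (val z).1 = x.
Proof. by have [y xy] := corS.1 x; exists (exist _ (x, y) xy). Qed.

Let cor_r_surj y : exists z : {p : X * Y | p \in S}, (val z).2 = y.
Proof. by have [x xy] := corS.2 y; exists (exist _ (x, y) xy). Qed.

Definition cor_tripod : tripod X Y := Tripod cor_l_surj cor_r_surj.
End CorTripod.

Definition map_cor (f : X -> Y) (g : Y -> X) : {set X * Y} :=
  [set (x, f x) | x : X] :|: [set (g y, y) | y : Y].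

Lemma map_corP (f : X -> Y) (g : Y -> X) : is_correspondence (map_cor f g).
Proof.
split=> [x|y].
- by exists (f x); rewrite finset.in_setU imset_f.
- by exists (g y); rewrite finset.in_setU [X in _ || X]imset_f ?orbT.
Qed.

End Correspondences.

Inductive tripod_class := Tri | Cor | Map.

Definition in_class (R : realType) (X Y : fin_pmetric R) (sq : tripod_class)
    (T : tripod X Y) : Prop :=
  match sq with
  | Tri => True
  | Cor => exists (S : {set X * Y}) (corS : is_correspondence S),
             T = cor_tripod corS
  | Map => exists (f : X -> Y) (g : Y -> X), T = cor_tripod (map_corP f g)
  end.

Definition pullback_dI (R : realType) (F : fieldType) (sq : tripod_class)
    (X Y : fin_pmetric R) : \bar R :=
  ereal_inf [set e | exists T : tripod X Y, in_class sq T /\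
    e = dI (VR F (pull_l T)) (VR F (pull_r T))].

Definition pullback_dB (R : realType) (F : fieldType) (k : nat)
    (sq : tripod_class) (X Y : fin_pmetric R) : \bar R :=
  ereal_inf [set e | exists T : tripod X Y, in_class sq T /\
    e = dM (ms_of_seq (verbose_barcode (VR F (pull_l T)) k))
           (ms_of_seq (verbose_barcode (VR F (pull_r T)) k))].

Definition sup_bottleneck (R : realType) (F : fieldType)
    (X Y : fin_pmetric R) : \bar R :=
  ereal_sup (range (fun k => bottleneck F k X Y)).

Definition sup_pullback_dB (R : realType) (F : fieldType)
    (sq : tripod_class) (X Y : fin_pmetric R) : \bar R :=
  ereal_sup (range (fun k => pullback_dB F k sq X Y)).

(* Main.v *)
(* For finite filtered complexes a delta-interleaving is an isomorphism of the
   ambient complexes which shifts both filtrations by at most delta.  Comparing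
   bases adapted to the two barcodes, its matrix satisfies Hall's condition for
   the relation of being at distance at most delta (Bjerkevik's argument), so
   the verbose barcodes are at matching distance at most delta.  The vertices of
   Z_X in one fibre over X can be merged one after the other, by cone homotopies
   which do not increase the filtration; hence Z_X and X have the same concise
   barcode, and the remaining diagonal bars of Z_X are absorbed by the diagonal.

   Strictness comes from three pairs of graphs, with distance 1 along edges and 2
   between non-adjacent vertices.
   - The star K_{1,3} and the path on four vertices are at Gromov-Hausdorff
     distance at least 1/2, because only the star has a vertex adjacent to all
     others, yet their complexes are isomorphic as filtered complexes.
   - The one-point space and the complete graph on k + 2 vertices are at
     bottleneck distance at most 1/2, while every tripod costs at least 1: on the
     side of the complete graph there is a bar in degree k with finite death at
     least 1, and all finite bars on the other side are (0, 0).
   - The paw and the star K_{1,3}: in each degree some tripod makes the two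
     verbose barcodes equal, but an interleaving with delta < 1 on a tripod would
     equate the numbers of cliques of each size in the two pulled back graphs.
     Counting each clique of size m with weight 2 ^ m, this is refuted by
     3-adic valuations. *)

Require Import Defs.
From HB Require Import structures.
From mathcomp Require Import all_boot all_order all_algebra.
From mathcomp Require Import all_classical all_reals all_analysis.
From mathcomp Require Import perm ring lra zify.

Set Implicit Arguments.
Unset Strict Implicit.
Unset Printing Implicit Defensive.

Import Order.TTheory GRing.Theory Num.Theory.

Local Open Scope ring_scope.

(** The third example shapes the proof: the verbose barcodes of the paw and the star have to be
    compared one degree at a time, on tripods that admit no interleaving below 1. The matching
    argument is therefore stated for linear maps in a single degree that preserve cycles and
    transport fillings of boundaries ([shift_map]). Interleavings and the merging of fibres provide
    such maps in every degree; for the paw and the star they are built by hand.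

    That construction uses a vertex [v] adjacent to all others in both graphs. By coning from [v], a
    cycle of positive degree is determined by its coefficients on the simplices avoiding [v], and
    these can be prescribed freely. If at most one pair of points is closer than 1, what matters is
    the list of diameters of these simplices, raised to at least 1.

    Barcodes exist because two filtrations of the cycles, the level and the cost of a filling, have
    a common orthogonal basis, just as two flags have a common adapted basis. *)

(** * A rank inequality and Hall's theorem *)

(** If [#|A| > #|N|], some nonzero row vector is killed by [P]. Tested against the column of [Q] at
    a support index of maximal [rk], it meets only entries where the product is known to be the
    identity, and returns a nonzero coefficient. *)
Lemma card_le_unitriangular (F : fieldType) (R : realType) (I J : finType)
    (A : {set I}) (N : {set J}) (P : I -> J -> F) (Q : J -> I -> F)
    (rk : I -> R) :
  {in A &, forall i i', rk i <= rk i' ->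
     \sum_(j in N) P i j * Q j i' = (i == i')%:R} ->
  (#|A| <= #|N|)%N.
Proof.
move=> PQ; rewrite leqNgt; apply/negP => NA.
pose M := \matrix_(i < #|A|, j < #|N|) P (enum_val i) (enum_val j).
have : kermx M != 0.
  rewrite kermx_eq0 /row_free neq_ltn; apply/orP; left.
  exact: leq_ltn_trans (rank_leq_col M) NA.
move=> /rowV0Pn[u /sub_kermxP uM u0].
pose v (i : I) : F :=
  \sum_(a < #|A| | enum_val a == i) u 0 a.
have vE a : v (enum_val a) = u 0 a.
  by rewrite /v (big_pred1 a) // => b; rewrite (inj_eq enum_val_inj).
have vM j : j \in N -> \sum_(i in A) v i * P i j = 0.
  move=> jN; rewrite (reindex_omap (enum_val (A := A))
      (fun i => insub (index i (enum A)))) => [|i iA] /=; last first.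
    have ik : (index i (enum A) < #|A|)%N by rewrite cardE index_mem mem_enum.
    rewrite insubT /=; congr Some.
    by rewrite (enum_val_nth i) /= nth_index// mem_enum.
  have /rowP/(_ (enum_rank_in jN j)) := uM; rewrite !mxE => {2}<-.
  apply: eq_big => [a|a _].
    have -> : index (enum_val a) (enum A) = a.
      by rewrite (enum_val_nth (enum_val a)) index_uniq ?enum_uniq// -cardE.
    by rewrite enum_valP valK eqxx.
  by rewrite vE mxE enum_rankK_in.
have /existsP[a0 ua0] : [exists a, u 0 a != 0].
  apply: contraNT u0 => /existsPn u0; apply/eqP/rowP => a; rewrite mxE.
  by apply/eqP; have := u0 a; rewrite negbK.
pose S := [set i in A | v i != 0].
have a0S : enum_val a0 \in S by rewrite inE enum_valP vE ua0.
have [i' i'S i'max] : exists2 i', i' \in S & forall i, i \in S -> rk i <= rk i'.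
  by case: (arg_maxP rk a0S) => i' i'S h; exists i' => // i /h.
have /andP[i'A] : (i' \in A) && (v i' != 0) by move: i'S; rewrite inE.
move/eqP; apply; transitivity (\sum_(i in A) v i * (i == i')%:R).
  rewrite (bigD1 i') //= eqxx mulr1 big1 ?addr0// => i /andP[_ /negbTE ->].
  by rewrite mulr0.
transitivity (\sum_(i in A) v i * \sum_(j in N) P i j * Q j i').
  apply: eq_bigr => i iA; have [->|vi] := eqVneq (v i) 0; first by rewrite !mul0r.
  by rewrite PQ// i'max// inE iA vi.
under eq_bigr do rewrite mulr_sumr.
rewrite exchange_big big1 //= => j jN.
under eq_bigr do rewrite mulrA.
by rewrite -mulr_suml vM// mul0r.
Qed.

Section Hall.
Variables (I J : finType) (r : I -> J -> bool).

Let nbr (A : {set I}) := [set j | [exists i in A, r i j]].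

Let nbrU A B : nbr (A :|: B) = nbr A :|: nbr B.
Proof.
apply/setP => j; rewrite !inE; apply/existsP/orP => [[i]|].
  rewrite inE => /andP[/orP[iA|iB] ij]; [left|right];
    by apply/existsP; exists i; rewrite ?iA ?iB ij.
by move=> [] /existsP[i /andP[iA ij]]; exists i; rewrite inE iA ?orbT.
Qed.

(** Induction on [#|D|] with the targets [E] still available. A nonempty proper subset with exactly
    as many neighbours as elements splits the problem in two; if there is none, any admissible pair
    can be removed, at the cost of at most one neighbour. The option type covers an empty [J]. *)
Let Hall_rec n (D : {set I}) (E : {set J}) : (#|D| <= n)%N ->
  (forall A : {set I}, A \subset D -> (#|A| <= #|nbr A :&: E|)%N) ->
  exists phi : I -> option J, {in D &, injective phi} /\
    forall i, i \in D -> exists j, [/\ phi i = Some j, j \in E & r i j].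
Proof.
elim: n => [|n IHn] in D E *.
  rewrite leqn0 cards_eq0 => /eqP -> _; exists (fun=> None).
  by split=> [i|i]; rewrite inE.
move=> Dn HD.
have [->|[i0 i0D]] := set_0Vmem D.
  by exists (fun=> None); split=> [i|i]; rewrite inE.
have [/existsP[A /and4P[AD A0 AnD /eqP cA]]|noA] := boolP [exists A : {set I},
    [&& A \subset D, A != finset.set0, A != D & #|A| == #|nbr A :&: E|]].
  have ltA : (#|A| < #|D|)%N by apply: proper_card; rewrite finset.properEneq AnD.
  have [phi1 [inj1 H1]] : exists phi : I -> option J, {in A &, injective phi} /\
      forall i, i \in A -> exists j, [/\ phi i = Some j, j \in nbr A :&: E & r i j].
    apply: IHn; first by rewrite -ltnS (leq_trans ltA).
    move=> B BA; apply: leq_trans (HD B (fintype.subset_trans BA AD)) _.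
    apply: subset_leq_card; rewrite finset.setIA finset.setSI //.
    rewrite finset.subsetI subxx /=; apply/fintype.subsetP => j; rewrite !inE.
    move=> /existsP[i /andP[iB ij]]; apply/existsP; exists i.
    by rewrite (fintype.subsetP BA).
  have [phi2 [inj2 H2]] : exists phi : I -> option J,
      {in D :\: A &, injective phi} /\
      forall i, i \in D :\: A ->
        exists j, [/\ phi i = Some j, j \in E :\: nbr A & r i j].
    apply: IHn.
      rewrite -ltnS; apply: leq_trans Dn; apply: proper_card.
      rewrite properE finset.subsetDl /=; apply/negP => /fintype.subsetP DA.
      case/set0Pn: A0 => i iA.
      by have := DA i (fintype.subsetP AD i iA); rewrite inE iA.
    move=> B BDA.
    have AB : [disjoint A & B].
      rewrite -setI_eq0; apply/eqP/setP => i; rewrite !inE.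
      case: (boolP (i \in B)) => [iB|]; last by rewrite andbF.
      by have := fintype.subsetP BDA i iB; rewrite inE => /andP[/negbTE ->].
    have ABD : A :|: B \subset D.
      by rewrite finset.subUset AD (fintype.subset_trans BDA) ?finset.subsetDl.
    have := HD _ ABD; rewrite nbrU cardsU.
    move: AB; rewrite -setI_eq0 => /eqP ->; rewrite cards0 subn0.
    have -> : (nbr A :|: nbr B) :&: E =
        (nbr A :&: E) :|: (nbr B :&: (E :\: nbr A)).
      by apply/setP => j; rewrite !inE; case: [exists i in A, r i j]; case: [exists i in B, r i j]; case: (j \in E).
    rewrite cardsU => le.
    have {}le := leq_trans le (leq_subr _ _).
    by move: le; rewrite cA leq_add2l.
  exists (fun i => if i \in A then phi1 i else phi2 i); split.
    move=> i i' iD i'D; case: ifPn => iA; case: ifPn => i'A.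
    - exact: inj1.
    - have [j [-> jA _]] := H1 _ iA.
      have [|j' [-> j'A _]] := H2 i'; first by rewrite inE i'A.
      by move=> [jj]; move: jA j'A; rewrite jj !inE => /andP[-> _].
    - have [j [-> jA _]] := H1 _ i'A.
      have [|j' [-> j'A _]] := H2 i; first by rewrite inE iA.
      by move=> [jj]; move: jA j'A; rewrite -jj !inE => /andP[-> _].
    - by apply: inj2; rewrite inE ?iA ?i'A.
  move=> i iD; case: ifPn => iA.
    have [j [-> jA ij]] := H1 _ iA; exists j; split=> //.
    by move: jA; rewrite inE => /andP[].
  have [|j [-> jA ij]] := H2 i; first by rewrite inE iA.
  by exists j; split=> //; move: jA; rewrite inE => /andP[].
have [j0] : exists j, j \in nbr [set i0] :&: E.
  by apply/card_gt0P; have := HD [set i0]; rewrite cards1 finset.sub1set; apply.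
rewrite 2!inE => /andP[/existsP[i /andP[/set1P -> r0]] j0E].
have [phi [injphi Hphi]] : exists phi : I -> option J,
    {in D :\ i0 &, injective phi} /\
    forall i, i \in D :\ i0 -> exists j, [/\ phi i = Some j, j \in E :\ j0 & r i j].
  apply: IHn.
    by rewrite -ltnS; apply: leq_trans Dn; rewrite [X in (_ < X)%N](cardsD1 i0) i0D.
  move=> A AD; have [->|A0] := eqVneq A finset.set0; first by rewrite cards0.
  have AD' : A \subset D by rewrite (fintype.subset_trans AD) ?finset.subD1set.
  move/existsPn/(_ A): noA; rewrite AD' A0 /= negb_and negbK => nA.
  have : (#|A| < #|nbr A :&: E|)%N.
    rewrite ltn_neqAle HD// andbT; case/orP: nA => // /eqP AeD.
    by move: AD; rewrite AeD => /fintype.subsetP/(_ _ i0D); rewrite !inE eqxx.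
  rewrite (cardsD1 j0 (_ :&: _)) => le; rewrite -ltnS; apply: leq_trans le _.
  rewrite -add1n leq_add ?leq_b1 //; apply: subset_leq_card.
  by apply/fintype.subsetP => j; rewrite !inE; case: (j == j0); case: [exists i in A, r i j]; case: (j \in E).
exists (fun i => if i == i0 then Some j0 else phi i); split.
  move=> i1 i2 i1D i2D; case: eqVneq => [->|n1]; case: eqVneq => [->|n2] //.
  - have [|j [-> jE _]] := Hphi i2; first by rewrite !inE n2.
    by move=> [jj]; move: jE; rewrite -jj !inE eqxx.
  - have [|j [-> jE _]] := Hphi i1; first by rewrite !inE n1.
    by move=> [jj]; move: jE; rewrite jj !inE eqxx.
  - by apply: injphi; rewrite !inE ?n1 ?n2.
move=> i1 i1D; case: eqVneq => [->|n1]; first by exists j0.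
have [|j [-> jE ij]] := Hphi i1; first by rewrite !inE n1.
by exists j; split=> //; move: jE; rewrite !inE => /andP[].
Qed.

Lemma Hall_marriage :
  (forall A : {set I}, (#|A| <= #|[set j | [exists i in A, r i j]]|)%N) ->
  exists phi : I -> J, injective phi /\ forall i, r i (phi i).
Proof.
move=> HA.
have [|phi [inj H]] := @Hall_rec #|I| [set: I] [set: J] (max_card _).
  by move=> A _; rewrite finset.setIT.
have {}H' i : exists j, (phi i = Some j) /\ r i j.
  by have [|j [-> _ ij]] := H i; [rewrite inE|exists j].
have [psi Hpsi] := choice H'.
exists psi; split=> [i i' e|i]; last by have [] := Hpsi i.
apply: inj; rewrite ?inE //.
by have [-> _] := Hpsi i; have [-> _] := Hpsi i'; rewrite e.
Qed.
End Hall.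

(** * Filtered vector spaces and orthogonal bases *)

Section Filtrations.
Context (R : realType) (F : fieldType).

(** Unlike [ell], such a function may take the value [+oo]: the filling filtration does so on chains
    that are not boundaries. *)
Record filtration (V : vectType F) (l : V -> \bar R) : Prop := Filtration {
  filt_eqNy : forall x, l x = -oo%E <-> x = 0;
  filtZ : forall (a : F) x, a != 0 -> l (a *: x) = l x;
  filtD : forall x y, (l (x + y)%R <= maxe (l x) (l y))%E }.

Definition orth_seq (V : vectType F) (l : V -> \bar R) (s : seq V) :=
  forall a : V -> F,
    l (\sum_(x <- s) a x *: x) = \big[maxe/-oo%E]_(x <- s | a x != 0) l x.

Lemma filt_sum_le (V : vectType F) (l : V -> \bar R) (I : Type) (s : seq I)
    (P : pred I) (f : I -> V) (b : \bar R) : filtration l ->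
  (forall i, P i -> (l (f i) <= b)%E) -> (l (\sum_(i <- s | P i) f i)%R <= b)%E.
Proof.
move=> fl h; elim/big_ind: _ => // [|x y hx hy].
  by have [_ ->] := filt_eqNy fl 0; rewrite ?leNye.
by apply: le_trans (filtD fl _ _) _; rewrite ge_max hx hy.
Qed.

(** As [w] is the difference of [c *: v + w] and [c *: v], the assumed bound on [l v] also bounds
    [l w] by the level of the sum. *)
Lemma orth_seq_cons (V : vectType F) (l : V -> \bar R) v s : filtration l ->
  orth_seq l s ->
  (forall (c : F) w, c != 0 -> w \in span s -> (l v <= l (c *: v + w)%R)%E) ->
  orth_seq l (v :: s).
Proof.
move=> fl os h a; rewrite !big_cons.
have [->|av] := eqVneq (a v) 0; first by rewrite scale0r add0r os.
rewrite -os; set w := \sum_(x <- s) _.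
have ws : w \in span s.
  rewrite /w big_seq; apply: memv_suml => x xs.
  by rewrite memvZ// memv_span.
apply/eqP; rewrite eq_le; apply/andP; split.
  by apply: le_trans (filtD fl _ _) _; rewrite filtZ.
rewrite ge_max h//=.
have -> : w = (a v *: v + w) + (- a v) *: v by rewrite scaleNr addrAC subrr add0r.
apply: le_trans (filtD fl _ _) _; rewrite filtZ ?oppr_eq0//.
by rewrite scaleNr addrAC subrr add0r ge_max lexx h.
Qed.

(** A subspace of maximal dimension inside [P] is all of [P], since any further vector of [P] could
    be added to it. *)
Lemma vspace_of_pred (V : vectType F) (P : V -> Prop) :
  P 0 -> (forall (a : F) x y, P x -> P y -> P (a *: x + y)) ->
  exists U : {vspace V}, forall x, x \in U <-> P x.
Proof.
move=> P0 PD.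
pose Q n := `[< exists U : {vspace V}, (\dim U == n) /\ forall x, x \in U -> P x >].
have [||n /asboolP[U [/eqP dU UP]] max] := @ex_maxnP Q (\dim {:V}).
- exists 0; apply/asboolP; exists 0%VS; rewrite dimv0; split=> // x.
  by rewrite memv0 => /eqP ->.
- by move=> n /asboolP[U [/eqP <- _]]; rewrite dimvS ?subvf.
exists U => x; split=> [/UP//|Px]; apply: contrapT => /negP xU.
have : Q (\dim (U + <[x]>)%VS).
  apply/asboolP; exists (U + <[x]>)%VS; split=> // y /memv_addP[u uU [w]].
  move=> /vlineP[a ->] ->; rewrite addrC; apply: PD => //; exact: UP.
move/max; rewrite -dU leqNgt => /negP; apply.
rewrite ltn_neqAle (dimvS (addvSl U _)) andbT (dimv_leqif_eq (addvSl U <[x]>)).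
apply: contra xU => /eqP ->; exact: subvP (addvSr _ _) _ (memv_line _).
Qed.

Lemma seq_min d (T : orderType d) (s : seq T) x0 : x0 \in s ->
  exists2 x, x \in s & forall y, y \in s -> (x <= y)%O.
Proof.
elim: s x0 => // y s IHs x0 _; case: s IHs => [_|z s IHs].
  by exists y; rewrite ?mem_head// => x; rewrite inE => /eqP ->.
have [x xs min] := IHs z (mem_head _ _).
case: (leP y x) => [yx|xy].
  exists y; rewrite ?mem_head// => t; rewrite inE => /predU1P[->//|/min].
  exact: le_trans.
exists x; first by rewrite inE xs orbT.
by move=> t; rewrite inE => /predU1P[->|/min//]; exact: ltW.
Qed.

(* A vector [v] minimizing [l1] splits off orthogonally for both filtrations,
   with complement any hyperplane that contains [{l2 < l2 v}] but not [v]. *)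
Lemma common_orth_basis (V : vectType F) (l1 l2 : V -> \bar R)
    (S : seq (\bar R)) : filtration l1 -> filtration l2 ->
  (forall x, l1 x \in S) -> forall W : {vspace V},
  exists s, [/\ basis_of W s, orth_seq l1 s & orth_seq l2 s].
Proof.
move=> f1 f2 l1S W; have [n] := ubnP (\dim W).
elim: n W => // n IHn W; rewrite ltnS => Wn.
have [W0|W0] := eqVneq W 0%VS.
  exists [::]; rewrite W0 nil_basis; split=> // a; rewrite !big_nil.
    by apply/(filt_eqNy f1).
  by apply/(filt_eqNy f2).
pose vals := [seq z <- S | `[< exists v, [/\ v \in W, v != 0 & l1 v = z] >]].
have [|z] := @seq_min _ _ vals (l1 (vpick W)).
- by rewrite mem_filter l1S andbT; apply/asboolP; exists (vpick W);
    rewrite memv_pick vpick0.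
rewrite mem_filter => /andP[/asboolP[v [vW v0 <-]] _] min.
have {}min w : w \in W -> w != 0 -> (l1 v <= l1 w)%E.
  by move=> wW w0; apply: min; rewrite mem_filter l1S andbT; apply/asboolP; exists w.
have [||U HU] := @vspace_of_pred V (fun x => x \in W /\ (l2 x < l2 v)%E).
- split; first exact: mem0v.
  have [_ ->//] := filt_eqNy f2 0.
  by rewrite ltNye; apply: contra_neq v0 => /(filt_eqNy f2).
- move=> a x y [xW xv] [yW yv]; split; first by rewrite memvD ?memvZ.
  apply: le_lt_trans (filtD f2 _ _) _; rewrite gt_max yv andbT.
  have [->|a0] := eqVneq a 0; last by rewrite filtZ.
  rewrite scale0r; have [_ ->//] := filt_eqNy f2 0.
  by rewrite ltNye; apply: contra_neq v0 => /(filt_eqNy f2).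
have vU : v \notin U by apply/negP => /HU[_]; rewrite ltxx.
pose C := (W :\: (U + <[v]>))%VS; pose W' := (U + C)%VS.
have UvW : (U + <[v]> <= W)%VS.
  by rewrite subv_add -memvE vW andbT; apply/subvP => x /HU[].
have WE : (W = <[v]> + W')%VS.
  by rewrite addvA [(<[v]> + U)%VS]addvC addvC addv_diff (addv_idPl UvW).
have vW' : v \notin W'.
  apply/negP => /memv_addP[u uU [c cC vuc]].
  have : c \in (C :&: (U + <[v]>))%VS.
    rewrite memv_cap cC /=; have -> : c = - u + v by rewrite vuc addKr.
    by rewrite memv_add ?memvN ?memv_line.
  rewrite capv_diff memv0 => /eqP c0; case/negP: vU.
  by rewrite vuc c0 addr0.
have dW' : (\dim W' < n)%N.
  apply: leq_trans Wn; rewrite WE.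
  rewrite ltn_neqAle (dimvS (addvSr _ _)) andbT.
  rewrite (dimv_leqif_eq (addvSr <[v]> W')); apply: contra vW' => /eqP {1}->.
  exact: subvP (addvSl _ _) _ (memv_line _).
have [s [bs o1 o2]] := IHn W' dW'.
have W's : span s = W' by exact: span_basis.
have key (c : F) w : c != 0 -> w \in span s -> c *: v + w \in W /\ c *: v + w \notin W'.
  rewrite W's => c0 wW'; split; first by rewrite WE memv_add// memvZ// memv_line.
  apply: contra vW' => h; rewrite -[v](scalerK c0) memvZ//.
  by rewrite -[c *: v](addrK w) memvB.
exists (v :: s); split.
- rewrite /basis_of free_cons W's vW' (basis_free bs) span_cons W's -WE eqxx //.
- apply: orth_seq_cons => // c w c0 ws; have [h1 h2] := key _ _ c0 ws.
  by apply: min => //; apply: contraNneq h2 => ->; exact: mem0v.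
- apply: orth_seq_cons => // c w c0 ws; have [h1 h2] := key _ _ c0 ws.
  rewrite leNgt; apply: contra h2 => h; apply: subvP (addvSl _ _) _ _.
  by apply/HU.
Qed.

Lemma orth_seq_perm (V : vectType F) (l : V -> \bar R) s t :
  perm_eq s t -> orth_seq l s -> orth_seq l t.
Proof.
move=> st os a.
by rewrite -(perm_big _ st) os (perm_big _ st).
Qed.

Lemma orth_seq_orthogonal (C : fcc R F) k (s : seq (ch C k)) :
  uniq s -> orth_seq (@ell _ _ C k) s -> Defs.orthogonal s.
Proof.
move=> us os lam.
pose a v := if insub (index v s) is Some i then lam i else 0.
have aE (i : 'I_(size s)) : a s`_i = lam i.
  by rewrite /a index_uniq// valK.
have := os a; rewrite (big_nth 0) big_mkord [RHS](big_nth 0) big_mkord => h.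
rewrite -[LHS](_ : ell (\sum_(i < size s) a s`_i *: s`_i) = _).
  by rewrite h; apply: eq_bigl => i; rewrite aE.
by congr ell; apply: eq_bigr => i _; rewrite aE.
Qed.

End Filtrations.

(** * Existence of verbose barcodes *)

Section BarcodeExistence.
Context (R : realType) (F : fieldType) (C : fcc R F).

(** Turns infima of levels into minima. In a Vietoris-Rips complex the levels are [-oo] and the
    diameters of simplices. *)
Definition finitely_valued :=
  forall k, exists S : seq (\bar R), forall x : ch C k, ell x \in S.

Lemma ell0 k : ell (0 : ch C k) = -oo%E.
Proof. exact/ell_eqNy. Qed.

Lemma ell_filtration k : filtration (@ell _ _ C k).
Proof.
by split; [exact: ell_eqNy|move=> a x; exact: ellZ|exact: ellD].
Qed.

Lemma ell_ge_ltNy k (x : ch C k) : x != 0 -> (-oo < ell x)%E.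
Proof. by move=> x0; rewrite ltNye; apply: contra_neq x0 => /ell_eqNy. Qed.

Lemma ell_fin_num k (x : ch C k) : x != 0 -> ell x \is a fin_num.
Proof. by move=> x0; rewrite fin_numElt ell_lty ell_ge_ltNy. Qed.

Lemma limg_cycles k : (limg (bd C k) <= cycles C k)%VS.
Proof.
case: k => [|k]; first exact: subvf.
by apply/subvP => _ /memv_imgP[y _ ->]; rewrite memv_ker bd_bd.
Qed.

Lemma bd_cycles k (y : ch C k.+1) : bd C k y \in cycles C k.
Proof. by apply: subvP (limg_cycles k) _ _; rewrite memv_img ?memvf. Qed.

(** [rho z] is the least level of a filling of [z], and [+oo] if there is none. Since the minimum is
    attained, the axioms for [rho] follow from those for [ell] applied to optimal fillings. *)
Lemma filling_filtration k : finitely_valued ->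
  exists rho : ch C k -> \bar R,
  [/\ forall y, (rho (bd C k y) <= ell y)%E,
      forall z, (rho z < +oo)%E -> exists y, bd C k y = z /\ ell y = rho z &
      filtration rho].
Proof.
move=> fv; have [S HS] := fv k.+1.
have ex z : exists r : \bar R, (forall y, bd C k y = z -> (r <= ell y)%E) /\
    (r = +oo%E \/ exists y, bd C k y = z /\ ell y = r).
  have [[y0 yz]|no] := pselect (exists y, bd C k y = z); last first.
    exists +oo%E; split; [|by left].
    by move=> y yz; exfalso; apply: no; exists y.
  pose vals := [seq s <- S | `[< exists y, bd C k y = z /\ ell y = s >]].
  have [|r rv min] := @seq_min _ _ vals (ell y0).
    by rewrite mem_filter HS andbT; apply/asboolP; exists y0.
  exists r; split.
    move=> y yz'; apply: min; rewrite mem_filter HS andbT.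
    by apply/asboolP; exists y.
  by right; move: rv; rewrite mem_filter => /andP[/asboolP].
have [rho Hrho] := choice ex.
have att z : (rho z < +oo)%E -> exists y, bd C k y = z /\ ell y = rho z.
  by move=> h; have [_ [e|//]] := Hrho z; move: h; rewrite e ltxx.
have le y : (rho (bd C k y) <= ell y)%E by have [+ _] := Hrho (bd C k y); apply.
exists rho; split=> //; split.
- move=> z; split=> [h|->].
    have [|y [zE yz]] := att z; first by rewrite h.
    by move: yz; rewrite h -zE => /ell_eqNy ->; rewrite linear0.
  by have := le 0; rewrite linear0 ell0 leeNy_eq => /eqP.
- have leZ a z : a != 0 -> (rho (a *: z) <= rho z)%E.
    move=> a0; have [h|] := ltP (rho z) +oo%E; last by rewrite leye_eq => /eqP ->; rewrite leey.
    by have [y [<- <-]] := att _ h; rewrite -linearZ /= (le_trans (le _))// ellZ.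
  move=> a z a0; apply/eqP; rewrite eq_le leZ//=.
  by rewrite -{1}[z](scalerK a0) leZ// invr_eq0.
- move=> x y; have [hx|] := ltP (rho x) +oo%E; last first.
    by rewrite leye_eq => /eqP ->; rewrite maxye leey.
  have [hy|] := ltP (rho y) +oo%E; last first.
    by rewrite leye_eq => /eqP ->; rewrite maxey leey.
  have [x' [<- <-]] := att _ hx; have [y' [<- <-]] := att _ hy.
  by rewrite -linearD /= (le_trans (le _))// ellD.
Qed.

Lemma bigmax_le (T : Type) (s : seq T) (P : pred T) (f : T -> \bar R) b :
  (forall i, P i -> (f i <= b)%E) ->
  (\big[maxe/-oo%E]_(i <- s | P i) f i <= b)%E.
Proof.
by move=> h; elim/big_ind: _ => [|x y hx hy|i /h//]; rewrite ?leNye// ge_max hx.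
Qed.

Lemma bigmax_ge (T : eqType) (s : seq T) (P : pred T) (f : T -> \bar R) i :
  i \in s -> P i -> (f i <= \big[maxe/-oo%E]_(i <- s | P i) f i)%E.
Proof.
elim: s => // x s IHs; rewrite inE big_cons => /predU1P[<- ->|/IHs h /h].
  by rewrite le_max lexx.
by case: ifP => // _; rewrite le_max => ->; rewrite orbT.
Qed.

(* The bases come from a common orthogonal basis of the cycles for [ell] and
   for the filling filtration; the [y_i] are optimal fillings. *)
Lemma verbose_barcode_exists k : finitely_valued ->
  exists B, is_verbose_barcode C k B.
Proof.
move=> fv; have [rho [rho_le rho_att f_rho]] := filling_filtration k fv.
have [Sk HSk] := fv k; have [Sk1 HSk1] := fv k.+1.
have fell := ell_filtration.
have [s [bs o1 o2]] := common_orth_basis (fell k) f_rho HSk (cycles C k).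
have [ka [bka oka _]] :=
  common_orth_basis (fell k.+1) (fell k.+1) HSk1 (lker (bd C k)).
have fs := basis_free bs.
have exY z : exists y, z \in limg (bd C k) -> bd C k y = z /\ ell y = rho z.
  have [/memv_imgP[y _ ->]|] := boolP (z \in limg (bd C k)); last by exists 0.
  have [|y' [h1 h2]] := rho_att (bd C k y); last by exists y'.
  by apply: le_lt_trans (rho_le y) (ell_lty _).
have [Y HY] := choice exY.
pose e1 := [seq x <- s | x \in limg (bd C k)].
pose e2 := [seq x <- s | x \notin limg (bd C k)].
have pe : perm_eq s (e1 ++ e2) by rewrite perm_sym; exact/permPl/perm_filterC.
(* A boundary has finite [rho], and by orthogonality this is the maximum over the basis vectors that
   occur in it. So only vectors that have a filling occur. *)
have span1 : (limg (bd C k) <= span e1)%VS.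
  apply/subvP => z zl; have zs : z \in span s.
    by rewrite (span_basis bs) (subvP (limg_cycles k)).
  have [a za _] := free_span fs zs; rewrite za big_seq.
  apply: memv_suml => x xs; have [->|ax] := eqVneq (a x) 0.
    by rewrite scale0r mem0v.
  apply: memvZ; apply: memv_span; rewrite mem_filter xs andbT.
  have [|y [<- _]] := rho_att x; last by rewrite memv_img ?memvf.
  case/memv_imgP: zl => y _ zy; apply: le_lt_trans (ell_lty y).
  apply: le_trans (rho_le y); rewrite -zy za o2.
  exact: (bigmax_ge (P := fun x => a x != 0)).
have be1 : basis_of (limg (bd C k)) e1.
  rewrite /basis_of filter_free// andbT eqEsubv span1 andbT.
  by apply/span_subvP => x; rewrite mem_filter => /andP[].
have se1 : size e1 = \dim (limg (bd C k)).
  by rewrite (size_basis (X := in_tuple e1)).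
have ske : size ka = \dim (lker (bd C k)).
  by rewrite (size_basis (X := in_tuple ka)).
have bdY x : x \in e1 -> bd C k (Y x) = x /\ ell (Y x) = rho x.
  by rewrite mem_filter => /andP[xl _]; exact: HY.
pose y := [seq Y x | x <- e1] ++ ka.
have by' : basis_of fullv y.
  rewrite basisEdim; apply/andP; split; last first.
    rewrite size_cat size_map se1 ske addnC.
    by rewrite -(limg_ker_dim (bd C k) fullv) capfv.
  apply/subvP => v _.
  have : bd C k v \in span e1 by rewrite (subvP span1)// memv_img ?memvf.
  move=> /(free_span (basis_free be1))[a va _].
  have -> : v = \sum_(x <- e1) a x *: Y x + (v - \sum_(x <- e1) a x *: Y x).
    by rewrite addrC subrK.
  rewrite span_cat; apply: memv_add.
    rewrite big_seq; apply: memv_suml => x xe; apply/memvZ/memv_span.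
    exact: map_f.
  rewrite (span_basis bka) memv_ker linearB /= va linear_sum /= subr_eq0.
  apply/eqP; rewrite !big_seq; apply: eq_bigr => x /bdY[h _].
  by rewrite linearZ /= h.
have oy : orth_seq (@ell _ _ C k.+1) y.
  move=> a; rewrite !big_cat !big_map; set w1 := \sum_(j <- e1) _.
  rewrite -oka; set w2 := \sum_(j <- ka) _.
  apply/eqP; rewrite eq_le; apply/andP; split.
    apply: le_trans (ellD _ _) _; rewrite ge_max !le_max lexx orbT andbT.
    apply/orP; left; rewrite /w1 big_seq.
    apply: filt_sum_le (fell _) _ => x xe; have [->|ax] := eqVneq (a (Y x)) 0.
      by rewrite scale0r ell0 leNye.
    rewrite ellZ//.
    pose P0 z : bool := a (Y z) != 0%R.
    exact: (bigmax_ge (P := P0) (fun z => ell (Y z))).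
  (* The boundary kills [w2] and turns [w1] into a combination of the [x]. As the fillings are
     optimal, [ell (Y x) = rho x], and orthogonality for [rho] gives the bound. *)
  have m1 : (\big[maxe/-oo]_(j <- e1 | a (Y j) != 0%R) ell (Y j) <=
      ell (w1 + w2)%R)%E.
    have bw2 : bd C k w2 = 0.
      apply/eqP; rewrite -memv_ker -(span_basis bka) /w2 big_seq.
      by apply: memv_suml => x xe; apply/memvZ/memv_span.
    apply: le_trans (rho_le _); rewrite linearD /= bw2 addr0.
    pose a' x := if x \in limg (bd C k) then a (Y x) else 0.
    have -> : bd C k w1 = \sum_(x <- s) a' x *: x.
      rewrite linear_sum big_filter [RHS](bigID (fun x => x \in limg (bd C k))) /=.
      rewrite [X in _ + X]big1 => [|x]; last first.
        by rewrite /a' => /negbTE ->; rewrite scale0r.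
      rewrite addr0; apply: eq_bigr => x xl.
      by rewrite linearZ /= /a' xl; have [-> _] := HY _ xl.
    rewrite o2 big_seq_cond; apply: bigmax_le => x /andP[xe ax].
    have [_ ->] := bdY _ xe; move: xe; rewrite mem_filter => /andP[xl xs].
    by apply: (bigmax_ge (P := fun x => a' x != 0)); rewrite // /a' xl.
  rewrite ge_max m1 /=.
  have := ellD (- w1) (w1 + w2); rewrite addKr => /le_trans; apply.
  rewrite ge_max lexx andbT.
  have lw1 : (ell w1 <= ell (w1 + w2)%R)%E.
    apply: le_trans _ m1; rewrite {1}/w1 big_seq.
    apply: filt_sum_le (fell _) _ => x xe; have [->|ax] := eqVneq (a (Y x)) 0.
      by rewrite scale0r ell0 leNye.
    rewrite ellZ//.
    pose P0 z : bool := a (Y z) != 0%R.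
    exact: (bigmax_ge (P := P0) (fun z => ell (Y z))).
  by rewrite -scaleN1r ellZ ?oppr_eq0 ?oner_eq0.
eexists; exists y, (e1 ++ e2); split; last reflexivity.
- by split=> //; apply: orth_seq_orthogonal => //; exact: free_uniq (basis_free by').
- split; first by rewrite -(perm_basis _ pe).
  apply: orth_seq_orthogonal; first by rewrite -(perm_uniq pe); exact: free_uniq.
  exact: orth_seq_perm pe o1.
- by rewrite -se1 take_size_cat// drop_size_cat ?size_map.
- move=> i; rewrite -se1 => ie; rewrite !nth_cat size_map ie (nth_map 0)//.
  by case: (bdY e1`_i) => //; exact: mem_nth.
Qed.

Lemma verbose_barcodeP k : finitely_valued ->
  is_verbose_barcode C k (verbose_barcode C k).
Proof. by move=> /(verbose_barcode_exists k)[B HB]; exact: xgetPex (ex_intro _ B HB). Qed.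

End BarcodeExistence.

(** * Bars detected by coordinate functionals *)

Section BarBasis.
Context (R : realType) (F : fieldType) (C : fcc R F) (k : nat).

Definition bar (B : seq (\bar R * \bar R)) (i : 'I_(size B)) := tnth (in_tuple B) i.

Lemma bar_nth B (i : 'I_(size B)) b0 : bar i = nth b0 B i.
Proof. exact: tnth_nth. Qed.

(* The coordinate functionals [c] detect the births and deaths of the bars. *)
Record bar_basis (B : seq (\bar R * \bar R)) (e : 'I_(size B) -> ch C k)
    (c : 'I_(size B) -> ch C k -> F) : Prop := BarBasis {
  bb_cycle : forall i, e i \in cycles C k;
  bb_sum : forall z, z \in cycles C k -> z = \sum_i c i z *: e i;
  bb_lin : forall i, linear (c i : ch C k -> F^o);
  bb_dual : forall i j, c i (e j) = (i == j)%:R;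
  bb_birth : forall i z, z \in cycles C k -> c i z != 0 ->
    ((bar i).1 <= ell z)%E;
  bb_death : forall i y, c i (bd C k y) != 0 -> ((bar i).2 <= ell y)%E;
  bb_ell : forall i, ell (e i) = (bar i).1;
  bb_fill : forall i, (bar i).2 = +oo%E \/
    exists y, bd C k y = e i /\ ell y = (bar i).2 }.

(** [c i] is the coordinate at [x_i], so orthogonality of [x] gives the births. On [bd y] it is the
    coordinate of [y] at [y_i] if [i < r], and zero otherwise; hence orthogonality of [y] gives the
    deaths. *)
Lemma verbose_barcode_basis B : is_verbose_barcode C k B ->
  exists e c, @bar_basis B e c.
Proof.
move=> [y [x]]; set r := \dim _; case=> [[by' oy] [bx ox] [bk bl] xy BE].
have sB : size B = size x by rewrite BE size_map size_iota.
pose e (i : 'I_(size B)) := x`_i.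
pose c (i : 'I_(size B)) z := coord (in_tuple x) (cast_ord sB i) z.
have barE (i : 'I_(size B)) : bar i = (ell x`_i, if (i < r)%N then ell y`_i else +oo%E).
  rewrite (bar_nth _ (0%E, 0%E)) {1}BE (nth_map 0%N); last first.
    by rewrite size_iota -sB.
  by rewrite nth_iota -?sB.
have rx : (r <= size x)%N.
  by rewrite /r (size_basis (X := in_tuple _) bl) size_take; case: ltnP => // /ltnW.
have ry : (r <= size y)%N.
  have := size_basis (X := in_tuple _) by'; have := limg_ker_dim (bd C k) fullv.
  by rewrite /r => <- <-; rewrite leq_addl.
have fx := basis_free bx.
have sumx z : z \in cycles C k -> z = \sum_(i < size x) coord (in_tuple x) i z *: x`_i.
  by move=> zc; rewrite {1}(coord_basis (X := in_tuple x) bx zc).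
have sumy z : z = \sum_(i < size y) coord (in_tuple y) i z *: y`_i.
  by rewrite {1}(coord_basis (X := in_tuple y) by' (memvf z)).
exists e, c; split.
- by move=> i; apply: (basis_mem bx); rewrite mem_nth// -sB.
- move=> z /sumx {1}->; rewrite (reindex (cast_ord sB)) //=.
  by exists (cast_ord (esym sB)) => i _; rewrite ?cast_ordK ?cast_ordKV.
- by move=> i a u v; rewrite /c linearP.
- move=> i j; rewrite /c /e -[x`_j]/(x`_(cast_ord sB j)).
  by rewrite (coord_free (X := in_tuple x)) // (inj_eq (@cast_ord_inj _ _ sB)) eq_sym.
- move=> i z zc ci; rewrite barE /= (sumx _ zc) ox.
  by rewrite (bigD1 (cast_ord sB i))//= le_max lexx.
- move=> i z ci.
  have /existsP[j /andP[bj cj]] : [exists j : 'I_(size y),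
      (coord (in_tuple y) j z != 0) && (c i (bd C k y`_j) != 0)].
    apply: contraNT ci => /existsPn h; rewrite (sumy z) !linear_sum /=.
    rewrite /c linear_sum big1// => j _; rewrite !linearZ /=.
    have := h j; rewrite negb_and !negbK => /orP[/eqP ->|/eqP].
      by rewrite mul0r.
    by rewrite /c => ->; rewrite mulr0.
  have jr : (j < r)%N.
    rewrite ltnNge; apply: contra cj => rj.
    have : y`_j \in lker (bd C k).
      apply: (basis_mem bk).
      rewrite -(subnKC rj) -nth_drop mem_nth// size_drop ltn_sub2r//.
      exact: leq_ltn_trans rj (ltn_ord j).
    by rewrite memv_ker /c => /eqP ->; rewrite linear0.
  have ij : (i : nat) = j.
    apply/eqP; apply: contraNT cj => ij; rewrite xy//.
    have jx : (j < size x)%N by exact: leq_trans rx.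
    rewrite /c -[x`_j]/(x`_(Ordinal jx)) (coord_free (X := in_tuple x))//.
    suff -> : (Ordinal jx == cast_ord sB i) = false by [].
    by apply/eqP => /(congr1 val) /= ji; rewrite ji eqxx in ij.
  rewrite barE /= ij jr (sumy z) oy.
  by rewrite (bigD1 j)//= le_max lexx.
- by move=> i; rewrite barE.
- move=> i; rewrite barE /=; case: ifP => ir; last by left.
  by right; exists y`_i; rewrite xy.
Qed.

End BarBasis.

(** * Matching bars along shift maps *)

Section Matching.
Context (R : realType) (F : fieldType).

Lemma lin_sum (U V : lmodType F) (f : U -> V) (I : Type) (s : seq I)
    (a : I -> F) (x : I -> U) : linear f ->
  f (\sum_(i <- s) a i *: x i) = \sum_(i <- s) a i *: f (x i).
Proof.
move=> lf; pose fL : {linear U -> V} := HB.pack f (GRing.isLinear.Build _ _ _ _ f lf).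
rewrite -[f]/(fL : U -> V) linear_sum; apply: eq_bigr => i _; exact: linearZ.
Qed.

Lemma lin0 (U V : lmodType F) (f : U -> V) : linear f -> f 0 = 0.
Proof.
move=> lf; pose fL : {linear U -> V} := HB.pack f (GRing.isLinear.Build _ _ _ _ f lf).
exact: (linear0 fL).
Qed.

Lemma linD (U V : lmodType F) (f : U -> V) x y : linear f -> f (x + y) = f x + f y.
Proof. by move=> lf; have := lf 1 x y; rewrite !scale1r. Qed.

Lemma edist_EFin (r s : R) : Defs.edist r%:E s%:E = `|r - s|%:E.
Proof. by rewrite /Defs.edist; case: eqVneq => // -[->]; rewrite subrr normr0. Qed.

Lemma bar_dist0 (a b : \bar R * \bar R) : a.1 \is a fin_num -> b.1 \is a fin_num ->
  a.2 != -oo%E -> b.2 != -oo%E -> (bar_dist a b <= 0)%E -> a = b.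
Proof.
case: a b => [[a1| |] a2] [[b1| |] b2] //= _ _; rewrite /bar_dist /=.
have e0 (r s : R) : (Defs.edist r%:E s%:E <= 0)%E -> r = s.
  by rewrite edist_EFin lee_fin normr_le0 subr_eq0 => /eqP.
case: a2 b2 => [a2| |] [b2| |] //= _ _; rewrite ?ltry ?ltxx ?eqxx //=.
  by rewrite ge_max => /andP[/e0 -> /e0 ->].
by move=> /e0 ->.
Qed.

Section BarFacts.
Variables (C : fcc R F) (k : nat) (B : seq (\bar R * \bar R)).
Variables (e : 'I_(size B) -> ch C k) (c : 'I_(size B) -> ch C k -> F).
Hypothesis be : bar_basis e c.

Lemma bb_neq0 i : e i != 0.
Proof.
apply/eqP => ei; have := bb_dual be i i; rewrite ei (lin0 (bb_lin be i)) eqxx.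
by move=> /esym/eqP; rewrite oner_eq0.
Qed.

Lemma bar1_fin (i : 'I_(size B)) : (bar i).1 \is a fin_num.
Proof. by rewrite -(bb_ell be) ell_fin_num ?bb_neq0. Qed.

Lemma bar_le (i : 'I_(size B)) : ((bar i).1 <= (bar i).2)%E.
Proof.
have [->|[y [ey <-]]] := bb_fill be i; first by rewrite leey.
by rewrite -(bb_ell be) -ey ell_bd.
Qed.

Lemma bar2_gtNy (i : 'I_(size B)) : (bar i).2 != -oo%E.
Proof.
rewrite -ltNye; apply: lt_le_trans (bar_le i).
by have := bar1_fin i; rewrite fin_numElt => /andP[].
Qed.
End BarFacts.

(** This is what the barcode in degree [k] sees of a filtered map: the levels of cycles, and the
    levels at which boundaries are filled. It leaves room for maps that exist in one degree only. *)
Record shift_map (C D : fcc R F) (k : nat) (delta : R)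
    (f : ch C k -> ch D k) : Prop := ShiftMap {
  sm_lin : linear f;
  sm_cycle : forall z, z \in cycles C k -> f z \in cycles D k;
  sm_ell : forall z, z \in cycles C k -> (ell (f z) <= ell z + delta%:E)%E;
  sm_fill : forall y, exists y', bd D k y' = f (bd C k y) /\
    (ell y' <= ell y + delta%:E)%E }.

Definition trunc (M : R) (x : \bar R) : R := if x == +oo%E then M else fine x.

Lemma trunc_fin M (x : \bar R) : x != +oo%E -> trunc M x = fine x.
Proof. by rewrite /trunc => /negbTE ->. Qed.

Lemma fin_num_of (x : \bar R) : x != -oo%E -> x != +oo%E -> x \is a fin_num.
Proof. by case: x. Qed.

(* Bjerkevik's argument: order the bars by [birth + death] (with a large
   constant [M] in place of an infinite death).  A bar of [D] contributing to the
   [(i, i')] entry of the product of the matrices of [f] and [g] is then close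
   to [i] or to [i'], so this product is unitriangular on [A] already after
   deleting the bars of [D] which are not close to any bar in [A]. *)
Lemma Hall_condition (C D : fcc R F) k (B B' : seq (\bar R * \bar R))
    (e : 'I_(size B) -> ch C k) c (e' : 'I_(size B') -> ch D k) c'
    (delta : R) (f : ch C k -> ch D k) (g : ch D k -> ch C k)
    (A : {set 'I_(size B)}) :
  bar_basis e c -> bar_basis e' c' -> 0 <= delta ->
  shift_map delta f -> shift_map delta g ->
  {in A &, forall i i', c i' (g (f (e i))) = (i == i')%:R} ->
  (#|A| <= #|[set j | [exists i in A,
     (bar_dist (bar i) (bar (j : 'I_(size B'))) <= delta%:E)%E]]|)%N.
Proof.
move=> be be' d0 sf sg gf; set N := [set j | _].
pose S := \sum_i `|fine (bar (i : 'I_(size B))).2| +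
  \sum_j `|fine (bar (j : 'I_(size B'))).2|.
(* [M] exceeds every finite death by at least [delta + 1], so after truncation a finite and an
   infinite bar are never within [delta]. *)
pose M := 1 + delta + S.
have MB (i : 'I_(size B)) : fine (bar i).2 + delta + 1 <= M.
  rewrite /M /S (bigD1 i) //=; have := ler_norm (fine (bar i).2).
  have : 0 <= \sum_(j | j != i) `|fine (bar (j : 'I_(size B))).2| by exact: sumr_ge0.
  have : 0 <= \sum_j `|fine (bar (j : 'I_(size B'))).2| by exact: sumr_ge0.
  lra.
have MB' (i : 'I_(size B')) : fine (bar i).2 + delta + 1 <= M.
  rewrite /M /S [X in _ <= _ + (_ + X)](bigD1 i) //=; have := ler_norm (fine (bar i).2).
  have : 0 <= \sum_(j | j != i) `|fine (bar (j : 'I_(size B'))).2| by exact: sumr_ge0.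
  have : 0 <= \sum_j `|fine (bar (j : 'I_(size B))).2| by exact: sumr_ge0.
  lra.
pose p (i : 'I_(size B)) := fine (bar i).1.
pose q (i : 'I_(size B)) := trunc M (bar i).2.
pose p' (i : 'I_(size B')) := fine (bar i).1.
pose q' (i : 'I_(size B')) := trunc M (bar i).2.
pose P i j := c' j (f (e i)); pose Q j i := c i (g (e' j)).
(* A nonzero matrix entry bounds the birth and the death of the target bar by those of the source
   plus [delta]. The complexes are generic because this is applied to [f] and to [g]. *)
have step : forall (C1 D1 : fcc R F) (B1 B1' : seq (\bar R * \bar R))
    (e1 : 'I_(size B1) -> ch C1 k) c1 (e1' : 'I_(size B1') -> ch D1 k) c1'
    (h : ch C1 k -> ch D1 k) i j,
    bar_basis e1 c1 -> bar_basis e1' c1' -> shift_map delta h ->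
    (fine (bar (j : 'I_(size B1'))).2 + delta + 1 <= M) ->
    c1' j (h (e1 i)) != 0 ->
    fine (bar (j : 'I_(size B1'))).1 <= fine (bar (i : 'I_(size B1))).1 + delta /\
    trunc M (bar (j : 'I_(size B1'))).2 <= trunc M (bar (i : 'I_(size B1))).2 + delta.
  move=> C1 D1 B1 B1' e1 c1 e1' c1' h i j b1 b1' sh MB1 cn0; split.
    rewrite -lee_fin EFinD !fineK ?(bar1_fin b1) ?(bar1_fin b1')//.
    apply: le_trans (bb_birth b1' (sm_cycle sh (bb_cycle b1 i)) cn0) _.
    by apply: le_trans (sm_ell sh (bb_cycle b1 i)) _; rewrite (bb_ell b1).
  have [iy|[y [ye yi]]] := bb_fill b1 i.
    by rewrite {2}/trunc iy eqxx /trunc; case: ifP => _; move: MB1 d0; lra.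
  have [y' [y'e y'l]] := sm_fill sh y.
  have jy' : ((bar j).2 <= ell y')%E.
    by apply: (bb_death b1'); rewrite y'e ye.
  have fj : (bar j).2 \is a fin_num.
    apply: fin_num_of; first exact: bar2_gtNy b1' _.
    by rewrite -ltey; apply: le_lt_trans jy' (ell_lty _).
  have fi : (bar i).2 \is a fin_num.
    by apply: fin_num_of; [exact: bar2_gtNy b1 _|rewrite -ltey -yi ell_lty].
  rewrite !trunc_fin ?fin_numE; last 2 first.
  - by case/andP: fi.
  - by case/andP: fj.
  rewrite -lee_fin EFinD !fineK//; apply: le_trans jy' _.
  by rewrite -yi.
have HP i j : P i j != 0 -> p' j <= p i + delta /\ q' j <= q i + delta.
  exact: step be be' sf (MB' j).
have HQ j i : Q j i != 0 -> p i <= p' j + delta /\ q i <= q' j + delta.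
  exact: step be' be sg (MB i).
have close i j : `|p i - p' j| <= delta -> `|q i - q' j| <= delta ->
    (bar_dist (bar i) (bar (j : 'I_(size B'))) <= delta%:E)%E.
  rewrite /p /p' /q /q'; move: (MB i) (MB' j) (bar1_fin be i) (bar1_fin be' j).
  move: (bar2_gtNy be i) (bar2_gtNy be' j); rewrite /bar_dist.
  case: (bar i) (bar j) => [[a1| |] [a2| |]] [[b1| |] [b2| |]] //= _ _ h1 h2 _ _;
    rewrite ?ltry ?ltxx ?eqxx /trunc ?eqxx ?edist_EFin //=.
  - by rewrite ge_max !lee_fin => -> ->.
  - by move=> _; rewrite ler_distl => /andP[]; move: h1 h2 => /= h1 h2 h3 h4; exfalso; lra.
  - by move=> _; rewrite ler_distl => /andP[]; move: h1 h2 => /= h1 h2 h3 h4; exfalso; lra.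
have PQ i i' : \sum_j P i j * Q j i' = c i' (g (f (e i))).
  rewrite (bb_sum be' (sm_cycle sf (bb_cycle be i))) (lin_sum _ _ _ (sm_lin sg)).
  by rewrite (lin_sum (V := F^o) _ _ _ (bb_lin be i')).
apply: (@card_le_unitriangular F R _ _ A N P Q (fun i => p i + q i)).
move=> i i' iA i'A rk; rewrite -gf// -PQ big_mkcond; apply: eq_bigr => j _.
case: ifPn => // jN; have [->|Pn] := eqVneq (P i j) 0; first by rewrite mul0r.
have [->|Qn] := eqVneq (Q j i') 0; first by rewrite mulr0.
exfalso; move: jN; rewrite inE => /existsPn jN.
have [h1 h2] := HP _ _ Pn; have [h3 h4] := HQ _ _ Qn.
(* If [j] is not close to [i], one coordinate drops by more than [delta] and the other rises by at
   most [delta], so [p' j + q' j < p i + q i]. In the same way [p i' + q i' < p' j + q' j], and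
   together these contradict [rk]. *)
have ni : ~ (`|p i - p' j| <= delta /\ `|q i - q' j| <= delta).
  by case=> u v; have := jN i; rewrite iA close.
have ni' : ~ (`|p i' - p' j| <= delta /\ `|q i' - q' j| <= delta).
  by case=> u v; have := jN i'; rewrite i'A close.
have {}ni : p' j < p i - delta \/ q' j < q i - delta.
  apply: contrapT => /not_orP[/negP + /negP]; rewrite -!leNgt => u v; apply: ni.
  by rewrite !ler_distl; split; apply/andP; split; lra.
have {}ni' : p i' < p' j - delta \/ q i' < q' j - delta.
  apply: contrapT => /not_orP[/negP + /negP]; rewrite -!leNgt => u v; apply: ni'.
  by rewrite !ler_distl; split; apply/andP; split; lra.
by move: rk => /=; case: ni; case: ni'; lra.
Qed.

(** Hall's theorem gives an injection. The Hall condition for [g] on all bars of [D] shows that [B']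
    has no more bars than [B], so the injection is bijective. *)
Theorem bar_matching (C D : fcc R F) k (B B' : seq (\bar R * \bar R))
    (delta : R) (f : ch C k -> ch D k) (g : ch D k -> ch C k) :
  is_verbose_barcode C k B -> is_verbose_barcode D k B' -> 0 <= delta ->
  shift_map delta f -> shift_map delta g ->
  (forall z, z \in cycles C k -> g (f z) = z) ->
  (forall z, z \in cycles D k -> f (g z) = z) ->
  exists phi : 'I_(size B) -> 'I_(size B'), bijective phi /\
    forall i, (bar_dist (bar i) (bar (phi i)) <= delta%:E)%E.
Proof.
move=> /verbose_barcode_basis[e [c be]] /verbose_barcode_basis[e' [c' be']].
move=> d0 sf sg gf fg.
have HA A := @Hall_condition _ _ _ _ _ e c e' c' delta f g A be be' d0 sf sg.
have HA' A := @Hall_condition _ _ _ _ _ e' c' e c delta g f A be' be d0 sg sf.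
have gfe i i' : c i' (g (f (e i))) = (i == i')%:R.
  by rewrite gf ?(bb_cycle be)// (bb_dual be) eq_sym.
have fge i i' : c' i' (f (g (e' i))) = (i == i')%:R.
  by rewrite fg ?(bb_cycle be')// (bb_dual be') eq_sym.
have [A|phi [iphi H]] := @Hall_marriage _ _
    (fun i j => (bar_dist (bar (i : 'I_(size B))) (bar (j : 'I_(size B'))) <= delta%:E)%E).
  by apply: HA => i i' _ _; exact: gfe.
exists phi; split=> //; apply: inj_card_bij => //; rewrite !card_ord.
have := HA' [set: _]; rewrite cardsT card_ord => h.
apply: leq_trans (h _) _; first by move=> i i' _ _; exact: fge.
by rewrite -[leqRHS]card_ord max_card.
Qed.

Lemma count_bars (B : seq (\bar R * \bar R)) (p : pred (\bar R * \bar R)) :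
  count p B = #|[set i : 'I_(size B) | p (bar i)]|.
Proof.
rewrite cardsE -sum1_card -sum1_count (big_nth (0%E, 0%E)) big_mkord.
by apply: eq_bigl => i; rewrite /= -(bar_nth i) unfold_in.
Qed.

(** At [delta = 0] close bars are equal, so the neighbours of the bars equal to [v] are equal to
    [v]. The error [bd C k w] has no coordinate at such a bar: that would need [v.2 <= ell w], but
    [ell w] is at most the birth [v.1]. *)
Theorem concise_count_le (C D : fcc R F) k (B B' : seq (\bar R * \bar R))
    (f : ch C k -> ch D k) (g : ch D k -> ch C k) :
  is_verbose_barcode C k B -> is_verbose_barcode D k B' ->
  shift_map 0 f -> shift_map 0 g ->
  (forall z, z \in cycles C k -> exists w,
     g (f z) = z + bd C k w /\ (ell w <= ell z)%E) ->
  forall v, (v.1 < v.2)%E -> (count_mem v B <= count_mem v B')%N.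
Proof.
move=> /verbose_barcode_basis[e [c be]] /verbose_barcode_basis[e' [c' be']].
move=> sf sg gf v v12; rewrite !count_bars; set A := [set i | _].
have := @Hall_condition _ _ _ _ _ e c e' c' 0 f g A be be' (lexx _) sf sg.
move=> h; apply: leq_trans (h _) _.
  move=> i i'; rewrite !inE => /eqP iv /eqP i'v.
  have [w [-> wl]] := gf _ (bb_cycle be i).
  rewrite (linD (V := F^o) _ _ (bb_lin be i')) (bb_dual be) eq_sym.
  have [->|cw] := eqVneq (c i' (bd C k w)) 0; first by rewrite addr0.
  have := le_trans (bb_death be cw) wl; rewrite (bb_ell be) iv i'v.
  by rewrite leNgt v12.
apply: subset_leq_card; apply/fintype.subsetP => j; rewrite !inE.
move=> /existsP[i]; rewrite inE => /andP[/eqP <- /bar_dist0 ->] //.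
- exact: bar1_fin be _.
- exact: bar1_fin be' _.
- exact: bar2_gtNy be _.
- exact: bar2_gtNy be' _.
Qed.

End Matching.

(** * From interleavings to matchings *)

Section Interleavings.
Context (R : realType) (F : fieldType).

Lemma ell_le_fine (C : fcc R F) k (x : ch C k) : (ell x <= (fine (ell x))%:E)%E.
Proof.
have [->|x0] := eqVneq x 0; first by rewrite !ell0 leNye.
by rewrite fineK// ell_fin_num.
Qed.

Record filtered_map (C D : fcc R F) (delta : R)
    (f : forall k, ch C k -> ch D k) : Prop := FilteredMap {
  fm_lin : forall k, linear (f k);
  fm_ell : forall k (x : ch C k), (ell (f k x) <= ell x + delta%:E)%E;
  fm_bd : forall k (x : ch C k.+1), f k (bd C k x) = bd D k (f k.+1 x) }.

Let glob_key (C D : fcc R F) (delta : R) (f : R -> forall k, ch C k -> ch D k) :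
  commutes_with_inclusions f -> forall t k (x : ch C k),
  in_sublevel t x -> f (fine (ell x)) k x = f t k x.
Proof.
move=> cf t k x xt; have /orP[le|le] := le_total (fine (ell x)) t.
  by apply: cf => //; exact: ell_le_fine.
by rewrite [RHS](cf t (fine (ell x))).
Qed.

Let glob_filtered (C D : fcc R F) (delta : R) (f : R -> forall k, ch C k -> ch D k) :
  commutes_with_inclusions f -> (forall t, chain_map_on t (t + delta) (f t)) ->
  filtered_map delta (fun k x => f (fine (ell x)) k x).
Proof.
move=> cf hf; have key := glob_key delta cf.
have lf k : linear (fun x : ch C k => f (fine (ell x)) k x).
  move=> a x y /=.
  pose t := Num.max (fine (ell (a *: x + y))) (Num.max (fine (ell x)) (fine (ell y))).
  have sub z : fine (ell z) <= t -> in_sublevel t (z : ch C k).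
    by move=> zt; apply: le_trans (ell_le_fine z) _; rewrite lee_fin.
  rewrite !(key t) ?sub ?le_max ?lexx ?orbT//.
  by have [_ + _] := hf t; apply; rewrite sub ?le_max ?lexx ?orbT.
split=> [//|k x|k x].
  have [->|x0] := eqVneq x 0.
    by have /= -> := lin0 (lf k); rewrite !ell0 leNye.
  have [+ _ _] := hf (fine (ell x)) => /(_ k x (ell_le_fine x)).
  by rewrite /in_sublevel EFinD fineK ?ell_fin_num.
have [_ _ <-] := hf (fine (ell x)); last exact: ell_le_fine.
by apply: key; apply: le_trans (ell_bd _) (ell_le_fine _).
Qed.

(** Above the level of [x] the value [f t k x] does not depend on [t], so evaluation at
    [fine (ell x)] glues the [f t] into one map. For [x = 0] the default level [0] is used, which is
    harmless. *)
Lemma interleaved_global (C D : fcc R F) (delta : R) : interleaved C D delta ->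
  exists (f : forall k, ch C k -> ch D k) (g : forall k, ch D k -> ch C k),
  [/\ filtered_map delta f, filtered_map delta g,
      forall k x, g k (f k x) = x & forall k y, f k (g k y) = y].
Proof.
move=> [f [g [[hf hg] [cf cg] gf fg]]].
exists (fun k x => f (fine (ell x)) k x), (fun k x => g (fine (ell x)) k x).
split; [exact: glob_filtered|exact: glob_filtered| |] => k x /=.
  rewrite (@glob_key _ _ delta g cg (fine (ell x) + delta)) ?gf//; first exact: ell_le_fine.
  by have [+ _ _] := hf (fine (ell x)); apply; exact: ell_le_fine.
rewrite (@glob_key _ _ delta f cf (fine (ell x) + delta)) ?fg//; first exact: ell_le_fine.
by have [+ _ _] := hg (fine (ell x)); apply; exact: ell_le_fine.
Qed.

Lemma filtered_shift (C D : fcc R F) delta f k :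
  @filtered_map C D delta f -> shift_map delta (f k).
Proof.
move=> [lf ef bf]; split=> // [z|y]; last by exists (f k.+1 y); rewrite bf.
case: k z => [|k] z /=; first by rewrite !memvf.
by rewrite !memv_ker -bf => /eqP ->; rewrite (lin0 (lf _)).
Qed.

Lemma dM_le (A B : multiset (\bar R * \bar R)) (b : \bar R)
    (phi : ms_index A -> ms_index B) : (0 <= b)%E -> bijective phi ->
  (forall i, (bar_dist (ms_elt i) (ms_elt (phi i)) <= b)%E) -> (dM A B <= b)%E.
Proof.
move=> b0 bphi h; apply: ge_ereal_inf; eexists; first by exists phi; split.
by rewrite ge_max b0 /=; apply: ge_ereal_sup => _ [i _ <-].
Qed.

Lemma dM_le_dI (C D : fcc R F) k : finitely_valued C -> finitely_valued D ->
  (dM (ms_of_seq (verbose_barcode C k)) (ms_of_seq (verbose_barcode D k))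
   <= dI C D)%E.
Proof.
move=> fC fD; apply: le_ereal_inf_tmp => _ [delta [d0 il] <-].
have [f [g [ff fg gf fgK]]] := interleaved_global il.
have [||phi [bphi H]] := bar_matching (verbose_barcodeP k fC) (verbose_barcodeP k fD) d0
  (filtered_shift k ff) (filtered_shift k fg).
- by move=> z _; exact: gf.
- by move=> z _; exact: fgK.
by apply: (@dM_le (ms_of_seq _) (ms_of_seq _) _ phi); rewrite ?lee_fin.
Qed.

Lemma VR_finitely_valued (X : fin_pmetric R) : finitely_valued (VR F X).
Proof.
move=> k; exists (-oo%E :: [seq (diam (val s))%:E | s : simplex X k]) => x.
rewrite /= /VR_ell; elim/big_ind: _ => [|a b ha hb|s _]; first exact: mem_head.
  by rewrite maxEle; case: ifP.
by rewrite inE; apply/orP; right; apply: map_f; rewrite mem_enum.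
Qed.

Lemma in_class_MapCor (X Y : fin_pmetric R) (T : tripod X Y) :
  in_class Map T -> in_class Cor T.
Proof. by move=> [f [g ->]]; eexists; eexists. Qed.

Definition class_incl (sq sq' : tripod_class) :=
  forall (X Y : fin_pmetric R) (T : tripod X Y), in_class sq T -> in_class sq' T.

Lemma class_Tri sq : class_incl sq Tri. Proof. by []. Qed.

Lemma class_Map sq : class_incl Map sq.
Proof. by case: sq => // X Y T /in_class_MapCor. Qed.

Lemma pullback_dI_incl sq sq' (X Y : fin_pmetric R) : class_incl sq sq' ->
  (pullback_dI F sq' X Y <= pullback_dI F sq X Y)%E.
Proof.
move=> h; apply: ereal_inf_le_tmp => _ [T [cT ->]].
by exists T; split=> //; exact: h.
Qed.

Lemma pullback_dB_incl k sq sq' (X Y : fin_pmetric R) : class_incl sq sq' ->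
  (pullback_dB F k sq' X Y <= pullback_dB F k sq X Y)%E.
Proof.
move=> h; apply: ereal_inf_le_tmp => _ [T [cT ->]].
by exists T; split=> //; exact: h.
Qed.

Lemma pullback_dB_le_dI k sq (X Y : fin_pmetric R) :
  (pullback_dB F k sq X Y <= pullback_dI F sq X Y)%E.
Proof.
apply: le_ereal_inf_tmp => _ [T [cT ->]].
apply: ge_ereal_inf; eexists; first by exists T; split.
by apply: dM_le_dI; exact: VR_finitely_valued.
Qed.

End Interleavings.

(** * Diameters, distortion and the Gromov-Hausdorff bound *)

Section Diameter.
Context (R : realType) (X : fin_pmetric R).

Lemma diam_leP (s : {set X}) (b : R) : 0 <= b ->
  reflect (forall x y, x \in s -> y \in s -> pm_dist x y <= b) (diam s <= b).
Proof.
move=> b0; apply: (iffP (bigmax_leP _ _ _ _)) => [[_ h] x y xs ys|h].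
  by have /bigmax_leP[_] := h x xs; apply.
by split=> // x xs; apply/bigmax_leP; split=> // y ys; exact: h.
Qed.

Lemma diam_ge0 (s : {set X}) : 0 <= diam s.
Proof. exact: bigmax_ge_id. Qed.

Lemma diam_ge (s : {set X}) x y : x \in s -> y \in s -> pm_dist x y <= diam s.
Proof. by move: x y; apply/diam_leP; rewrite ?diam_ge0. Qed.

Lemma VR_ell_ge (F : fieldType) k (c : VR_ch F X k) s :
  c s != 0 -> ((diam (val s))%:E <= VR_ell c)%E.
Proof. by move=> cs; have /VR_ell_leP/(_ s cs) := lexx (VR_ell c). Qed.

Lemma VR_ell_ge0 (F : fieldType) k (c : VR_ch F X k) : c != 0 -> (0 <= VR_ell c)%E.
Proof.
move=> c0; have /existsP[s cs] : [exists s, c s != 0].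
  apply: contraNT c0 => /existsPn h; apply/eqP/ffunP => s; rewrite ffunE.
  by apply/eqP; rewrite -[_ == _]negbK h.
by apply: le_trans (VR_ell_ge cs); rewrite lee_fin diam_ge0.
Qed.
End Diameter.

Section GromovHausdorff.
Context (R : realType) (F : fieldType).

(** Both complexes have the same vertices, oriented by the same enumeration, so the identity is a
    chain map. Only the filtrations differ, and a diameter changes by at most the distortion. *)
Lemma interleaved_distortion (X Y : fin_pmetric R) (T : tripod X Y) (delta : R) :
  0 <= delta ->
  (forall z z' : tri_set T, `|pm_dist (tri_l z) (tri_l z') -
    pm_dist (tri_r z) (tri_r z')| <= delta) ->
  interleaved (VR F (pull_l T)) (VR F (pull_r T)) delta.
Proof.
move=> d0 dist.
have ellr k (c : VR_ch F (pull_l T) k) :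
    (@VR_ell R F (pull_r T) k c <= VR_ell c + delta%:E)%E.
  apply/(@VR_ell_leP R F (pull_r T) k c) => s cs.
  apply: le_trans (leeD (@VR_ell_ge R (pull_l T) F k c s cs) (lexx _)).
  rewrite -EFinD lee_fin; apply/diam_leP; first by rewrite addr_ge0 ?diam_ge0.
  move=> z z' zs z's; have := dist z z'; rewrite ler_distl => /andP[h _].
  have := @diam_ge R (pull_l T) (val s) z z' zs z's; rewrite /= => h'.
  by move: h h'; rewrite /pm_dist /=; lra.
have elll k (c : VR_ch F (pull_l T) k) :
    (@VR_ell R F (pull_l T) k c <= @VR_ell R F (pull_r T) k c + delta%:E)%E.
  apply/VR_ell_leP => s cs.
  apply: le_trans (leeD (@VR_ell_ge R (pull_r T) F k c s cs) (lexx _)).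
  rewrite -EFinD lee_fin; apply/diam_leP; first by rewrite addr_ge0 ?diam_ge0.
  move=> z z' zs z's; have := dist z z'; rewrite ler_distl => /andP[_ h].
  have := @diam_ge R (pull_r T) (val s) z z' zs z's; rewrite /= => h'.
  by move: h h'; rewrite /pm_dist /=; lra.
exists (fun _ _ x => x), (fun _ _ x => x); split=> //; split=> //.
- move=> t; split=> // k x xt; apply: le_trans (ellr k x) _.
  by rewrite EFinD leeD.
- move=> t; split=> // k x xt; apply: le_trans (elll k x) _.
  by rewrite EFinD leeD.
Qed.

Lemma dI_distortion (X Y : fin_pmetric R) (T : tripod X Y) (delta : R) :
  0 <= delta ->
  (forall z z' : tri_set T, `|pm_dist (tri_l z) (tri_l z') -
    pm_dist (tri_r z) (tri_r z')| <= delta) ->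
  (dI (VR F (pull_l T)) (VR F (pull_r T)) <= delta%:E)%E.
Proof.
move=> d0 dist; apply: ereal_inf_lbound; exists delta => //; split=> //.
exact: interleaved_distortion.
Qed.

(** Nearest-point maps; the minima are attained because both spaces are finite. *)
Lemma nearest_points (X Y : fin_pmetric R) (W : metricType R) (i : X -> W)
    (j : Y -> W) : exists (f : X -> Y) (g : Y -> X), forall z,
  z \in map_cor f g ->
  ((mdist (i z.1) (j z.2))%:E <= hausdorff_dist (range i) (range j))%E.
Proof.
have /card_gt0P[x0 _] := pm_nonempty X; have /card_gt0P[y0 _] := pm_nonempty Y.
have exf x : exists y, forall y', mdist (i x) (j y) <= mdist (i x) (j y').
  by case: (@arg_minP _ _ _ y0 xpredT (fun y => mdist (i x) (j y))) => // y _ h;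
    exists y => y'; exact: h.
have exg y : exists x, forall x', mdist (i x) (j y) <= mdist (i x') (j y).
  by case: (@arg_minP _ _ _ x0 xpredT (fun x => mdist (i x) (j y))) => // x _ h;
    exists x => x'; exact: h.
have [f Hf] := choice exf; have [g Hg] := choice exg.
exists f, g => z; rewrite finset.in_setU /hausdorff_dist le_max.
case/orP => /imsetP[x _ ->] /=; apply/orP; [left|right].
  apply: le_ereal_sup_tmp; eexists; first by exists (i x); [exists x|].
  by apply: le_ereal_inf_tmp => _ [_ [y _ <-] <-]; rewrite lee_fin.
apply: le_ereal_sup_tmp; eexists; first by exists (j x); [exists x|].
by apply: le_ereal_inf_tmp => _ [_ [y _ <-] <-]; rewrite lee_fin.
Qed.

(** A Hausdorff distance [h] in some [W] gives nearest-point maps whose pairs are at distance at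
    most [h], hence distortion at most [2 * h]. With [e] arbitrary, this serves both the general
    upper bound and the lower bound for the star and the path. *)
Lemma dGH_ge (X Y : fin_metric R) (e : \bar R) :
  (forall (f : X -> Y) (g : Y -> X) (h : R), 0 <= h ->
    (forall z z', z \in map_cor f g -> z' \in map_cor f g ->
      `|pm_dist z.1 z'.1 - pm_dist z.2 z'.2| <= 2 * h) ->
    (e <= (2 * h)%:E)%E) -> (e <= 2%:E * dGH X Y)%E.
Proof.
move=> H; rewrite -lee_pdivrMl//; apply: le_ereal_inf_tmp => _ [W [i [j [ii ij ->]]]].
rewrite lee_pdivrMl//; have [f [g fg]] := nearest_points i j.
move: fg; case: (hausdorff_dist _ _) => [h| |] fg; last 2 first.
- by rewrite gt0_muley ?leey.
- have /card_gt0P[x0 _] := pm_nonempty X.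
  have /(fg _) : (x0, f x0) \in map_cor f g by rewrite finset.in_setU imset_f.
  by rewrite leeNy_eq.
rewrite -EFinM; apply: (H f g).
  have /card_gt0P[x0 _] := pm_nonempty X.
  have /(fg _) : (x0, f x0) \in map_cor f g by rewrite finset.in_setU imset_f.
  by rewrite lee_fin; apply: le_trans; exact: mdist_ge0.
move=> z z' /fg + /fg; rewrite !lee_fin -ii -ij => h1 h2.
have t1 := metric_triangle (i z.1) (j z.2) (i z'.1).
have t2 := metric_triangle (j z.2) (j z'.2) (i z'.1).
have t3 := metric_triangle (j z.2) (i z.1) (j z'.2).
have t4 := metric_triangle (i z.1) (i z'.1) (j z'.2).
rewrite [mdist (j z'.2) (i z'.1)]metric_sym in t2.
rewrite [mdist (j z.2) (i z.1)]metric_sym in t3.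
by rewrite ler_distl; apply/andP; split; lra.
Qed.

Lemma pullback_dI_le_dGH (X Y : fin_metric R) :
  (pullback_dI F Map X Y <= 2%:E * dGH X Y)%E.
Proof.
apply: dGH_ge => f g h h0 dist; apply: ge_ereal_inf; eexists.
  by exists (cor_tripod (map_corP f g)); split; [exists f, g|].
apply: dI_distortion; first by rewrite mulr_ge0.
by move=> z z'; apply: dist; [exact: valP z|exact: valP z'].
Qed.

End GromovHausdorff.

(** * Multisets and absorption by the diagonal *)

Section MultisetIso.
Context (R : realType).

Definition ms_iso (T : Type) (A B : multiset T) :=
  exists phi : ms_index A -> ms_index B, bijective phi /\
    forall i, ms_elt i = ms_elt (phi i).

Lemma ms_iso_refl T (A : multiset T) : ms_iso A A.
Proof. by exists id; split=> //; exists id. Qed.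

Lemma ms_iso_sym T (A B : multiset T) : ms_iso A B -> ms_iso B A.
Proof.
move=> [phi [[psi pK qK] h]]; exists psi; split; first by exists phi.
by move=> i; rewrite h qK.
Qed.

Lemma ms_iso_trans T (A B C : multiset T) : ms_iso A B -> ms_iso B C -> ms_iso A C.
Proof.
move=> [phi [bp h]] [psi [bq h']]; exists (psi \o phi); split.
  exact: bij_comp.
by move=> i; rewrite h h'.
Qed.

Lemma ms_iso_union T (A A' B B' : multiset T) : ms_iso A A' -> ms_iso B B' ->
  ms_iso (ms_union A B) (ms_union A' B').
Proof.
move=> [phi [[phi' pK pK'] h]] [psi [[psi' qK qK'] h']].
exists (fun i => match i with inl a => inl (phi a) | inr b => inr (psi b) end).
split; last by case.
by exists (fun i => match i with inl a => inl (phi' a) | inr b => inr (psi' b) end);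
  case=> i; rewrite ?pK ?pK' ?qK ?qK'.
Qed.

Lemma ms_unionA T (A B C : multiset T) :
  ms_iso (ms_union (ms_union A B) C) (ms_union A (ms_union B C)).
Proof.
exists (fun i => match i with inl (inl a) => inl a | inl (inr b) => inr (inl b)
  | inr c => inr (inr c) end).
split; last by case=> [[]|].
by exists (fun i => match i with inl a => inl (inl a) | inr (inl b) => inl (inr b)
  | inr (inr c) => inr c end); [case=> [[]|]|case=> [|[]]].
Qed.

Definition ms_single T (a : T) : multiset T := @Multiset T unit (fun=> a).

Lemma ms_cons T (a : T) s :
  ms_iso (ms_of_seq (a :: s)) (ms_union (ms_single a) (ms_of_seq s)).
Proof.
exists (fun i : 'I_(size s).+1 => if unlift ord0 i is Some j then inr j else inl tt).
split.
  exists (fun i : unit + 'I_(size s) => if i is inr j then lift ord0 j else ord0).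
    by move=> i; case: unliftP => [j ->|->].
  by case=> [[]|j]; rewrite ?unlift_none ?liftK.
move=> i /=; case: unliftP => [j ->|->]; last by rewrite (tnth_nth a).
by rewrite !(tnth_nth a).
Qed.

Lemma ms_of_seq_perm (T : eqType) (s t : seq T) : perm_eq s t ->
  ms_iso (ms_of_seq s) (ms_of_seq t).
Proof.
case: t => [|a t]; first by move/perm_nilP ->; exact: ms_iso_refl.
move: (a :: t) => {}t st; have := st; have -> : t = in_tuple t by [].
move=> /tuple_permP[p sE].
have sz := perm_size st.
exists (fun i : 'I_(size s) => p (cast_ord sz i)); split.
  apply: bij_comp; first exact: injF_bij (@perm_inj _ p).
  by exists (cast_ord (esym sz)) => i; rewrite ?cast_ordK ?cast_ordKV.
move=> i /=; rewrite (tnth_nth a) /= {1}sE.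
have -> : (i : nat) = cast_ord sz i by [].
by rewrite -tnth_nth tnth_mktuple.
Qed.

(** Hilbert's hotel: the extra copy takes place [0] over [r], and the others move up by one. *)
Lemma diag_absorb (r : \bar R) : (0 <= r)%E ->
  ms_iso (ms_union (ms_single (r, r)) (Defs.diag R)) (Defs.diag R).
Proof.
move=> r0; pose r' : {r : \bar R | (0 <= r)%E} := exist _ r r0.
exists (fun i : unit + {r : \bar R | (0 <= r)%E} * nat => match i with
  | inl _ => (r', 0%N)
  | inr (x, n) => if x == r' then (x, n.+1) else (x, n) end).
split.
  exists (fun i : {r : \bar R | (0 <= r)%E} * nat =>
    let: (x, n) := i in if x == r' then
      (if n is n'.+1 then inr (x, n') else inl tt) else inr (x, n)).
    case=> [[]|[x n]]; first by rewrite eqxx.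
    by case: ifPn => [xr|/negbTE xr]; rewrite xr.
  case=> x n; case: ifPn => [/eqP ->|/negbTE -> //].
  by case: n => [//|n]; rewrite eqxx.
by case=> [[]|[x n]] //=; case: ifP.
Qed.

Lemma concise_absorb (s : seq (\bar R * \bar R)) :
  (forall b, b \in s -> (b.1 <= b.2)%E /\ (0 <= b.1)%E) ->
  ms_iso (ms_union (ms_of_seq s) (Defs.diag R))
    (ms_union (ms_of_seq [seq b <- s | (b.1 < b.2)%E]) (Defs.diag R)).
Proof.
elim: s => [|a s IHs] h; first exact: ms_iso_refl.
have {}IHs := IHs (fun b bs => h b (mem_behead (s := a :: s) bs)).
have [a12 a0] := h a (mem_head _ _).
apply: ms_iso_trans (ms_iso_union (ms_cons a s) (ms_iso_refl _)) _.
apply: ms_iso_trans (ms_unionA _ _ _) _.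
apply: ms_iso_trans (ms_iso_union (ms_iso_refl _) IHs) _.
rewrite /=; case: ifPn => [_|].
  apply: ms_iso_trans (ms_iso_sym (ms_unionA _ _ _)) _.
  exact: ms_iso_union (ms_iso_sym (ms_cons _ _)) (ms_iso_refl _).
rewrite -leNgt => a21; have e12 : a = (a.1, a.1).
  by case: a a12 a21 {h a0} => a1 a2 /= h1 h2; congr (_, _); apply/le_anti; rewrite h1 h2.
rewrite e12; set t := ms_of_seq _.
have comm (A B : multiset (\bar R * \bar R)) : ms_iso (ms_union A B) (ms_union B A).
  exists (fun i => match i with inl a => inr a | inr b => inl b end).
  split; last by case.
  by exists (fun i => match i with inl a => inr a | inr b => inl b end); case.
apply: ms_iso_trans (ms_iso_union (ms_iso_refl _) (comm _ _)) _.
apply: ms_iso_trans (ms_iso_sym (ms_unionA _ _ _)) _.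
apply: ms_iso_trans (ms_iso_union (diag_absorb a0) (ms_iso_refl _)) _.
exact: comm.
Qed.

Lemma dM_iso_le (A A' B B' : multiset (\bar R * \bar R)) :
  ms_iso A A' -> ms_iso B B' -> (dM A B <= dM A' B')%E.
Proof.
move=> [f [bf hf]] /ms_iso_sym[g [bg hg]].
apply: le_ereal_inf_tmp => _ [phi [bphi ->]].
apply: (@dM_le _ _ _ _ (g \o phi \o f)).
- by rewrite le_max lexx.
- by do 2 apply: bij_comp => //.
move=> i; rewrite /= -hg hf le_max; apply/orP; right.
by apply: ereal_sup_ubound; exists (f i).
Qed.

Lemma dM_union_diag (A B : multiset (\bar R * \bar R)) :
  (dM (ms_union A (Defs.diag R)) (ms_union B (Defs.diag R)) <= dM A B)%E.
Proof.
apply: le_ereal_inf_tmp => _ [phi [[psi pK qK] ->]].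
pose phi' (i : ms_index (ms_union A (Defs.diag R))) : ms_index (ms_union B (Defs.diag R)) :=
  match i with inl a => inl (phi a) | inr d => inr d end.
apply: (@dM_le _ _ _ _ phi').
- by rewrite le_max lexx.
- by exists (fun i => match i with inl a => inl (psi a) | inr d => inr d end);
    case=> i /=; rewrite ?pK ?qK.
case=> [i|[[r r0] n]] /=; rewrite le_max; apply/orP.
  by right; apply: ereal_sup_ubound; exists i.
left; rewrite /bar_dist /Defs.edist /= eqxx maxxx.
by case: r r0 => [r| |] //= _; rewrite ?ltry.
Qed.

End MultisetIso.

(** * Coefficients, signs and cones in the full simplex *)

Section Chains.
Context (R : realType) (F : fieldType) (X : fin_pmetric R).

(* Zero unless the set has [k + 1] elements. *)
Definition cval k (c : VR_ch F X k) (s : {set X}) : F :=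
  if (insub s : option {s : {set X} | #|s| == k.+1}) is Some t then c t else 0.

Definition sgn (s : {set X}) (x : X) : F := (-1) ^+ pos s x.

Lemma cval_val k (c : VR_ch F X k) (t : simplex X k) : cval c (val t) = c t.
Proof. by rewrite /cval valK. Qed.

Lemma cval_in k (c : VR_ch F X k) (s : {set X}) (hs : #|s| == k.+1) :
  cval c s = c (exist _ s hs).
Proof. by rewrite -cval_val. Qed.

Lemma cval_out k (c : VR_ch F X k) (s : {set X}) : #|s| != k.+1 -> cval c s = 0.
Proof. by move=> hs; rewrite /cval insubN. Qed.

Lemma cval_eq k (c d : VR_ch F X k) :
  (forall s : {set X}, #|s| = k.+1 -> cval c s = cval d s) -> c = d.
Proof.
move=> h; apply/ffunP => t; rewrite -!cval_val; apply: h; exact/eqP/(valP t).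
Qed.

Lemma cval0 k (s : {set X}) : cval (0 : VR_ch F X k) (s : {set X}) = 0.
Proof. by rewrite /cval; case: insub => // t; rewrite ffunE. Qed.

Lemma cvalP k (a : F) (c d : VR_ch F X k) (s : {set X}) :
  cval (a *: c + d) s = a * cval c s + cval d s.
Proof.
by rewrite /cval; case: insub => [t|]; rewrite ?mulr0 ?addr0// !ffunE.
Qed.

Lemma cvalD k (c d : VR_ch F X k) (s : {set X}) : cval (c + d) s = cval c s + cval d s.
Proof. by rewrite -[c]scale1r cvalP mul1r scale1r. Qed.

Lemma cvalN k (c : VR_ch F X k) (s : {set X}) : cval (- c) s = - cval c s.
Proof. by rewrite -scaleN1r -[_ *: c]addr0 cvalP cval0 addr0 mulN1r. Qed.

Lemma cvalB k (c d : VR_ch F X k) (s : {set X}) : cval (c - d) s = cval c s - cval d s.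
Proof. by rewrite cvalD cvalN. Qed.

Lemma cvalZ k (a : F) (c : VR_ch F X k) (s : {set X}) : cval (a *: c) s = a * cval c s.
Proof. by rewrite -[_ *: c]addr0 cvalP cval0 addr0. Qed.

Lemma cval_ffun k (f : {set X} -> F) (s : {set X}) : #|s| = k.+1 ->
  cval ([ffun t : simplex X k => f (val t)] : VR_ch F X k) (s : {set X}) = f s.
Proof. by move=> /eqP hs; rewrite (cval_in _ hs) ffunE. Qed.

Lemma cval_neq0 k (c : VR_ch F X k) (s : {set X}) : cval c s != 0 ->
  #|s| = k.+1 /\ ((diam s)%:E <= VR_ell c)%E.
Proof.
move=> cs; have /eqP hs : #|s| == k.+1.
  by apply: contraNT cs => hs; rewrite cval_out.
split=> //; move/eqP: hs => hs; move: cs; rewrite (cval_in _ hs).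
by move=> /VR_ell_ge.
Qed.

Lemma VR_ell_cval k (c : VR_ch F X k) (b : \bar R) :
  (forall s : {set X}, #|s| = k.+1 -> cval c s != 0 -> ((diam s)%:E <= b)%E) ->
  (VR_ell c <= b)%E.
Proof.
move=> h; apply/VR_ell_leP => s cs; apply: h; first exact/eqP/(valP s).
by rewrite cval_val.
Qed.

Lemma cval_bd k (c : VR_ch F X k.+1) (s : {set X}) : #|s| = k.+1 ->
  cval (VR_bd F X k c) s = \sum_(x | x \notin s) sgn (x |: s) x * cval c (x |: s).
Proof.
move=> hs; have /eqP hs' := hs; rewrite (cval_in _ hs') lfunE /= ffunE /=.
rewrite (exchange_big_dep xpredT) //= [RHS]big_mkcond; apply: eq_bigr => x _.
case: ifPn => [xs|xs]; last first.
  rewrite big1 // => u /andP[xu /eqP us]; move: xs; rewrite -us.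
  by rewrite !inE eqxx.
have cu : #|x |: s| == k.+2 by rewrite cardsU1 xs hs.
rewrite (big_pred1 (exist _ (x |: s) cu : simplex X k.+1)) => [|u].
  by rewrite (cval_in _ cu).
apply/andP/eqP => [[xu /eqP us]|->] /=; last first.
  by rewrite finset.setU11 finset.setU1K.
by apply: val_inj; rewrite /= -us finset.setD1K.
Qed.

Let posD1_lt (u : {set X}) (x y : X) :
  (enum_rank x < enum_rank y)%N -> pos (u :\ y) x = pos u x.
Proof.
move=> xy; apply: eq_card => z; rewrite !inE.
by case: eqVneq => //= ->; rewrite ltnNge (ltnW xy) andbF.
Qed.

Let posD1_gt (u : {set X}) (x y : X) : x \in u ->
  (enum_rank x < enum_rank y)%N -> pos u y = (pos (u :\ x) y).+1.
Proof.
move=> xu xy; rewrite /pos (cardsD1 x) inE xu xy add1n; congr S.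
by apply: eq_card => z; rewrite !inE andbA.
Qed.

Lemma sgn_sqr (s : {set X}) x : sgn s x * sgn s x = 1.
Proof. by rewrite /sgn -expr2 sqrr_sign. Qed.

Lemma sgn_neq0 (s : {set X}) x : sgn s x != 0.
Proof. by rewrite /sgn signr_eq0. Qed.

(** The sign rule behind the vanishing of a double boundary: removing two vertices in the two
    possible orders gives opposite signs. *)
Lemma sgn_swap (u : {set X}) x y : x \in u -> y \in u -> x != y ->
  sgn u x * sgn u y = - (sgn (u :\ x) y * sgn (u :\ y) x).
Proof.
wlog xy : x y / (enum_rank x < enum_rank y)%N.
  move=> H xu yu xny; case: (ltngtP (enum_rank x) (enum_rank y)) => h.
  - exact: H.
  - by rewrite mulrC H// 1?eq_sym// mulrC.
  - by move/val_inj/enum_rank_inj: h xny => ->; rewrite eqxx.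
move=> xu yu _; rewrite /sgn (posD1_gt xu xy) (posD1_lt _ xy) exprS.
by rewrite mulN1r mulrN mulrC.
Qed.

Lemma sgn_prod (s : {set X}) x :
  sgn s x = \prod_(y in s) (if (enum_rank y < enum_rank x)%N then -1 else 1).
Proof.
rewrite /sgn /pos -big_mkcondr /= prodr_const; congr (_ ^+ _).
by apply: eq_card => y; rewrite !inE.
Qed.

(** The oriented join with [v]. Simplices of [c] that already contain [v] contribute nothing. *)
Definition cone (v : X) k (c : VR_ch F X k) : VR_ch F X k.+1 :=
  [ffun u : simplex X k.+1 => if v \in val u then sgn (val u) v * cval c (val u :\ v) else 0].

Lemma cval_cone v k (c : VR_ch F X k) (u : {set X}) :
  cval (cone v c) u = if v \in u then sgn u v * cval c (u :\ v) else 0.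
Proof.
have [hu|hu] := eqVneq #|u| k.+2.
  by rewrite (cval_ffun (fun u : {set X} => if v \in u then sgn u v * cval c (u :\ v) else 0)).
rewrite cval_out//; case: ifP => // vu; rewrite cval_out ?mulr0//.
by move: hu; rewrite (cardsD1 v) vu add1n eqSS.
Qed.

Lemma cone_lin v k : linear (@cone v k).
Proof.
move=> a c d; apply: cval_eq => s _; rewrite cvalP !cval_cone cvalP.
by case: ifP => _; [rewrite mulrDr mulrCA|rewrite mulr0 addr0].
Qed.

Lemma bd_cone_out v k (c : VR_ch F X k) (s : {set X}) : #|s| = k.+1 -> v \notin s ->
  cval (VR_bd F X k (cone v c)) s = cval c s.
Proof.
move=> hs vs; rewrite cval_bd// (bigD1 v) //= big1 ?addr0 => [|x /andP[xs xv]].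
  by rewrite cval_cone finset.setU11 finset.setU1K// mulrA sgn_sqr mul1r.
by rewrite cval_cone !inE eq_sym (negbTE xv) (negbTE vs) mulr0.
Qed.

(** The cone is a contracting homotopy in positive degrees. On a simplex through [v], the term of
    [v] itself returns [c], and the others cancel by [sgn_swap]. *)
Lemma bd_cone v k (c : VR_ch F X k.+1) :
  VR_bd F X k.+1 (cone v c) + cone v (VR_bd F X k c) = c.
Proof.
apply: cval_eq => s hs; rewrite cvalD [cval (cone _ (VR_bd _ _ _ _)) _]cval_cone.
case: ifPn => vs; last by rewrite addr0 bd_cone_out.
have hsv : #|s :\ v| = k.+1 by move: hs; rewrite (cardsD1 v) vs add1n => -[].
rewrite !cval_bd// (bigD1 v (P := fun x => x \notin s :\ v)) /=; last by rewrite !inE eqxx.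
rewrite finset.setD1K// mulrDr mulrA sgn_sqr mul1r addrCA -[RHS]addr0; congr (_ + _).
rewrite mulr_sumr [X in _ + X](eq_bigl (fun x => x \notin s)) => [|x]; last first.
  by rewrite !inE; case: eqVneq => [->|xv] /=; rewrite ?vs ?andbT.
rewrite -big_split big1 //= => x xs.
have xv : x != v by apply: contraNneq xs => ->.
have e1 : (x |: s) :\ v = x |: s :\ v.
  apply/setP => y; rewrite !inE; case: (eqVneq y x) => [->|]; rewrite ?xv//.
have e2 : (x |: s) :\ x = s by rewrite finset.setU1K.
rewrite cval_cone inE vs orbT !mulrA sgn_swap ?inE ?eqxx ?vs ?orbT//.
by rewrite e1 e2 mulNr addNr.
Qed.

Definition vanish (z : X) k (c : VR_ch F X k) :=
  forall s : {set X}, z \in s -> cval c s = 0.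

Lemma vanish_bd z k (c : VR_ch F X k.+1) : vanish z c -> vanish z (VR_bd F X k c).
Proof.
move=> h s zs; have [hs|hs] := eqVneq #|s| k.+1; last by rewrite cval_out.
by rewrite cval_bd// big1// => x _; rewrite h ?mulr0// inE zs orbT.
Qed.

Lemma vanish_cone z v k (c : VR_ch F X k) : z != v -> vanish z c -> vanish z (cone v c).
Proof.
move=> zv h s zs; rewrite cval_cone; case: ifP => // _.
by rewrite h ?mulr0// !inE zv.
Qed.

Lemma vanish_sub z k (c d : VR_ch F X k) : vanish z c -> vanish z d -> vanish z (c - d).
Proof. by move=> hc hd s zs; rewrite cvalB hc// hd// subr0. Qed.

Definition star_part (z : X) k (c : VR_ch F X k) : VR_ch F X k :=
  [ffun t : simplex X k => if z \in val t then c t else 0].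

Lemma cval_star_part z k (c : VR_ch F X k) (s : {set X}) :
  cval (star_part z c) s = if z \in s then cval c s else 0.
Proof.
have [hs|hs] := boolP (#|s| == k.+1); last by rewrite !cval_out//; case: ifP.
by rewrite !(cval_in _ hs) ffunE.
Qed.

Lemma star_part_lin z k : linear (@star_part z k).
Proof.
move=> a c d; apply: cval_eq => s _; rewrite cvalP !cval_star_part cvalP.
by case: ifP => _ //; rewrite mulr0 addr0.
Qed.

Lemma vanish_star_part z v k (c : VR_ch F X k) : vanish z c -> vanish z (star_part v c).
Proof. by move=> h s zs; rewrite cval_star_part h//; case: ifP. Qed.

Lemma star_part_vanish z k (c : VR_ch F X k) : vanish z c -> star_part z c = 0.
Proof.
by move=> h; apply: cval_eq => s _; rewrite cval_star_part cval0; case: ifP => // /h.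
Qed.

End Chains.

(** * Merging points at distance zero *)

Section Collapse.
Context (R : realType) (F : fieldType) (Z : fin_pmetric R) (r : Z -> Z).
Hypothesis r_dist : forall z y, pm_dist (r z) y = pm_dist z y.

(** The prism operator for moving [z] onto [r z]: simplices through [z] are joined with [r z]. *)
Let h z k (c : VR_ch F Z k) : VR_ch F Z k.+1 := cone (r z) (star_part z c).

Let h_lin z k : linear (@h z k).
Proof. by move=> a c d; rewrite /h star_part_lin cone_lin. Qed.

(** The added vertex [r z] has the same distances as [z], which lies in the base, so the join is no
    larger than its base. *)
Let ell_h z k (c : VR_ch F Z k) : (VR_ell (h z c) <= VR_ell c)%E.
Proof.
apply: VR_ell_cval => u hu; rewrite /h cval_cone.
case: ifPn => ru; last by rewrite eqxx.
rewrite cval_star_part; case: ifPn => zu; last by rewrite mulr0 eqxx.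
rewrite mulf_eq0 negb_or => /andP[_ /cval_neq0[_]]; apply: le_trans.
rewrite lee_fin; apply/diam_leP; first exact: diam_ge0.
have sub x : x \in u -> exists2 x', x' \in u :\ r z &
    forall y, pm_dist x y = pm_dist x' y.
  move=> xu; have [->|xr] := eqVneq x (r z); first by exists z.
  by exists x => //; rewrite !inE xr.
move=> x y /sub[x' x'u xx'] /sub[y' y'u yy'].
by rewrite xx' pm_sym yy' pm_sym diam_ge.
Qed.

Let h_vanish z z' k (c : VR_ch F Z k) : z' != r z -> vanish z' c -> vanish z' (h z c).
Proof. by move=> zr hc; apply/vanish_cone/vanish_star_part. Qed.

Let h_vanish0 z k (c : VR_ch F Z k) : vanish z c -> h z c = 0.
Proof. by rewrite /h => /star_part_vanish ->; rewrite (lin0 (@cone_lin _ _ _ _ _)). Qed.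

(** The homotopy formula on cycles, where the term [h z (VR_bd F Z k c)] vanishes; this form also
    makes sense in degree [0]. [tau1] is the full formula on chains of positive degree. *)
Let tau z k (c : VR_ch F Z k) : VR_ch F Z k := c - VR_bd F Z k (h z c).

Let tau1 z k (y : VR_ch F Z k.+1) : VR_ch F Z k.+1 :=
  y - VR_bd F Z k.+1 (h z y) - h z (VR_bd F Z k y).

(** The cone identity for the star part of [y] rewrites the boundary of [h z y]. On simplices
    through [z], a chain and its star part have the same boundary, so everything cancels. *)
Let tau1_vanish z k (y : VR_ch F Z k.+1) : r z != z -> vanish z (tau1 z y).
Proof.
move=> rz s zs; have [hs|hs] := eqVneq #|s| k.+2; last by rewrite cval_out.
have := bd_cone (r z) (star_part z y) => /eqP; rewrite eq_sym -subr_eq => /eqP e.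
rewrite /tau1 !cvalB -/(h z y) -e cvalB cval_star_part zs /h !cval_cone.
case: ifPn => rs; last by rewrite !subr0 subrr.
have hsr : #|s :\ r z| = k.+1 by move: hs; rewrite (cardsD1 (r z)) rs add1n => -[].
have zsr : z \in s :\ r z by rewrite !inE eq_sym rz.
rewrite cval_star_part zsr !cval_bd// opprB addrCA subrr addr0.
suff -> : \sum_(x | x \notin s :\ r z) sgn F (x |: s :\ r z) x *
    cval (star_part z y) (x |: s :\ r z) =
  \sum_(x | x \notin s :\ r z) sgn F (x |: s :\ r z) x * cval y (x |: s :\ r z).
  by rewrite subrr.
by apply: eq_bigr => x _; rewrite cval_star_part inE zsr orbT.
Qed.

Let tau_vanish z k (c : VR_ch F Z k) : r z != z -> c \in cycles (VR F Z) k ->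
  vanish z (tau z c).
Proof.
move=> rz; case: k c => [|k] c cc s zs.
  have [hs|hs] := eqVneq #|s| 1%N; last by rewrite cval_out.
  rewrite /tau cvalB bd_cone_out// ?cval_star_part ?zs ?subrr//.
  move/eqP/cards1P: hs zs => [x ->]; rewrite !inE => /eqP <-; by [].
have -> : tau z c = tau1 z c.
  move: cc; rewrite memv_ker => /eqP bc.
  rewrite /tau1 [VR_bd F Z k c]bc.
  by have -> : h z (0 : VR_ch F Z k) = 0; [exact: lin0 (@h_lin z k)|rewrite subr0].
exact: tau1_vanish.
Qed.

(* Moves the vertices of [L] one after the other onto their images under [r],
   each step being chain homotopic to the identity through the cones [h]. *)
Lemma collapse (L : seq Z) k : (forall z, z \in L -> r z \notin L) ->
  exists T : VR_ch F Z k -> VR_ch F Z k,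
  [/\ linear T,
      forall c, c \in cycles (VR F Z) k -> exists w,
        T c = c + VR_bd F Z k w /\ (VR_ell w <= VR_ell c)%E,
      forall c z, c \in cycles (VR F Z) k -> z \in L -> vanish z (T c),
      forall y, exists y', [/\ VR_bd F Z k y' = T (VR_bd F Z k y),
        (VR_ell y' <= VR_ell y)%E & forall z, z \in L -> vanish z y'] &
      forall c, (forall z, z \in L -> vanish z c) -> T c = c].
Proof.
elim: L => [_|z L IHL rL].
  exists id; split=> // [c _|y]; last by exists y.
  by exists 0; rewrite linear0 addr0; split=> //; have /VR_ell_eqNy -> := erefl (0 : VR_ch F Z k.+1); rewrite leNye.
have [|T [lT hT vT bT fT]] := IHL.
  by move=> z' z'L; have := rL z'; rewrite !inE z'L orbT negb_or => /(_ isT)/andP[].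
have [rz rzL] : r z != z /\ r z \notin L.
  by have := rL z; rewrite !inE eqxx negb_or => /(_ isT)/andP[].
have cycT c : c \in cycles (VR F Z) k -> T c \in cycles (VR F Z) k.
  move=> cc; have [w [-> _]] := hT _ cc; apply: memvD => //.
  exact: (@bd_cycles _ _ (VR F Z)).
exists (fun c => tau z (T c)); split.
- move=> a c d; rewrite lT /tau h_lin linearP scalerBr opprD !addrA.
  by congr (_ - _); rewrite addrAC.
- move=> c cc; have [w [Tc lw]] := hT _ cc.
  exists (w - h z (T c)); split; first by rewrite /tau {1}Tc linearB /= addrA.
  apply: le_trans (VR_ellD _ _) _; rewrite ge_max lw /= -scaleN1r.
  rewrite VR_ellZ ?oppr_eq0 ?oner_eq0//; apply: le_trans (ell_h _ _) _.
  rewrite Tc; apply: le_trans (VR_ellD _ _) _; rewrite ge_max lexx /=.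
  exact: le_trans (VR_ell_bd _) lw.
- move=> c z' cc; rewrite inE => /predU1P[->|z'L].
    by apply: tau_vanish => //; exact: cycT.
  (* The cone vertex [r z] is outside [L], so this step does not bring back vertices that were
     removed before. *)
  apply: vanish_sub; first exact: vT.
  apply/vanish_bd/h_vanish; last exact: vT.
  by apply: contraNneq rzL => <-.
- move=> y; have [y' [by' ly' vy']] := bT y; exists (tau1 z y'); split.
  + rewrite /tau1 !linearB /= VR_bd_bd subr0 by'; reflexivity.
  + apply: le_trans (VR_ellD _ _) _; rewrite ge_max; apply/andP; split.
      apply: le_trans (VR_ellD _ _) _; rewrite ge_max ly' /= -scaleN1r.
      rewrite VR_ellZ ?oppr_eq0 ?oner_eq0//.
      apply: le_trans (VR_ell_bd _) _; exact: le_trans (ell_h _ _) ly'.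
    rewrite -scaleN1r VR_ellZ ?oppr_eq0 ?oner_eq0//.
    apply: le_trans (ell_h _ _) _; exact: le_trans (VR_ell_bd _) ly'.
  + move=> z'; rewrite inE => /predU1P[->|z'L]; first exact: tau1_vanish.
    have zr : z' != r z by apply: contraNneq rzL => <-.
    apply: vanish_sub; last exact/h_vanish/vanish_bd/vy'.
    by apply: vanish_sub; [exact: vy'|exact/vanish_bd/h_vanish/vy'].
- move=> c vc; rewrite fT => [|z' z'L]; last by apply: (vc z'); rewrite inE z'L orbT.
  have hz : h z c = 0 by apply: h_vanish0; apply: (vc z); rewrite mem_head.
  by rewrite /tau hz linear0 subr0.
Qed.

End Collapse.

(** * Transport of chains along an isometric injection *)

Section PushForward.
Context (R : realType) (F : fieldType) (X Z : fin_pmetric R) (s : X -> Z).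
Hypothesis s_inj : injective s.
Hypothesis s_dist : forall x y, pm_dist (s x) (s y) = pm_dist x y.

(** Detects an inversion: [s] need not respect the enumerations that orient the simplices. *)
Let inv (x y : X) : F :=
  if (enum_rank x < enum_rank y)%N && (enum_rank (s y) < enum_rank (s x))%N
  then -1 else 1.

(* The sign of the permutation comparing the two orientations of a simplex. *)
Let eps (a : {set X}) : F := \prod_(x in a) \prod_(y in a) inv x y.

Let eps_sqr a : eps a * eps a = 1.
Proof.
rewrite /eps -big_split big1 //= => x _; rewrite -big_split big1 //= => y _.
by rewrite /inv; case: ifP => _; rewrite ?mulrNN mulr1.
Qed.

(** The factors of [eps (x |: a)] that involve [x] count the inversions by which the positions of
    [x] and [s x] differ. *)
Let sgn_push x (a : {set X}) : x \notin a ->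
  sgn F (s @: (x |: a)) (s x) * eps (x |: a) = sgn F (x |: a) x * eps a.
Proof.
move=> xa; rewrite /eps (big_setU1 _ xa) /=.
under [X in _ * (_ * X) = _]eq_bigr do rewrite (big_setU1 _ xa) /=.
rewrite big_split /= !mulrA; congr (_ * _).
rewrite !sgn_prod big_imset /=; last by move=> y y' _ _; exact: s_inj.
rewrite !(big_setU1 _ xa) /= !ltnn /inv ltnn /= !mul1r -!big_split /=.
apply: eq_bigr => y ya.
have xy : x != y by apply: contraNneq xa => ->.
case: (ltngtP (enum_rank x) (enum_rank y)) => [h|h|]; last first.
- by move/val_inj/enum_rank_inj/eqP; rewrite (negbTE xy).
- case: (ltngtP (enum_rank (s x)) (enum_rank (s y))) => [h'|h'|]; rewrite ?mulr1 ?mul1r//.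
  by move/val_inj/enum_rank_inj/s_inj/eqP; rewrite (negbTE xy).
- case: (ltngtP (enum_rank (s x)) (enum_rank (s y))) => [h'|h'|]; rewrite ?mulr1 ?mul1r ?mulrNN ?mulr1//.
Qed.

Let s_imK (a : {set X}) : s @^-1: (s @: a) = a.
Proof. by apply/setP => x; rewrite inE mem_imset. Qed.

Let s_preK (t : {set Z}) : t \subset s @: [set: X] -> s @: (s @^-1: t) = t.
Proof.
move=> /fintype.subsetP ts; apply/setP => z; apply/imsetP/idP => [[x + ->]|zt].
  by rewrite inE.
by have /imsetP[x _ zx] := ts z zt; exists x => //; rewrite inE -zx.
Qed.

Definition push k (c : VR_ch F X k) : VR_ch F Z k :=
  [ffun t : simplex Z k => if val t \subset s @: [set: X]
    then eps (s @^-1: val t) * cval c (s @^-1: val t) else 0].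

(** Restriction to the simplices inside the image of [s]. On chains supported there it inverts
    [push], so it is applied after [collapse]. *)
Definition pull k (d : VR_ch F Z k) : VR_ch F X k :=
  [ffun a : simplex X k => eps (val a) * cval d (s @: val a)].

Lemma cval_push k (c : VR_ch F X k) (t : {set Z}) : cval (push c) t =
  if t \subset s @: [set: X] then eps (s @^-1: t) * cval c (s @^-1: t) else 0.
Proof.
have [ht|ht] := boolP (#|t| == k.+1); first by rewrite (cval_in _ ht) ffunE.
rewrite cval_out//; case: ifPn => // ts; rewrite cval_out ?mulr0//.
by rewrite -(card_imset _ s_inj) s_preK.
Qed.

Lemma cval_push_im k (c : VR_ch F X k) (a : {set X}) :
  cval (push c) (s @: a) = eps a * cval c a.
Proof.
have sub : s @: a \subset s @: [set: X] by apply: imsetS; exact: finset.subsetT.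
by rewrite cval_push sub s_imK.
Qed.

Lemma cval_pull k (d : VR_ch F Z k) (a : {set X}) :
  cval (pull d) a = eps a * cval d (s @: a).
Proof.
have [ha|ha] := boolP (#|a| == k.+1); first by rewrite (cval_in _ ha) ffunE.
by rewrite !cval_out ?mulr0// card_imset.
Qed.

Lemma push_lin k : linear (@push k).
Proof.
move=> a c d; apply: cval_eq => t _; rewrite cvalP !cval_push cvalP.
by case: ifP => _; [rewrite mulrDr mulrCA|rewrite mulr0 addr0].
Qed.

Lemma pull_lin k : linear (@pull k).
Proof.
move=> a c d; apply: cval_eq => t _; rewrite cvalP !cval_pull cvalP.
by rewrite mulrDr mulrCA.
Qed.

Lemma pushK k (c : VR_ch F X k) : pull (push c) = c.
Proof.
by apply: cval_eq => a _; rewrite cval_pull cval_push_im mulrA eps_sqr mul1r.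
Qed.

Lemma pullK k (d : VR_ch F Z k) :
  (forall z, z \notin s @: [set: X] -> vanish z d) -> push (pull d) = d.
Proof.
move=> vd; apply: cval_eq => t _; rewrite cval_push; case: ifPn => ts.
  by rewrite cval_pull mulrA eps_sqr mul1r s_preK.
by have /subsetPn[z zt zs] := ts; rewrite (vd z).
Qed.

Lemma push_bd k (c : VR_ch F X k.+1) :
  push (VR_bd F X k c) = VR_bd F Z k (push c).
Proof.
apply: cval_eq => t ht; rewrite cval_push [in RHS]cval_bd//.
have [ts|ts] := boolP (t \subset s @: [set: X]); last first.
  have /subsetPn[z zt zs] := ts; rewrite big1// => x _.
  rewrite cval_push; case: ifPn => [/fintype.subsetP/(_ z)|]; last by rewrite mulr0.
  by rewrite inE zt orbT (negbTE zs) => /(_ isT).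
rewrite -[in RHS](s_preK ts); set a := s @^-1: t.
have ha : #|a| = k.+1 by rewrite -ht -(s_preK ts) card_imset.
rewrite cval_bd//.
rewrite (bigID (fun z => z \in s @: [set: X])) /= [X in _ + X]big1 ?addr0; last first.
  move=> z /andP[_ zs]; rewrite cval_push; case: ifPn; last by rewrite mulr0.
  by move=> /fintype.subsetP/(_ z); rewrite inE set11 (negbTE zs) => /(_ isT).
rewrite (eq_bigl (fun z => z \in s @: (~: a))) => [|z]; last first.
  apply/andP/imsetP => [[za /imsetP[x _ zx]]|[x + ->]].
    by exists x => //; move: za; rewrite zx inE mem_imset.
  by rewrite inE mem_imset// imset_f// inE.
rewrite big_imset /=; last by move=> x x' _ _; exact: s_inj.
rewrite mulr_sumr; apply: eq_big => [x|x xa]; first by rewrite [RHS]inE.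
by rewrite -imsetU1 cval_push_im !mulrA sgn_push// [eps a * _]mulrC.
Qed.

Let diam_im (a : {set X}) : diam (s @: a) = diam a.
Proof.
apply/eqP; rewrite eq_le; apply/andP; split.
  apply/diam_leP; first exact: diam_ge0.
  by move=> _ _ /imsetP[x xa ->] /imsetP[y ya ->]; rewrite s_dist diam_ge.
apply/diam_leP; first exact: diam_ge0.
by move=> x y xa ya; rewrite -s_dist diam_ge// imset_f.
Qed.

Lemma ell_push k (c : VR_ch F X k) : (VR_ell (push c) <= VR_ell c)%E.
Proof.
apply: VR_ell_cval => t _; rewrite cval_push; case: ifPn => ts; last by rewrite eqxx.
rewrite mulf_eq0 negb_or => /andP[_ /cval_neq0[_]]; apply: le_trans.
by rewrite -{1}(s_preK ts) diam_im.
Qed.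

Lemma ell_pull k (d : VR_ch F Z k) : (VR_ell (pull d) <= VR_ell d)%E.
Proof.
apply: VR_ell_cval => a _; rewrite cval_pull mulf_eq0 negb_or.
by move=> /andP[_ /cval_neq0[_]]; rewrite diam_im.
Qed.

End PushForward.

(** * Concise barcodes of pullbacks *)

Section ConcisePullback.
Context (R : realType) (F : fieldType).

Lemma VR_is_verbose (X : fin_pmetric R) k :
  is_verbose_barcode (VR F X) k (verbose_barcode (VR F X) k).
Proof. exact/verbose_barcodeP/VR_finitely_valued. Qed.

Lemma perm_eq_concise (s t : seq (\bar R * \bar R)) :
  (forall v, (v.1 < v.2)%E -> count_mem v s = count_mem v t) ->
  perm_eq [seq b <- s | (b.1 < b.2)%E] [seq b <- t | (b.1 < b.2)%E].
Proof.
move=> h; apply/allP => v _ /=; rewrite !count_filter.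
have [v12|v12] := boolP (v.1 < v.2)%E.
  have E (u : seq (\bar R * \bar R)) :
      count (predI (pred1 v) (fun b => (b.1 < b.2)%E)) u = count_mem v u.
    by apply: eq_count => b /=; case: eqVneq => // ->.
  by rewrite !E h.
have E (u : seq (\bar R * \bar R)) :
    count (predI (pred1 v) (fun b => (b.1 < b.2)%E)) u = 0%N.
  rewrite -(count_pred0 u); apply: eq_count => b /=.
  by case: eqVneq => // ->; rewrite (negbTE v12).
by rewrite !E.
Qed.

Section Pullback.
Variables (X : fin_pmetric R) (Zt : finType) (phi : Zt -> X).
Hypothesis phi_surj : forall x, exists z, phi z = x.
Let Z := pullback phi_surj.

(** [f] pushes along a section of [phi]; [g] collapses each fibre onto its chosen representative and
    then restricts to the section. On cycles, [f (g z)] is the collapse itself, hence homologous to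
    [z] without raising the level. *)
Lemma pullback_equiv k : exists (f : ch (VR F X) k -> ch (VR F Z) k)
    (g : ch (VR F Z) k -> ch (VR F X) k),
  [/\ shift_map 0 f, shift_map 0 g, forall z, g (f z) = z &
    forall z, z \in cycles (VR F Z) k -> exists w,
      f (g z) = z + bd (VR F Z) k w /\ (ell w <= ell z)%E].
Proof.
have [s0 s0K] := choice phi_surj; pose s : X -> Z := s0.
have sK x : phi (s x) = x by exact: s0K.
have s_inj : injective s by apply: can_inj sK.
have s_dist x y : pm_dist (s x) (s y) = pm_dist x y.
  by rewrite /pm_dist /= !sK.
pose r (z : Z) : Z := s (phi z).
have r_dist z y : pm_dist (r z) y = pm_dist z y by rewrite /pm_dist /= sK.
pose L := [seq z <- enum Z | z \notin s @: [set: X]].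
have LE z : (z \in L) = (z \notin s @: [set: X]).
  by rewrite mem_filter mem_enum andbT.
have rL z : z \in L -> r z \notin L.
  by move=> _; rewrite LE negbK /r imset_f// inE.
have [T [lT hT vT bT fT]] := collapse F r_dist k rL.
have vL k' (c : VR_ch F Z k') : (forall z, z \in L -> vanish z c) ->
    push s (pull s c) = c.
  by move=> vc; apply: pullK => // z zs; apply: vc; rewrite LE.
have ell0' (e : \bar R) : (e + 0%:E)%E = e by rewrite adde0.
have pushcyc c : c \in cycles (VR F X) k -> push s c \in cycles (VR F Z) k.
  case: (k) c => [|k'] c; first by rewrite !memvf.
  rewrite !memv_ker /= -push_bd// => /eqP ->.
  by rewrite (lin0 (@push_lin _ F _ _ _ s_inj _)).
exists (@push _ F _ _ s k), (fun d => pull s (T d)); split.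
- split; [exact: push_lin|exact: pushcyc|by move=> z _; rewrite ell0'; exact: ell_push|].
  by move=> y; exists (push s y); rewrite ell0' /= push_bd//; split=> //; exact: ell_push.
- split.
  + by move=> a c d; rewrite lT pull_lin.
  + move=> d dc; have [w [Td _]] := hT _ dc.
    have Tdc : T d \in cycles (VR F Z) k.
      by rewrite Td; apply: memvD => //; exact: (@bd_cycles _ _ (VR F Z)).
    have := vL _ (T d) (fun z => vT d z dc); move: (pull s (T d)) Tdc => c + pc.
    rewrite -pc; case: (k) c {pc} => [|k'] c; first by rewrite !memvf.
    rewrite !memv_ker /= -push_bd// => /eqP pbc.
    by rewrite -[VR_bd _ _ _ _](pushK s_inj) pbc (lin0 (@pull_lin _ F _ _ _ s_inj _)).
  + move=> d dc; rewrite ell0'; apply: (le_trans (ell_pull s_inj s_dist _)).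
    have [w [-> lw]] := hT _ dc; apply: le_trans (VR_ellD _ _) _.
    by rewrite ge_max lexx /=; apply: le_trans (VR_ell_bd _) lw.
  + move=> y; have [y' [by' ly' vy']] := bT y; exists (pull s y'); split.
      rewrite /= -by' -(vL _ y' vy') pushK// -push_bd// pushK//.
    by rewrite ell0'; exact: (le_trans (ell_pull s_inj s_dist _)) ly'.
- move=> c; rewrite fT ?pushK// => z; rewrite LE => zs t zt.
  rewrite cval_push//; case: ifPn => // /fintype.subsetP/(_ _ zt).
  by rewrite (negbTE zs).
- move=> d dc; have [w [Td lw]] := hT _ dc; exists w; split=> //.
  by rewrite vL => [|z]; [exact: Td|exact: vT].
Qed.

Lemma concise_pullback k :
  perm_eq (concise_barcode (VR F X) k) (concise_barcode (VR F Z) k).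
Proof.
have [f [g [sf sg gf fg]]] := pullback_equiv k.
apply: perm_eq_concise => v v12; apply/eqP; rewrite eqn_leq; apply/andP; split.
  apply: (concise_count_le (VR_is_verbose X k) (VR_is_verbose Z k) sf sg) => // z _.
  by exists 0; rewrite linear0 addr0 gf ell0 leNye.
exact: (concise_count_le (VR_is_verbose Z k) (VR_is_verbose X k) sg sf).
Qed.

End Pullback.

Lemma VR_bars (X : fin_pmetric R) k b : b \in verbose_barcode (VR F X) k ->
  (b.1 <= b.2)%E /\ (0 <= b.1)%E.
Proof.
have [e [c be]] := verbose_barcode_basis (VR_is_verbose X k).
move=> /(nthP b)[i ib <-]; rewrite -(bar_nth (Ordinal ib)).
split; first exact: bar_le be _.
by rewrite -(bb_ell be); apply: VR_ell_ge0; exact: bb_neq0 be _.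
Qed.

Lemma concise_iso (X : fin_pmetric R) (Zt : finType) (phi : Zt -> X)
    (phi_surj : forall x, exists z, phi z = x) k :
  ms_iso (ms_union (ms_of_seq (concise_barcode (VR F X) k)) (Defs.diag R))
    (ms_union (ms_of_seq (verbose_barcode (VR F (pullback phi_surj)) k)) (Defs.diag R)).
Proof.
apply: ms_iso_trans (ms_iso_sym (concise_absorb _)); last exact: VR_bars.
by apply: ms_iso_union (ms_iso_refl _); apply/ms_of_seq_perm/concise_pullback.
Qed.

Lemma bottleneck_le_pullback k (X Y : fin_pmetric R) :
  (bottleneck F k X Y <= pullback_dB F k Tri X Y)%E.
Proof.
apply: le_ereal_inf_tmp => _ [T [_ ->]].
apply: le_trans (dM_iso_le (concise_iso (@tri_l_surj _ _ _ T) k)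
  (concise_iso (@tri_r_surj _ _ _ T) k)) _.
exact: dM_union_diag.
Qed.

End ConcisePullback.

(** * Metrics from graphs *)

Section GraphMetrics.
Context (R : realType).

(** With nonzero distances [1] and [2] only, the triangle inequality holds for every graph. *)
Definition graph_dist n (e : rel 'I_n) (i j : 'I_n) : R :=
  if i == j then 0 else if e i j then 1 else 2.

Lemma graph_dist_ge1 n (e : rel 'I_n) i j : i != j -> 1 <= graph_dist e i j.
Proof. by rewrite /graph_dist => /negbTE ->; case: ifP => _; lra. Qed.

Lemma graph_dist_le2 n (e : rel 'I_n) i j : graph_dist e i j <= 2.
Proof. by rewrite /graph_dist; case: ifP => _; [|case: ifP => _]; lra. Qed.

Lemma graph_distxx n (e : rel 'I_n) i : graph_dist e i i = 0.
Proof. by rewrite /graph_dist eqxx. Qed.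

Lemma graph_dist_triangle n (e : rel 'I_n) i j k :
  graph_dist e i k <= graph_dist e i j + graph_dist e j k.
Proof.
have [->|ij] := eqVneq i j; first by rewrite graph_distxx add0r.
have [->|jk] := eqVneq j k; first by rewrite graph_distxx addr0.
have := graph_dist_ge1 e ij; have := graph_dist_ge1 e jk.
have := graph_dist_le2 e i k; lra.
Qed.

Lemma graph_dist_sym n (e : rel 'I_n) (se : symmetric e) i j :
  graph_dist e i j = graph_dist e j i.
Proof. by rewrite /graph_dist eq_sym se. Qed.

Lemma card_ord_gt0 n : (0 < #|'I_n.+1|)%N. Proof. by rewrite card_ord. Qed.

Definition graph_pmetric n (e : rel 'I_n.+1) (se : symmetric e) : fin_pmetric R :=
  @FinPMetric R 'I_n.+1 (graph_dist e) (card_ord_gt0 n) (graph_distxx e)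
    (graph_dist_sym se) (graph_dist_triangle e).

Lemma graph_sep n (e : rel 'I_n.+1) (se : symmetric e)
    (x y : graph_pmetric se) : pm_dist x y = 0 -> x = y.
Proof.
move=> xy; apply/eqP; apply: contra_eqT xy => xy.
by have := graph_dist_ge1 e xy; rewrite /pm_dist /= => h; apply/eqP => h0; move: h; rewrite h0; lra.
Qed.

Definition graph_metric n (e : rel 'I_n.+1) (se : symmetric e) : fin_metric R :=
  @FinMetric R (graph_pmetric se) (@graph_sep n e se).

End GraphMetrics.

(** * The point and the complete graph *)

Section BottleneckStrict.
Context (R : realType) (F : fieldType).

Lemma diam_single (X : fin_pmetric R) (s : {set X}) : #|s| = 1%N -> diam s = 0.
Proof.
move=> /eqP/cards1P[x ->]; apply/eqP; rewrite eq_le diam_ge0 andbT.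
by apply/diam_leP => // y z; rewrite !inE => /eqP -> /eqP ->; rewrite pm_refl.
Qed.

Lemma VR_ell0_le (X : fin_pmetric R) (c : VR_ch F X 0) : (VR_ell c <= 0)%E.
Proof. by apply: VR_ell_cval => s hs _; rewrite diam_single. Qed.

Lemma VR_ell0 (X : fin_pmetric R) (c : VR_ch F X 0) : c != 0 -> VR_ell c = 0%E.
Proof. by move=> /VR_ell_ge0 h; apply/le_anti; rewrite VR_ell0_le. Qed.

(** In positive degree every cycle bounds its cone, so no bar is infinite; in degree [0] all births
    are [0]. *)
Lemma VR_infinite_bar (X : fin_pmetric R) k b :
  b \in verbose_barcode (VR F X) k -> b.2 = +oo%E -> b.1 = 0%E.
Proof.
have [e [c be]] := verbose_barcode_basis (VR_is_verbose F X k).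
move=> /(nthP b)[i ib <-]; rewrite -(bar_nth (Ordinal ib)).
move: (Ordinal ib) => {ib} j binf; case: k e c be j binf => [|k] e c be j binf.
  by rewrite -(bb_ell be); apply: VR_ell0; exact: bb_neq0 be j.
exfalso; have /card_gt0P[v _] := pm_nonempty X.
have bde : bd (VR F X) k.+1 (cone v (e j)) = e j.
  have := bd_cone v (e j); have := bb_cycle be j; rewrite memv_ker => /eqP.
  by rewrite /= => ->; rewrite (lin0 (@cone_lin _ _ _ _ _)) addr0.
have := bb_death be (i := j) (y := cone v (e j)); rewrite bde (bb_dual be) eqxx oner_neq0.
by move=> /(_ isT); rewrite binf leNgt ell_lty.
Qed.

Lemma VR_finite_bar (X : fin_pmetric R) k b (M : R) : 0 <= M ->
  (forall x y : X, pm_dist x y <= M) ->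
  b \in verbose_barcode (VR F X) k -> b.2 != +oo%E -> (b.2 <= M%:E)%E.
Proof.
move=> M0 dM; have [e [c be]] := verbose_barcode_basis (VR_is_verbose F X k).
move=> /(nthP b)[i ib <-]; rewrite -(bar_nth (Ordinal ib)).
have [->|[y [_ <-]]] := bb_fill be (Ordinal ib); first by rewrite eqxx.
by move=> _; apply: VR_ell_cval => s _ _; rewrite lee_fin; apply/diam_leP.
Qed.

Lemma dM_map (h : \bar R * \bar R -> \bar R * \bar R) s b : (0 <= b)%E ->
  (forall a, a \in s -> (bar_dist (h a) a <= b)%E) ->
  (dM (ms_of_seq (map h s)) (ms_of_seq s) <= b)%E.
Proof.
move=> b0 hs; apply: (@dM_le _ (ms_of_seq _) (ms_of_seq _) _ (cast_ord (size_map h s))).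
- exact: b0.
- by exists (cast_ord (esym (size_map h s))) => i; rewrite ?cast_ordK ?cast_ordKV.
move=> i /=; rewrite (tnth_nth (h (0%E, 0%E))) (tnth_nth (0%E, 0%E)) /=.
have si : (i < size s)%N by exact: leq_trans (ltn_ord i) (eq_leq (size_map h s)).
by rewrite (nth_map (0%E, 0%E))// hs// mem_nth.
Qed.

(* Long bars on both sides are matched with each other; the remaining ones are
   trivial on the side of [X] and matched with their midpoints on that of [Y]. *)
Lemma bottleneck_point (X Y : fin_pmetric R) k :
  (forall x x' : X, x = x') -> (forall y y' : Y, pm_dist y y' <= 1) ->
  (bottleneck F k X Y <= (1 / 2)%:E)%E.
Proof.
move=> X1 dY; have /card_gt0P[x0 _] := pm_nonempty X.
have surjl x : exists y : Y, x0 = x.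
  have /card_gt0P[y0 _] := pm_nonempty Y; exists y0; exact: X1.
have surjr y : exists y' : Y, y' = y by exists y.
pose T := @Tripod R X Y Y (fun _ => x0) id surjl surjr.
(* The matching obtained from this interleaving only serves to see that both sides have equally many
   infinite bars. *)
have il : interleaved (VR F (pull_l T)) (VR F (pull_r T)) 1.
  apply: interleaved_distortion => // z z' /=.
  by rewrite pm_refl sub0r normrN ger0_norm ?pm_dist_ge0.
have [f [g [ff fg gf fgK]]] := interleaved_global il.
have [||phi [bphi H]] := bar_matching (VR_is_verbose F (pull_l T) k)
  (VR_is_verbose F (pull_r T) k) ler01 (filtered_shift k ff) (filtered_shift k fg).
- by move=> z _; exact: gf.
- by move=> z _; exact: fgK.
set A := verbose_barcode _ _ in phi bphi H; set B := verbose_barcode _ _ in phi bphi H.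
have finA b : b \in A -> b.2 != +oo%E -> b = (0%E, 0%E).
  move=> bA binf; have [b12 b0] := VR_bars bA.
  have : (b.2 <= 0%:E)%E.
    by apply: VR_finite_bar bA binf => // z z'; rewrite /pm_dist /= pm_refl.
  case: b {bA binf} b12 b0 => [b1 b2] /= b12 b10 b20; congr (_, _); apply/le_anti.
    by rewrite b10 (le_trans b12).
  by rewrite b20 (le_trans b10).
(* Finite bars of [B] lie in the unit interval, so moving one to its midpoint costs at most
   [1 / 2]. *)
pose mid (b : \bar R * \bar R) := if b.2 == +oo%E then b else
  (((fine b.1 + fine b.2) / 2)%:E, ((fine b.1 + fine b.2) / 2)%:E).
have finB b : b \in B -> b.2 != +oo%E ->
    exists p q : R, [/\ b = (p%:E, q%:E), 0 <= p, p <= q & q <= 1].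
  move=> bB binf; have [b12 b0] := VR_bars bB.
  have : (b.2 <= 1%:E)%E by apply: VR_finite_bar bB binf.
  case: b {bB} b12 b0 binf => [[p| |] [q| |]] //=; rewrite !lee_fin => h1 h2 _ h3.
  by exists p, q.
have infB b : b \in B -> b.2 = +oo%E -> b = (0%E, +oo%E).
  move=> bB binf; have := VR_infinite_bar bB binf.
  by case: b bB binf => [? ?] /= _ -> ->.
have infA b : b \in A -> b.2 = +oo%E -> b = (0%E, +oo%E).
  move=> bB binf; have := VR_infinite_bar bB binf.
  by case: b bB binf => [? ?] /= _ -> ->.
have eqf : [seq b <- A | (b.1 < b.2)%E] = [seq b <- map mid B | (b.1 < b.2)%E].
  have fA : [seq b <- A | (b.1 < b.2)%E] = nseq (count (fun b => b.2 == +oo%E) A) (0%E, +oo%E).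
    have -> : [seq b <- A | (b.1 < b.2)%E] = [seq b <- A | b.2 == +oo%E].
      apply: eq_in_filter => b bA; have [binf|binf] := eqVneq b.2 +oo%E.
        by rewrite (infA _ bA binf) ltry.
      by rewrite (finA _ bA binf) ltxx.
    rewrite -size_filter; apply/all_pred1P/allP => b; rewrite mem_filter.
    by move=> /andP[/eqP binf bA] /=; rewrite (infA _ bA binf).
  have fB : [seq b <- map mid B | (b.1 < b.2)%E] =
      nseq (count (fun b => b.2 == +oo%E) B) (0%E, +oo%E).
    have -> : [seq b <- map mid B | (b.1 < b.2)%E] = [seq b <- map mid B | b.2 == +oo%E].
      apply: eq_in_filter => _ /mapP[b bB ->]; rewrite /mid.
      by case: eqP => [binf|_] /=; rewrite ?ltxx// (infB _ bB binf) eqxx ltry.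
    have -> : count (fun b => b.2 == +oo%E) B = count (fun b => b.2 == +oo%E) (map mid B).
      rewrite count_map; apply: eq_count => b /=; rewrite /mid.
      by case: ifPn => // ->.
    rewrite -size_filter; apply/all_pred1P/allP => c; rewrite mem_filter.
    move=> /andP[/eqP cinf /mapP[b bB cb]] /=; move: cinf; rewrite cb /mid.
    by case: eqP => // binf _; rewrite (infB _ bB binf).
  rewrite fA fB; congr (nseq _ _); rewrite !count_bars.
  rewrite -(card_imset _ (bij_inj bphi)); apply: eq_card => j.
  have [psi phiK psiK] := bphi.
  have same i : ((bar i).2 == +oo%E) = ((bar (phi i)).2 == +oo%E).
    have := H i; rewrite /bar_dist.
    case: (bar i) (bar (phi i)) => [a1 [a2| |]] [b1 [b2| |]] //=;
      by rewrite ?ltxx ?ltry ?eqxx.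
  rewrite inE; apply/imsetP/idP => [[i + ->]|jinf]; first by rewrite inE same.
  by exists (psi j); rewrite ?psiK// inE same psiK.
have isoX : ms_iso (ms_union (ms_of_seq (concise_barcode (VR F X) k)) (Defs.diag R))
    (ms_union (ms_of_seq (map mid B)) (Defs.diag R)).
  apply: ms_iso_trans (concise_iso F surjl k) _; rewrite -/A.
  apply: ms_iso_trans (concise_absorb (s := A) _) _; first exact: VR_bars.
  rewrite eqf; apply/ms_iso_sym/concise_absorb => _ /mapP[b bB ->].
  rewrite /mid; have [binf|binf] := eqVneq b.2 +oo%E; first exact: VR_bars bB.
  have [p [q [-> p0 pq q1]]] := finB _ bB binf; rewrite /= lexx lee_fin; split=> //.
  by lra.
apply: le_trans (dM_iso_le isoX (concise_iso F surjr k)) _.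
apply: le_trans (dM_union_diag _ _) _; apply: dM_map; first by rewrite lee_fin; lra.
move=> b bB; rewrite /mid; have [binf|binf] := eqVneq b.2 +oo%E.
  rewrite (infB _ bB binf) /bar_dist /= ?ltxx ?eqxx /Defs.edist eqxx lee_fin; lra.
have [p [q [-> p0 pq q1]]] := finB _ bB binf; rewrite /bar_dist /= !ltry /= !edist_EFin.
by rewrite ge_max !lee_fin !ler_distl; apply/andP; split; apply/andP; split; lra.
Qed.

End BottleneckStrict.

Section TripodStrict.
Context (R : realType) (F : fieldType).

Definition delta_chain (X : fin_pmetric R) k (a : {set X}) : VR_ch F X k :=
  [ffun t : simplex X k => (val t == a)%:R].

Lemma cval_delta (X : fin_pmetric R) k (a s : {set X}) : #|a| = k.+1 ->
  cval (delta_chain k a) s = (s == a)%:R.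
Proof.
move=> ha; have [hs|hs] := eqVneq #|s| k.+1.
  by rewrite (cval_ffun (fun s : {set X} => (s == a)%:R)).
by rewrite cval_out//; case: (eqVneq s a) hs => [->|_ _ //]; rewrite ha eqxx.
Qed.

Lemma cval_bd_delta (X : fin_pmetric R) k (a : {set X}) x : #|a| = k.+2 -> x \in a ->
  cval (VR_bd F X k (delta_chain k.+1 a)) (a :\ x) = sgn F a x.
Proof.
move=> ha xa; have hs : #|a :\ x| = k.+1 by move: ha; rewrite (cardsD1 x) xa => -[].
rewrite cval_bd// (bigD1 x) /=; last by rewrite !inE eqxx.
rewrite finset.setD1K// cval_delta// eqxx mulr1 big1 ?addr0// => y /andP[yax yx].
rewrite cval_delta//; case: eqP => [ya|_]; last by rewrite mulr0.
by move: yax; rewrite !inE yx /= -ya !inE eqxx.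
Qed.

Lemma filt_sum_lt (V : vectType F) (l : V -> \bar R) (I : Type) (s : seq I)
    (f : I -> V) (b : \bar R) : filtration l -> (-oo < b)%E ->
  (forall i, (l (f i) < b)%E) -> (l (\sum_(i <- s) f i)%R < b)%E.
Proof.
move=> fl b0 h; elim/big_ind: _ => // [|x y hx hy].
  by have [_ ->] := filt_eqNy fl 0.
by apply: le_lt_trans (filtD fl _ _) _; rewrite gt_max hx hy.
Qed.

Lemma complete_sym n : symmetric (fun _ _ : 'I_n => true).
Proof. by []. Qed.

Definition point_metric : fin_metric R := graph_metric R (@complete_sym 1).

Definition simplex_metric k : fin_metric R := graph_metric R (@complete_sym k.+2).

Lemma simplex_metric_le1 k (x y : simplex_metric k) : pm_dist x y <= 1.
Proof. by rewrite /pm_dist /= /graph_dist; case: ifP. Qed.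

Lemma simplex_metric_ge1 k (x y : simplex_metric k) : x != y -> 1 <= pm_dist x y.
Proof. exact: graph_dist_ge1. Qed.

Lemma diam_ge1 (X : fin_pmetric R) (s : {set X}) :
  (exists x y, [/\ x \in s, y \in s & 1 <= pm_dist x y]) -> 1 <= diam s.
Proof. by move=> [x [y [xs ys xy]]]; apply: le_trans xy (diam_ge xs ys). Qed.

Lemma card_ge2 (T : finType) (s : {set T}) : (1 < #|s|)%N ->
  exists x y, [/\ x \in s, y \in s & x != y].
Proof.
move=> h; have /card_gt0P[x xs] : (0 < #|s|)%N by exact: ltnW.
move: h; rewrite (cardsD1 x) xs => /card_gt0P[y]; rewrite !inE => /andP[yx ys].
by exists x, y; rewrite eq_sym.
Qed.

(** In positive degree, lift all vertices to [Z]. The boundary of the lifted simplex has level at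
    least [1], so it involves a basis cycle born at [1] or later, whose bar is finite. In degree [0]
    all births are [0]; there the death is bounded in the complete graph, and the bar is carried
    over by [concise_pullback]. *)
Lemma simplex_long_bar k (T : tripod point_metric (simplex_metric k)) :
  exists b, [/\ b \in verbose_barcode (VR F (pull_r T)) k, (1%:E <= b.2)%E &
    b.2 != +oo%E].
Proof.
set Y := simplex_metric k in T *; set Z := pull_r T.
case: k @Y T @Z => [|k] Y T Z.
  have [e [c be]] := verbose_barcode_basis (VR_is_verbose F Y 0).
  set a : {set Y} := [set: Y]; have ha : #|a| = 2%N by rewrite cardsT card_ord.
  set z := VR_bd F Y 0 (delta_chain 1 a).
  have z0 : z != 0.
    have /card_ge2[x [_ [xa _ _]]] : (1 < #|a|)%N by rewrite ha.
    apply/eqP => z0; have := cval_bd_delta ha xa.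
    by rewrite -/z z0 cval0 => /esym/eqP; rewrite (negbTE (sgn_neq0 _ _ _)).
  have /existsP[i ci] : [exists i, c i z != 0].
    apply: contraNT z0 => /existsPn h.
    have zc : z \in cycles (VR F Y) 0 by exact: (@bd_cycles _ _ (VR F Y)).
    rewrite (bb_sum be zc) big1// => i _.
    by have := h i; rewrite negbK => /eqP ->; rewrite scale0r.
  have ifin : (bar i).2 != +oo%E.
    by rewrite -ltey; apply: le_lt_trans (bb_death be ci) (ell_lty _).
  have i1 : (1%:E <= (bar i).2)%E.
    have [/eqP|[y [ye <-]]] := bb_fill be i; first by rewrite (negbTE ifin).
    have /existsP[t yt] : [exists t, y t != 0].
      have := bb_neq0 be i; apply: contraNT => /existsPn h; rewrite -ye.
      suff -> : y = 0 by rewrite linear0.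
      by apply/ffunP => t; have := h t; rewrite negbK ffunE => /eqP.
    apply: le_trans (VR_ell_ge yt); rewrite lee_fin; apply: diam_ge1.
    have [|u [v [ut vt uv]]] := @card_ge2 _ (val t); first by rewrite (eqP (valP t)).
    by exists u, v; split=> //; exact: simplex_metric_ge1.
  have i0 : (bar i).1 = 0%E.
    by rewrite -(bb_ell be); apply: VR_ell0; exact: bb_neq0 be i.
  have : bar i \in concise_barcode (VR F Y) 0.
    by rewrite mem_filter i0 (lt_le_trans _ i1) ?lte_fin// mem_tnth.
  rewrite (perm_mem (concise_pullback F (@tri_r_surj _ _ _ T) 0)) mem_filter.
  by move=> /andP[_ iV]; exists (bar i).
have [e [c be]] := verbose_barcode_basis (VR_is_verbose F Z k.+1).
have [s0 s0K] := choice (@tri_r_surj _ _ _ T); pose s : Y -> Z := s0.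
have sinj : injective s by apply: can_inj s0K.
have dist_s y y' : pm_dist (s y) (s y') = pm_dist y y' by rewrite /pm_dist /= !s0K.
set a : {set Z} := s @: [set: Y].
have ha : #|a| = k.+3 by rewrite card_imset// cardsT card_ord.
set z := VR_bd F Z k.+1 (delta_chain k.+2 a).
have z1 : (1%:E <= VR_ell z)%E.
  have /card_gt0P[x xa] : (0 < #|a|)%N by rewrite ha.
  have cz : cval z (a :\ x) != 0 by rewrite cval_bd_delta// sgn_neq0.
  have [hx] := cval_neq0 cz; apply: le_trans; rewrite lee_fin; apply: diam_ge1.
  have [|u [v [ut vt uv]]] := @card_ge2 _ (a :\ x); first by rewrite hx.
  exists u, v; split=> //; move: ut vt uv; rewrite !inE.
  move=> /andP[_ /imsetP[u' _ ->]] /andP[_ /imsetP[v' _ ->]] uv.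
  by rewrite dist_s; apply: simplex_metric_ge1; apply: contraNneq uv => ->.
have /existsP[i /andP[ci i1]] : [exists i, (c i z != 0) && (1%:E <= ell (e i))%E].
  move: z1; apply: contraLR => /existsPn h; rewrite -ltNge.
  have zc : z \in cycles (VR F Z) k.+1 by exact: (@bd_cycles _ _ (VR F Z)).
  rewrite (bb_sum be zc).
  have lt1 i : (ell (c i z *: e i) < 1%:E)%E.
    have := h i; rewrite negb_and negbK => /orP[/eqP ->|].
      by rewrite scale0r ell0 ltNyr.
    rewrite -ltNge => ei; have [->|ci] := eqVneq (c i z) 0.
      by rewrite scale0r ell0 ltNyr.
    by rewrite ellZ.
  exact: filt_sum_lt (ell_filtration (VR F Z) k.+1) (ltNyr _) lt1.
exists (bar i); split; first exact: mem_tnth.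
  by apply: le_trans (bar_le be i); rewrite -(bb_ell be).
by rewrite -ltey; apply: le_lt_trans (bb_death be ci) (ell_lty _).
Qed.

Lemma dM_long_bar (A B : seq (\bar R * \bar R)) :
  (forall a, a \in A -> a.2 != +oo%E -> a.2 = 0%E) ->
  (exists b, [/\ b \in B, (1%:E <= b.2)%E & b.2 != +oo%E]) ->
  (1%:E <= dM (ms_of_seq A) (ms_of_seq B))%E.
Proof.
move=> A0 [b [bB b1 bfin]]; apply: le_ereal_inf_tmp => _ [phi [[psi _ psiK] ->]].
move: bB => /(nthP b)[j jB bE].
rewrite le_max; apply/orP; right; apply: le_ereal_sup_tmp.
eexists; first by exists (psi (Ordinal jB)).
rewrite psiK /= [tnth (in_tuple B) _](_ : _ = b); last by rewrite (tnth_nth b).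
have := A0 _ (mem_tnth (psi (Ordinal jB)) (in_tuple A)).
move: (tnth _ _) => a a0; rewrite /bar_dist; have [ainf|ainf] := eqVneq a.2 +oo%E.
  by rewrite ainf ltxx /= (negbTE bfin) leey.
rewrite !ltey ainf bfin /= le_max (a0 ainf); apply/orP; right.
case: (b.2) b1 bfin => [q| |] //; rewrite lee_fin => q1 _; rewrite edist_EFin lee_fin.
by rewrite sub0r normrN (le_trans q1)// ler_norm.
Qed.

Lemma pullback_dB_simplex k :
  (1%:E <= pullback_dB F k Tri point_metric (simplex_metric k))%E.
Proof.
apply: le_ereal_inf_tmp => _ [T [_ ->]].
apply: dM_long_bar; last exact: simplex_long_bar.
move=> a aV ainf; have [a12 a0] := VR_bars aV; apply/le_anti.
rewrite (le_trans a0 a12) andbT; apply: VR_finite_bar aV ainf => // x y.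
rewrite /pm_dist /=.
by rewrite (ord1 (tri_l x)) (ord1 (tri_l y)) graph_distxx.
Qed.

Lemma bottleneck_simplex k k' :
  (bottleneck F k' point_metric (simplex_metric k) <= (1 / 2)%:E)%E.
Proof.
apply: bottleneck_point; last exact: simplex_metric_le1.
by move=> x x'; rewrite (ord1 x) (ord1 x').
Qed.

Lemma bottleneck_lt_pullback k :
  exists X Y : fin_metric R, (bottleneck F k X Y < pullback_dB F k Tri X Y)%E.
Proof.
exists point_metric, (simplex_metric k).
apply: le_lt_trans (bottleneck_simplex k k) _.
by apply: lt_le_trans (pullback_dB_simplex k); rewrite lte_fin; lra.
Qed.

Lemma sup_bottleneck_lt_pullback :
  exists X Y : fin_metric R, (sup_bottleneck F X Y < sup_pullback_dB F Tri X Y)%E.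
Proof.
exists point_metric, (simplex_metric 0).
apply: (@le_lt_trans _ _ (1 / 2)%:E).
  by apply: ge_ereal_sup => _ [k _ <-]; exact: bottleneck_simplex.
apply: (@lt_le_trans _ _ 1%:E); first by rewrite lte_fin; lra.
by apply: le_trans (pullback_dB_simplex 0) (ereal_sup_ubound _); exists 0%N.
Qed.

End TripodStrict.

(** * The star and the path *)

Section StarPath.
Context (R : realType) (F : fieldType).

Definition star4 : rel 'I_4 := fun i j => (val i == 0%N) || (val j == 0%N).

Lemma star4_sym : symmetric star4.
Proof. by move=> i j; rewrite /star4 orbC. Qed.

Definition path4 : rel 'I_4 := fun i j =>
  (val i, val j) \in [:: (0, 1); (1, 0); (0, 2); (2, 0); (2, 3); (3, 2)]%N.

Lemma path4_sym : symmetric path4.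
Proof. by move=> [[|[|[|[|i]]]] hi] [[|[|[|[|j]]]] hj]. Qed.

Lemma star4_far (i j : 'I_4) : i != j -> ~~ star4 i j ->
  (val i, val j) \in [:: (1, 2); (2, 1); (1, 3); (3, 1); (2, 3); (3, 2)]%N.
Proof. by case: i j => [[|[|[|[|i]]]] hi] [[|[|[|[|j]]]] hj]. Qed.

Lemma path4_far (i j : 'I_4) : i != j -> ~~ path4 i j ->
  (val i, val j) \in [:: (1, 2); (2, 1); (1, 3); (3, 1); (0, 3); (3, 0)]%N.
Proof. by case: i j => [[|[|[|[|i]]]] hi] [[|[|[|[|j]]]] hj]. Qed.

Definition star_metric : fin_metric R := graph_metric R star4_sym.

Definition path_metric : fin_metric R := graph_metric R path4_sym.

Lemma dGH_star_path : (1%:E <= 2%:E * dGH star_metric path_metric)%E.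
Proof.
apply: dGH_ge => f g h h0 dist; rewrite lee_fin.
pose c : star_metric := (ord0 : 'I_4).
(* Every vertex of the path misses some vertex, while the centre [c] of the star is within [1] of
   all points. The pairs [(c, f c)] and [(g y, y)] then give distortion at least [2 - 1]. *)
have [y far] : exists y : path_metric, pm_dist (f c) y = 2.
  rewrite /pm_dist /= /graph_dist; case: (f c) => [[|[|[|[|i]]]] hi] //.
  - by exists (@Ordinal 4 3 isT).
  - by exists (@Ordinal 4 2 isT).
  - by exists (@Ordinal 4 1 isT).
  - by exists (@Ordinal 4 0 isT).
have : `|pm_dist c (g y) - pm_dist (f c) y| <= 2 * h.
  apply: (dist (c, f c) (g y, y)); rewrite finset.in_setU.
    by rewrite (imset_f (fun x => (x, f x))).
  by rewrite orbC (imset_f (fun y => (g y, y))).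
rewrite far ler_distl => /andP[+ _].
have : pm_dist c (g y) <= 1.
  by rewrite /pm_dist /= /graph_dist /star4 /=; case: ifP => _; lra.
by lra.
Qed.

(** Nonzero chains of [W1] have level at least [1], and chains of [W2] at most [2]. So only a [c] of
    level below [2] matters, and then [d] has to avoid the long edges. *)
Lemma VR_ell_edge_le (W1 W2 : fin_pmetric R) (adj : rel W2)
    (c : VR_ch F W1 1) (d : VR_ch F W2 1) :
  (forall x y : W1, x != y -> 1 <= pm_dist x y) ->
  (forall x y : W2, pm_dist x y <= 2) ->
  (forall x y : W2, adj x y -> pm_dist x y <= 1) ->
  symmetric adj -> (c = 0 -> d = 0) ->
  ((VR_ell c < 2%:E)%E -> forall x y, x != y -> ~~ adj x y -> cval d [set x; y] = 0) ->
  (VR_ell d <= VR_ell c)%E.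
Proof.
move=> ge1 le2 adj1 sadj cd vd; apply: VR_ell_cval => s hs ds.
have [c2|c2] := leP 2%:E (VR_ell c).
  by apply: le_trans c2; rewrite lee_fin; apply/diam_leP.
have /existsP[t ct] : [exists t, c t != 0].
  apply: contraNT ds => /existsPn h; rewrite cd ?cval0//.
  by apply/ffunP => t; have := h t; rewrite negbK ffunE => /eqP.
apply: le_trans (VR_ell_ge ct); apply: (@le_trans _ _ 1%:E); rewrite lee_fin; last first.
  apply: diam_ge1; have [|x [y [xt yt xy]]] := @card_ge2 _ (val t).
    by rewrite (eqP (valP t)).
  by exists x, y; split=> //; exact: ge1.
have /cards2P[x [y [xy sE]]] : #|s| == 2%N by rewrite hs.
have {}adjxy : adj x y.
  by apply: contraNT ds => nadj; rewrite sE vd.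
apply/(@diam_leP R W2 s 1 ler01) => u v; rewrite sE !inE.
by move=> /orP[]/eqP -> /orP[]/eqP ->; rewrite ?pm_refl ?adj1 ?[adj y x]sadj.
Qed.

(** Two of any three vertices have the same colour. Star and path are both bipartite, so their
    filtrations differ in degree [1] only. *)
Lemma diam_bipartite (W : fin_pmetric R) (col : W -> bool) (s : {set W}) :
  (forall x y : W, pm_dist x y <= 2) ->
  (forall x y : W, x != y -> col x = col y -> pm_dist x y = 2) ->
  (2 < #|s|)%N -> diam s = 2.
Proof.
move=> le2 far s3; apply/eqP; rewrite eq_le; apply/andP; split; first exact/diam_leP.
have [x [y [xs ys xy cxy]]] : exists x y : W, [/\ x \in s, y \in s, x != y & col x = col y].
  pose A := [set x in s | col x]; pose B := [set x in s | ~~ col x].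
  have cAB : (#|A| + #|B| = #|s|)%N.
    rewrite -(cardsID [set x | col x] s); congr (_ + _)%N.
      by apply: eq_card => x; rewrite !inE.
    by apply: eq_card => x; rewrite !inE andbC.
  have [A2|A2] := ltnP 1 #|A|.
    have [x [y [+ + xy]]] := card_ge2 A2; rewrite !inE => /andP[xs cx] /andP[ys cy].
    by exists x, y; rewrite cx cy.
  have B2 : (1 < #|B|)%N by move: s3 A2; rewrite -cAB; lia.
  have [x [y [+ + xy]]] := card_ge2 B2; rewrite !inE => /andP[xs cx] /andP[ys cy].
  by exists x, y; rewrite (negbTE cx) (negbTE cy).
by rewrite -(far _ _ xy cxy) diam_ge.
Qed.

End StarPath.

Section Twist.
Context (R : realType) (F : fieldType) (Z : finType) (Z0 Z0' : (0 < #|Z|)%N).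
Variables (num : Z -> 'I_4) (pt : 'I_4 -> Z).
Hypotheses (numK : cancel num pt) (ptK : cancel pt num).
Variables (dX dY : Z -> Z -> R).
Hypotheses (rX : forall x, dX x x = 0) (sX : forall x y, dX x y = dX y x)
  (tX : forall x y z, dX x z <= dX x y + dX y z).
Hypotheses (rY : forall x, dY x x = 0) (sY : forall x y, dY x y = dY y x)
  (tY : forall x y z, dY x z <= dY x y + dY y z).
Hypothesis dXE : forall x y, dX x y = graph_dist R star4 (num x) (num y).
Hypothesis dYE : forall x y, dY x y = graph_dist R path4 (num x) (num y).

Let ZX := FinPMetric Z0 rX sX tX.
Let ZY := FinPMetric Z0' rY sY tY.

Let p0 : ZX := pt (@Ordinal 4 0 isT).
Let p1 : ZX := pt (@Ordinal 4 1 isT).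
Let p2 : ZX := pt (@Ordinal 4 2 isT).
Let p3 : ZX := pt (@Ordinal 4 3 isT).

Let n0 (x : ZX) : val (num x) = 0%N -> x = p0.
Proof. by move=> e; rewrite -[x]numK; congr pt; apply: val_inj. Qed.

Let n1 (x : ZX) : val (num x) = 1%N -> x = p1.
Proof. by move=> e; rewrite -[x]numK; congr pt; apply: val_inj. Qed.

Let n2 (x : ZX) : val (num x) = 2%N -> x = p2.
Proof. by move=> e; rewrite -[x]numK; congr pt; apply: val_inj. Qed.

Let n3 (x : ZX) : val (num x) = 3%N -> x = p3.
Proof. by move=> e; rewrite -[x]numK; congr pt; apply: val_inj. Qed.

Let ptP (z : ZX) : [\/ z = p0, z = p1, z = p2 | z = p3].
Proof.
have [[[h0 h1] h2] h3] := (@n0 z, @n1 z, @n2 z, @n3 z).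
case: (num z) h0 h1 h2 h3 => [[|[|[|[|i]]]] hi] //= h0 h1 h2 h3.
- by apply: Or41; exact: h0.
- by apply: Or42; exact: h1.
- by apply: Or43; exact: h2.
- by apply: Or44; exact: h3.
Qed.

Let adjX : rel Z := fun x y => star4 (num x) (num y).
Let adjY : rel Z := fun x y => path4 (num x) (num y).

Let eqE (x y : Z) : (x == y) = (num x == num y).
Proof. by rewrite (can_eq numK). Qed.

Let ptE i j : (pt i == pt j :> Z) = (i == j).
Proof. by rewrite (can_eq ptK). Qed.

Let pD : ((p0 == p1) = false) * ((p0 == p2) = false) * ((p0 == p3) = false)
  * ((p1 == p0) = false) * ((p1 == p2) = false) * ((p1 == p3) = false)
  * ((p2 == p0) = false) * ((p2 == p1) = false) * ((p2 == p3) = false)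
  * ((p3 == p0) = false) * ((p3 == p1) = false) * ((p3 == p2) = false).
Proof. by do !split; rewrite ptE. Qed.

Let numE : (num p0 = @Ordinal 4 0 isT) * (num p1 = @Ordinal 4 1 isT) *
  (num p2 = @Ordinal 4 2 isT) * (num p3 = @Ordinal 4 3 isT).
Proof. by do !split; rewrite ptK. Qed.

Let distX (x y : ZX) : @pm_dist R ZX x y =
  if x == y then 0 else if adjX x y then 1 else 2.
Proof. by rewrite /pm_dist /= dXE eqE. Qed.

Let distY (x y : ZY) : @pm_dist R ZY x y =
  if x == y then 0 else if adjY x y then 1 else 2.
Proof. by rewrite /pm_dist /= dYE eqE. Qed.

Let u : {set ZX} := [set p0; p2; p3].
Let zz : VR_ch F ZX 1 := VR_bd F ZX 1 (delta_chain F 2 u).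
(** The sign for which [lam c] is minus the coefficient of [c] at {0, 3} divided by that of [zz],
    when {0, 3} is the only edge of [c] at vertex 3. *)
Let kap : F := - (sgn F [set p0; p3] p0 * sgn F u p2).
Let lam (c : VR_ch F ZX 1) : F := kap * cval (VR_bd F ZX 0 c) [set p3].
(* Adding a multiple of the boundary of [u] turns the edge {0, 3}, which is short
   in the star and long in the path, into the chain 0 - 2 - 3. *)
Let twist (c : VR_ch F ZX 1) : VR_ch F ZX 1 := c + lam c *: zz.
Let untwist (c : VR_ch F ZX 1) : VR_ch F ZX 1 := c - lam c *: zz.

Let u0 : u :\ p0 = [set p2; p3].
Proof. by apply/setP => z; rewrite !inE; have [->|->|->|->] := ptP z; rewrite ?eqxx ?pD. Qed.

Let u2 : u :\ p2 = [set p0; p3].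
Proof. by apply/setP => z; rewrite !inE; have [->|->|->|->] := ptP z; rewrite ?eqxx ?pD. Qed.

Let cardu : #|u| = 3.
Proof. by rewrite /u -finset.setUA !cardsU1 cards1 !inE !pD. Qed.

Let bdzz : VR_bd F ZX 0 zz = 0.
Proof. exact: VR_bd_bd. Qed.

Let lamP a c d : lam (a *: c + d) = a * lam c + lam d.
Proof. by rewrite /lam linearP /= cvalP mulrDr mulrCA. Qed.

(** [lam] depends on the boundary only and [zz] is a cycle. This makes [twist] and [untwist] inverse
    to each other. *)
Let lamzz c a : lam (c + a *: zz) = lam c.
Proof. by rewrite addrC lamP {1}/lam bdzz cval0 !mulr0 add0r. Qed.

Let twistK c : untwist (twist c) = c.
Proof. by rewrite /untwist {2}/twist lamzz /twist addrK. Qed.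

Let untwistK c : twist (untwist c) = c.
Proof. by rewrite /twist {2}/untwist -scaleNr lamzz /untwist subrK. Qed.

Let twist_lin : linear twist.
Proof.
by move=> a c d; rewrite /twist lamP scalerDl scalerDr scalerA addrACA.
Qed.

Let untwist_lin : linear untwist.
Proof.
move=> a c d; rewrite /untwist lamP scalerDl scalerBr scalerA opprD.
by rewrite addrACA.
Qed.

Let bd_twist c : VR_bd F ZX 0 (twist c) = VR_bd F ZX 0 c.
Proof. by rewrite /twist linearD linearZ /= bdzz scaler0 addr0. Qed.

Let bd_untwist c : VR_bd F ZX 0 (untwist c) = VR_bd F ZX 0 c.
Proof. by rewrite /untwist linearB linearZ /= bdzz scaler0 subr0. Qed.

Let twist_bd y : twist (VR_bd F ZX 1 y) = VR_bd F ZX 1 y.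
Proof. by rewrite /twist /lam VR_bd_bd cval0 mulr0 scale0r addr0. Qed.

Let untwist_bd y : untwist (VR_bd F ZX 1 y) = VR_bd F ZX 1 y.
Proof. by rewrite /untwist /lam VR_bd_bd cval0 mulr0 scale0r subr0. Qed.

Let zz03 : cval zz [set p0; p3] = sgn F u p2.
Proof. by rewrite -u2 cval_bd_delta ?cardu// !inE eqxx ?orbT. Qed.

Let zz23 : cval zz [set p2; p3] = sgn F u p0.
Proof. by rewrite -u0 cval_bd_delta ?cardu// !inE eqxx. Qed.

Let zz1 x : x != p1 -> cval zz [set p1; x] = 0.
Proof.
move=> x1; rewrite cval_bd; last by rewrite cards2 eq_sym x1.
apply: big1 => y _; rewrite cval_delta ?cardu//; case: eqP => [e|]; last by rewrite mulr0.
have : p1 \in u by rewrite -e !inE eqxx orbT.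
by rewrite !inE !pD.
Qed.

Let bd3 (c : VR_ch F ZX 1) : cval (VR_bd F ZX 0 c) [set p3] =
  \sum_(x <- [:: p0; p1; p2]) sgn F [set x; p3] x * cval c [set x; p3].
Proof.
rewrite cval_bd ?cards1//.
rewrite (bigD1 p0) ?inE ?pD// (bigD1 p1) ?inE ?pD// (bigD1 p2) ?inE ?pD//= big1 ?addr0 => [|x].
  by rewrite !big_cons big_nil addr0.
by rewrite !inE; have [->|->|->|->] := ptP x; rewrite ?eqxx ?pD ?andbF.
Qed.

Let cval_far (W : fin_pmetric R) (c : VR_ch F W 1) x y : (VR_ell c < 2%:E)%E ->
  pm_dist x y = 2 -> cval c [set x; y] = 0.
Proof.
move=> c2 xy; apply/eqP; apply: contraTT c2 => /cval_neq0[_]; rewrite -leNgt.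
apply: le_trans; rewrite lee_fin -xy diam_ge// !inE eqxx ?orbT//.
Qed.

Let twist_ell c : (@VR_ell R F ZY 1 (twist c) <= @VR_ell R F ZX 1 c)%E.
Proof.
apply: (@VR_ell_edge_le R F ZX ZY adjY).
- by move=> x y /negbTE xy; rewrite distX xy; case: ifP => _; lra.
- by move=> x y; rewrite distY; case: ifP => _; [|case: ifP => _]; lra.
- by move=> x y xy; rewrite distY xy; case: ifP => _; lra.
- by move=> x y; exact: path4_sym.
- by move=> ->; exact: lin0 twist_lin.
move=> c2.
have z12 : cval c [set p1; p2] = 0 by apply: cval_far => //; rewrite distX pD /adjX !numE.
have z13 : cval c [set p1; p3] = 0 by apply: cval_far => //; rewrite distX pD /adjX !numE.
have z23 : cval c [set p2; p3] = 0 by apply: cval_far => //; rewrite distX pD /adjX !numE.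
have t12 : cval (twist c) [set p1; p2] = 0.
  by rewrite /twist cvalD cvalZ z12 zz1 ?pD// mulr0 addr0.
have t13 : cval (twist c) [set p1; p3] = 0.
  by rewrite /twist cvalD cvalZ z13 zz1 ?pD// mulr0 addr0.
have t03 : cval (twist c) [set p0; p3] = 0.
  rewrite /twist cvalD cvalZ zz03 /lam bd3 !big_cons big_nil z13 z23 !mulr0 !addr0.
  rewrite /kap; set s := sgn _ _ _; set t := sgn _ _ _; set w := cval _ _.
  rewrite (_ : _ + _ = w - (s * s) * (t * t) * w); last by ring.
  by rewrite !sgn_sqr mul1r mul1r subrr.
move=> x y; rewrite eqE => /path4_far far /far; rewrite !inE !xpair_eqE.
case/orP => [/andP[/eqP/n1 -> /eqP/n2 ->]|]; first exact: t12.
case/orP => [/andP[/eqP/n2 -> /eqP/n1 ->]|].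
  by rewrite finset.setUC; exact: t12.
case/orP => [/andP[/eqP/n1 -> /eqP/n3 ->]|]; first exact: t13.
case/orP => [/andP[/eqP/n3 -> /eqP/n1 ->]|].
  by rewrite finset.setUC; exact: t13.
case/orP => [/andP[/eqP/n0 -> /eqP/n3 ->]|]; first exact: t03.
case/andP => [/eqP/n3 -> /eqP/n0 ->].
by rewrite finset.setUC; exact: t03.
Qed.

Let untwist_ell c : (@VR_ell R F ZX 1 (untwist c) <= @VR_ell R F ZY 1 c)%E.
Proof.
apply: (@VR_ell_edge_le R F ZY ZX adjX).
- by move=> x y /negbTE xy; rewrite distY xy; case: ifP => _; lra.
- by move=> x y; rewrite distX; case: ifP => _; [|case: ifP => _]; lra.
- by move=> x y xy; rewrite distX xy; case: ifP => _; lra.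
- by move=> x y; exact: star4_sym.
- by move=> ->; exact: lin0 untwist_lin.
move=> c2.
have z12 : cval c [set p1; p2] = 0 by apply: (@cval_far ZY) => //; rewrite distY pD /adjY !numE.
have z13 : cval c [set p1; p3] = 0 by apply: (@cval_far ZY) => //; rewrite distY pD /adjY !numE.
have z03 : cval c [set p0; p3] = 0 by apply: (@cval_far ZY) => //; rewrite distY pD /adjY !numE.
have t12 : cval (untwist c) [set p1; p2] = 0.
  by rewrite /untwist cvalB cvalZ z12 zz1 ?pD// mulr0 subr0.
have t13 : cval (untwist c) [set p1; p3] = 0.
  by rewrite /untwist cvalB cvalZ z13 zz1 ?pD// mulr0 subr0.
(* On the path, {2, 3} is the only short edge at vertex 3, while [kap] was fitted to {0, 3};
   [sgn_swap] compares the signs of these two edges in [zz]. *)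
have t23 : cval (untwist c) [set p2; p3] = 0.
  rewrite /untwist cvalB cvalZ zz23 /lam bd3 !big_cons big_nil z13 z03 !mulr0 !addr0 !add0r.
  have := @sgn_swap R F ZX u p0 p2; rewrite u0 u2 !inE !eqxx ?orbT ?pD => /(_ isT isT isT).
  rewrite /kap; set s := sgn F [set p0; p3] _; set t := sgn F u p2; set w := cval _ _.
  set s' := sgn F [set p2; p3] _; set t' := sgn F u p0 => e.
  rewrite (_ : _ - _ = w + (s * s') * (t' * t) * w); last by ring.
  rewrite e (_ : _ + _ = w - (s * s) * (s' * s') * w); last by ring.
  by rewrite !sgn_sqr mul1r mul1r subrr.
move=> x y; rewrite eqE => /star4_far far /far; rewrite !inE !xpair_eqE.
case/orP => [/andP[/eqP/n1 -> /eqP/n2 ->]|]; first exact: t12.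
case/orP => [/andP[/eqP/n2 -> /eqP/n1 ->]|].
  by rewrite finset.setUC; exact: t12.
case/orP => [/andP[/eqP/n1 -> /eqP/n3 ->]|]; first exact: t13.
case/orP => [/andP[/eqP/n3 -> /eqP/n1 ->]|].
  by rewrite finset.setUC; exact: t13.
case/orP => [/andP[/eqP/n2 -> /eqP/n3 ->]|]; first exact: t23.
case/andP => [/eqP/n3 -> /eqP/n2 ->].
by rewrite finset.setUC; exact: t23.
Qed.

Let star4_col (i j : 'I_4) : i != j -> (val i == 0%N) = (val j == 0%N) ->
  star4 i j = false.
Proof. by case: i j => [[|[|[|[|i]]]] hi] [[|[|[|[|j]]]] hj]. Qed.

Let path4_col (i j : 'I_4) : i != j ->
  (val i \in [:: 1; 2]%N) = (val j \in [:: 1; 2]%N) -> path4 i j = false.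
Proof. by case: i j => [[|[|[|[|i]]]] hi] [[|[|[|[|j]]]] hj]. Qed.

Let diam_XY (s : {set ZX}) : #|s| != 2%N -> @diam R ZX s = @diam R ZY s.
Proof.
move=> s2; have [s3|s3] := ltnP 2 #|s|.
  have -> : @diam R ZX s = 2.
    apply: (@diam_bipartite R ZX (fun x => val (num x) == 0%N)) => // x y.
      by rewrite distX; case: ifP => _; [|case: ifP => _]; lra.
    move=> xy cxy; rewrite distX (negbTE xy) /adjX star4_col//.
    by rewrite -eqE.
  apply/esym; apply: (@diam_bipartite R ZY (fun x => val (num x) \in [:: 1; 2]%N)) => // x y.
    by rewrite distY; case: ifP => _; [|case: ifP => _]; lra.
  move=> xy cxy; rewrite distY (negbTE xy) /adjY path4_col//.
  by rewrite -eqE.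
have [s0|s0] := posnP #|s|.
  by move/cards0_eq: s0 => ->; rewrite /diam !big_set0.
have s1 : #|s| = 1%N by move: s2 s3 s0; case: #|s| => [|[|[|]]].
by rewrite (@diam_single R ZX)// (@diam_single R ZY).
Qed.

Let ell_XY k (c : VR_ch F ZX k) : k != 1%N -> @VR_ell R F ZX k c = @VR_ell R F ZY k c.
Proof.
move=> k1; apply: eq_bigr => s _; rewrite diam_XY//.
by rewrite (eqP (valP s)).
Qed.

Let tw k : VR_ch F ZX k -> VR_ch F ZX k :=
  match k with 1%N => twist | _ => id end.
Let untw k : VR_ch F ZX k -> VR_ch F ZX k :=
  match k with 1%N => untwist | _ => id end.

(** The twist preserves the boundaries of [1]-chains and fixes those of [2]-chains, so the identity
    in the other degrees completes it to a chain isomorphism. *)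
Lemma interleaved_twist : interleaved (VR F ZX) (VR F ZY) 0.
Proof.
exists (fun _ k => @tw k), (fun _ k => @untw k); split.
- split=> t; split.
  + move=> k x; rewrite addr0 /in_sublevel; apply: le_trans.
    case: k x => [|[|k]] x; [|exact: twist_ell|].
      by rewrite /= (@ell_XY 0).
    by rewrite /= (@ell_XY k.+2).
  + by move=> [|[|k]] a x y _ _ //; exact: twist_lin.
  + move=> [|[|k]] x _; [exact: (esym (bd_twist x))|exact: twist_bd|by []].
  + move=> k x; rewrite addr0 /in_sublevel; apply: le_trans.
    case: k x => [|[|k]] x; [|exact: untwist_ell|].
      by rewrite /= (@ell_XY 0).
    by rewrite /= (@ell_XY k.+2).
  + by move=> [|[|k]] a x y _ _ //; exact: untwist_lin.
  + move=> [|[|k]] x _; [exact: (esym (bd_untwist x))|exact: untwist_bd|by []].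
- by split.
- by move=> t [|[|k]] x _ //; exact: twistK.
- by move=> t [|[|k]] x _ //; exact: untwistK.
Qed.

End Twist.

Lemma pullback_dI_lt_dGH (R : realType) (F : fieldType) :
  exists X Y : fin_metric R, (pullback_dI F Map X Y < 2%:E * dGH X Y)%E.
Proof.
exists (star_metric R), (path_metric R); apply: (@le_lt_trans _ _ 0%:E).
  apply: ge_ereal_inf; eexists; first by exists (cor_tripod (@map_corP R (star_metric R) (path_metric R) id id)); split;
    [exists id, id|].
  apply: ereal_inf_lbound; exists 0 => //; split=> //.
  have in_diag (i : 'I_4) : (i, i) \in @map_cor R (star_metric R) (path_metric R) id id.
    by rewrite finset.in_setU (imset_f (fun x : 'I_4 => (x, x))).
  pose Z : finType := {p : star_metric R * path_metric R |
    p \in @map_cor R (star_metric R) (path_metric R) id id}.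
  pose num (z : Z) : 'I_4 := (val z).1.
  pose pt (i : 'I_4) : Z := exist _ (i, i) (in_diag i).
  have diagE w : w \in @map_cor R (star_metric R) (path_metric R) id id ->
      (w.1, w.1) = w by rewrite finset.in_setU => /orP[] /imsetP[x _ ->].
  have numK : cancel num pt by move=> z; apply: val_inj; exact: diagE (valP z).
  have sndE (z : Z) : (val z).2 = (val z).1 by rewrite -(diagE _ (valP z)).
  pose T := cor_tripod (@map_corP R (star_metric R) (path_metric R) id id).
  have dX x y : @pm_dist R (pull_l T) x y = graph_dist R star4 (num x) (num y) by [].
  have dY x y : @pm_dist R (pull_r T) x y = graph_dist R path4 (num x) (num y).
    by rewrite /num -!sndE.
  exact: (@interleaved_twist R F Z (@pm_nonempty R (pull_l T)) (@pm_nonempty R (pull_r T))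
    num pt numK (fun=> erefl) _ _ (@pm_refl R (pull_l T)) (@pm_sym R (pull_l T))
    (@pm_triangle R (pull_l T)) (@pm_refl R (pull_r T)) (@pm_sym R (pull_r T))
    (@pm_triangle R (pull_r T)) dX dY).
by apply: lt_le_trans (dGH_star_path R); rewrite lte_fin.
Qed.

(** * Simplex counts in sublevels and weighted clique counts *)

Section SublevelCount.
Context (R : realType) (F : fieldType).

Lemma delta_decomp (X : fin_pmetric R) k (c : VR_ch F X k) (N : {set {set X}}) :
  (forall t, t \in N -> #|t| = k.+1) ->
  (forall t, cval c t != 0 -> t \in N) ->
  c = \sum_(t <- enum N) cval c t *: delta_chain F k t.
Proof.
move=> Nk cN; apply: cval_eq => s hs; rewrite big_enum.
have sumE (I : finType) (P : pred I) (f : I -> VR_ch F X k) :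
    cval (\sum_(i | P i) f i) s = \sum_(i | P i) cval (f i) s.
  elim/big_rec2: _ => [|i y1 y2 _ <-]; first exact: cval0.
  exact: cvalD.
rewrite sumE; have [sN|sN] := boolP (s \in N).
  rewrite (bigD1 s) //= cvalZ cval_delta ?Nk// eqxx mulr1 big1 ?addr0// => t /andP[tN ts].
  by rewrite cvalZ cval_delta ?Nk// eq_sym (negbTE ts) mulr0.
have /eqP -> : cval c s == 0 by apply: contraNT sN => /cN.
rewrite big1// => t tN; rewrite cvalZ cval_delta ?Nk//.
by case: eqP sN => [->|_ _]; rewrite ?tN ?mulr0.
Qed.

Lemma VR_ell_delta (X : fin_pmetric R) k (a : {set X}) : #|a| = k.+1 ->
  (VR_ell (delta_chain F k a) <= (diam a)%:E)%E.
Proof.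
move=> ha; apply: VR_ell_cval => s _; rewrite cval_delta//.
by case: (s =P a) => [->//|]; rewrite eqxx.
Qed.

(** By [bb'], [f] maps the simplices counted on the left to combinations of those counted on the
    right, so the identity [g (f x) = x] factors through the latter. The product is the identity on
    all of [A], hence the constant rank. *)
Lemma sublevel_card_le (X Y : fin_pmetric R) (delta b b' : R)
    (f : forall k, ch (VR F X) k -> ch (VR F Y) k)
    (g : forall k, ch (VR F Y) k -> ch (VR F X) k) k :
  filtered_map delta f -> filtered_map delta g -> (forall k x, g k (f k x) = x) ->
  (forall t : {set Y}, diam t <= b + delta -> diam t <= b') ->
  (#|[set s : {set X} | (#|s| == k.+1) && (diam s <= b)%R]| <=
   #|[set t : {set Y} | (#|t| == k.+1) && (diam t <= b')%R]|)%N.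
Proof.
move=> ff fg gf bb'; set A := [set s | _]; set N := [set t | _].
apply: (@card_le_unitriangular F R _ _ A N
  (fun s t => cval (f k (delta_chain F k s)) t)
  (fun t s => cval (g k (delta_chain F k t)) s) (fun=> 0)).
move=> s s'; rewrite !inE => /andP[/eqP hs bs] /andP[/eqP hs' bs'] _.
rewrite eq_sym -[RHS](_ : cval (delta_chain F k s) s' = _); last by rewrite cval_delta.
rewrite -[in RHS](gf k (delta_chain F k s)).
rewrite [in RHS](@delta_decomp Y k (f k (delta_chain F k s)) N).
- rewrite (lin_sum _ _ _ (@fm_lin _ _ _ _ _ _ fg k)) big_enum.
  have sumE (I : finType) (P : pred I) (h : I -> VR_ch F X k) :
      cval (\sum_(i | P i) h i) s' = \sum_(i | P i) cval (h i) s'.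
    elim/big_rec2: _ => [|i y1 y2 _ <-]; first exact: cval0.
    exact: cvalD.
  by rewrite sumE; apply: eq_bigr => t _; rewrite cvalZ.
- by move=> t; rewrite inE => /andP[/eqP].
- move=> t /cval_neq0[ht dt]; rewrite inE ht eqxx bb'//= -lee_fin.
  apply: le_trans dt _; apply: le_trans (fm_ell ff _) _.
  by rewrite EFinD leeD// (le_trans (VR_ell_delta hs))// lee_fin.
Qed.

End SublevelCount.

Section CliqueCount.

(** A power set then weighs a power of 3, by the binomial theorem. Plain counts would give powers of
    2, and the residues [1] and [-1] that separate the two graphs coincide modulo 2. *)
Definition pow2_weight (Z : finType) (S : {set {set Z}}) := (\sum_(s in S) 2 ^ #|s|)%N.

Lemma pow2_weight_powerset (Z : finType) (A : {set Z}) :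
  pow2_weight (powerset A) = (3 ^ #|A|)%N.
Proof.
rewrite /pow2_weight; have [n] := ubnP #|A|; elim: n A => // n IHn A.
rewrite ltnS => An; have [->|[x xA]] := set_0Vmem A.
  by rewrite powerset0 big_set1 !cards0.
rewrite (bigID (fun s : {set Z} => x \in s)) /=.
have -> : (\sum_(s in powerset A | x \notin s) 2 ^ #|s| = 3 ^ #|A :\ x|)%N.
  rewrite -IHn; last by move: An; rewrite (cardsD1 x) xA.
  by apply: eq_bigl => s; rewrite !inE subsetD1.
have -> : (\sum_(s in powerset A | x \in s) 2 ^ #|s| = 2 * 3 ^ #|A :\ x|)%N.
  rewrite -IHn; last by move: An; rewrite (cardsD1 x) xA.
  rewrite big_distrr /= (reindex_onto (fun s => x |: s) (fun s => s :\ x)) /=.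
    apply: eq_big => s.
      rewrite !inE finset.subUset finset.sub1set xA eqxx andbT /= subsetD1.
      apply/andP/andP => [[sA /eqP e]|[sA xs]]; first by rewrite sA -e !inE eqxx.
      by rewrite sA finset.setU1K.
    rewrite !inE => /andP[/andP[_ _] /eqP e].
    by rewrite cardsU1 -{1}e !inE eqxx expnS.
  by move=> s /andP[_ xs]; rewrite finset.setD1K.
by rewrite (cardsD1 x A) xA expnS; lia.
Qed.

Lemma pow2_weightU (Z : finType) (S S' : {set {set Z}}) :
  (pow2_weight (S :|: S') + pow2_weight (S :&: S') = pow2_weight S + pow2_weight S')%N.
Proof.
rewrite /pow2_weight (big_setID S) /= finset.setUK finset.setDUl finset.setDv finset.set0U.
by rewrite [X in (_ = _ + X)%N](big_setID S) /= finset.setIC; lia.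
Qed.

Lemma pow2_weight_count (Z : finType) (P P' : pred {set Z}) :
  (forall m, #|[set s : {set Z} | (#|s| == m) && P s]| = #|[set s : {set Z} | (#|s| == m) && P' s]|) ->
  pow2_weight [set s : {set Z} | P s] = pow2_weight [set s : {set Z} | P' s].
Proof.
move=> h; have E (Q : pred {set Z}) : pow2_weight [set s : {set Z} | Q s] =
    (\sum_(m < #|Z|.+1) #|[set s : {set Z} | (#|s| == m) && Q s]| * 2 ^ m)%N.
  rewrite /pow2_weight (partition_big (fun s : {set Z} => inord #|s| : 'I_#|Z|.+1) xpredT)//=.
  apply: eq_bigr => m _; rewrite -sum_nat_const; apply: eq_big => s.
    rewrite !inE andbC -val_eqE /= inordK// ltnS; exact: max_card.
  rewrite inE => /andP[_ /eqP <-]; rewrite inordK// ltnS; exact: max_card.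
by rewrite !E; apply: eq_bigr => m _; rewrite h.
Qed.

(* Compares 3-adic valuations. *)
Lemma star_paw_weights (W a b c d r m s : nat) :
  (W + 3 ^ a + 3 ^ a = 3 ^ (a + b.+1) + 3 ^ (a + c.+1) + 3 ^ (a + d.+1))%N ->
  (W + 3 ^ r <> 3 ^ (r + m.+1) + 3 ^ (r + s.+1))%N.
Proof.
rewrite !expnD !expnS; move: (3 ^ b)%N (3 ^ c)%N (3 ^ d)%N (3 ^ m)%N (3 ^ s)%N.
move=> B C D M S; have ha : (0 < 3 ^ a)%N by rewrite expn_gt0.
have hr : (0 < 3 ^ r)%N by rewrite expn_gt0.
(* [W] is [3 ^ a] times a number congruent to [-2], that is to [1], modulo 3, and [3 ^ r] times one
   congruent to [-1]. So [a = r], and then the residues disagree. *)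
case: (ltngtP a r) => [ar|ra|<-] h1 h2.
- have e : (3 ^ r = 3 ^ a * (3 * 3 ^ (r - a).-1))%N.
    by rewrite -expnS -expnD; congr (_ ^ _)%N; lia.
  move: h1 h2; rewrite e; move: (3 ^ (r - a).-1)%N (3 ^ a)%N ha => t u u0 h1 h2.
  have : (u * (3 * (B + C + D) + 3 * t) = u * (3 * t * (3 * M + 3 * S) + 2))%N by nia.
  move/eqP; rewrite eqn_pmul2l// => /eqP; nia.
- have e : (3 ^ a = 3 ^ r * (3 * 3 ^ (a - r).-1))%N.
    by rewrite -expnS -expnD; congr (_ ^ _)%N; lia.
  move: h1 h2; rewrite e; move: (3 ^ (a - r).-1)%N (3 ^ r)%N hr => t u u0 h1 h2.
  have : (u * (3 * t * (3 * B + 3 * C + 3 * D) + 1) = u * (3 * (M + S) + 6 * t))%N by nia.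
  move/eqP; rewrite eqn_pmul2l// => /eqP; nia.
- have : (3 ^ a * (3 * (B + C + D)) = 3 ^ a * (3 * (M + S) + 1))%N by nia.
  by move/eqP; rewrite eqn_pmul2l// => /eqP; lia.
Qed.

End CliqueCount.

(** * The paw and the star: no interleaving below 1 *)

Section PawStar.
Context (R : realType) (F : fieldType).

(** The triangle 0, 1, 2 with vertex 3 attached to 0. *)
Definition paw4 : rel 'I_4 := fun i j =>
  [|| val i == 0%N, val j == 0%N | (val i != 3%N) && (val j != 3%N)].

Lemma paw4_sym : symmetric paw4.
Proof. by move=> i j; rewrite /paw4 orbCA [in RHS]andbC. Qed.

Definition paw_metric : fin_metric R := graph_metric R paw4_sym.

Section Cliques.
Variables (W : fin_pmetric R) (num : W -> 'I_4) (e : rel 'I_4).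
Hypothesis num_surj : forall i, exists z, num z = i.
Hypothesis distE : forall x y : W, pm_dist x y = graph_dist R e (num x) (num y).

Let fib (I : seq nat) : {set W} := [set z | val (num z) \in I].

Lemma graph_diam_le1 (s : {set W}) : reflect
  (forall x y, x \in s -> y \in s -> (num x == num y) || e (num x) (num y))
  (diam s <= 1).
Proof.
apply: (iffP (diam_leP _ ler01)) => h x y xs ys.
  have := h x y xs ys; rewrite distE /graph_dist; case: eqP => //= _.
  by case: ifP => // _; lra.
have := h x y xs ys; rewrite distE /graph_dist; case: eqP => //= _.
by move=> ->.
Qed.

Let card_fib i : (0 < #|fib [:: val (i : 'I_4)]|)%N.
Proof. by have [z zi] := num_surj i; apply/card_gt0P; exists z; rewrite !inE zi. Qed.

Let fibD (I J : seq nat) : {in I, forall i, i \notin J} ->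
  #|fib (I ++ J)| = (#|fib I| + #|fib J|)%N.
Proof.
move=> IJ; have -> : fib (I ++ J) = fib I :|: fib J.
  by apply/setP => z; rewrite !inE mem_cat.
rewrite cardsU -[RHS]subn0; congr (_ - _)%N; apply/eqP; rewrite cards_eq0.
apply/eqP/setP => z; rewrite !inE; apply/negP => /andP[/IJ].
by move=> /negbTE ->.
Qed.

Let powersetI (A B : {set W}) : powerset A :&: powerset B = powerset (A :&: B).
Proof. by apply/setP => s; rewrite !inE finset.subsetI. Qed.

Let fibI (I J K : seq nat) : (forall i, (i \in I) && (i \in J) = (i \in K)) ->
  fib I :&: fib J = fib K.
Proof. by move=> h; apply/setP => z; rewrite !inE h. Qed.

(** Sets of diameter at most [1] lie over one of the three edges, and the preimages of two edges
    meet in the fibre over the centre; inclusion-exclusion gives the formula. The successors record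
    that fibres are nonempty. *)
Lemma star_weight : e =2 star4 -> exists a b c d,
  (pow2_weight [set s : {set W} | (diam s <= 1)%R] + 3 ^ a + 3 ^ a =
   3 ^ (a + b.+1) + 3 ^ (a + c.+1) + 3 ^ (a + d.+1))%N.
Proof.
move=> eE; exists #|fib [:: 0%N]|, #|fib [:: 1%N]|.-1, #|fib [:: 2%N]|.-1, #|fib [:: 3%N]|.-1.
rewrite !prednK ?(card_fib (@Ordinal 4 1 isT)) ?(card_fib (@Ordinal 4 2 isT))
  ?(card_fib (@Ordinal 4 3 isT))//.
have -> : [set s : {set W} | diam s <= 1] =
    powerset (fib [:: 0; 1]%N) :|: powerset (fib [:: 0; 2]%N) :|: powerset (fib [:: 0; 3]%N).
  apply/setP => s; rewrite !inE; apply/graph_diam_le1/orP => [h|h x y xs ys]; last first.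
    rewrite eE /star4; case: h => [/orP[]|] /fintype.subsetP sub; have := sub _ xs;
      have := sub _ ys; rewrite !inE -val_eqE /= => /orP[] /eqP -> /orP[] /eqP -> //.
  have [s0|] := boolP (s \subset fib [:: 0; 1]%N); first by left.
  move=> /subsetPn[x xs]; rewrite !inE => xn.
  have sub (i : nat) : val (num x) = i -> s \subset fib [:: 0%N; i].
    move=> /= xi; apply/fintype.subsetP => y ys; rewrite !inE.
    have := h x y xs ys; rewrite eE /star4 -val_eqE /= xi.
    move: xn; rewrite /= xi; case: (i == 0%N) => //= _.
    by move=> /orP[/eqP ->|->]; rewrite ?eqxx ?orbT.
  case: (num x) xn sub => [[|[|[|[|i]]]] hi] //= _ sub.
    by left; rewrite (sub 2%N).
  by right; rewrite (sub 3%N).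
have h1 := pow2_weightU (powerset (fib [:: 0; 1]%N)) (powerset (fib [:: 0; 2]%N)).
have h2 := pow2_weightU (powerset (fib [:: 0; 1]%N) :|: powerset (fib [:: 0; 2]%N))
  (powerset (fib [:: 0; 3]%N)).
move: h1 h2; rewrite finset.setIUl !powersetI.
rewrite (@fibI [:: 0; 1]%N [:: 0; 2]%N [:: 0]%N); last by move=> [|[|[|i]]].
rewrite (@fibI [:: 0; 1]%N [:: 0; 3]%N [:: 0]%N); last by move=> [|[|[|[|i]]]].
rewrite (@fibI [:: 0; 2]%N [:: 0; 3]%N [:: 0]%N); last by move=> [|[|[|[|i]]]].
rewrite finset.setUid !pow2_weight_powerset.
rewrite (@fibD [:: 0]%N [:: 1]%N) ?(@fibD [:: 0]%N [:: 2]%N) ?(@fibD [:: 0]%N [:: 3]%N);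
  try by move=> i; rewrite !inE => /eqP ->.
by move=> h1 h2; rewrite h2 addnAC h1.
Qed.

(** The same count with the maximal cliques {0, 1, 2} and {0, 3}, which meet in vertex 0. *)
Lemma paw_weight : e =2 paw4 -> exists r m s,
  (pow2_weight [set s : {set W} | (diam s <= 1)%R] + 3 ^ r =
   3 ^ (r + m.+1) + 3 ^ (r + s.+1))%N.
Proof.
move=> eE; exists #|fib [:: 0%N]|, #|fib [:: 1%N; 2%N]|.-1, #|fib [:: 3%N]|.-1.
rewrite !prednK ?(card_fib (@Ordinal 4 3 isT))//; last first.
  rewrite (@fibD [:: 1]%N [:: 2]%N); last by move=> i; rewrite !inE => /eqP ->.
  by rewrite addn_gt0 (card_fib (@Ordinal 4 1 isT)).
have -> : [set s : {set W} | diam s <= 1] =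
    powerset (fib [:: 0; 1; 2]%N) :|: powerset (fib [:: 0; 3]%N).
  apply/setP => s; rewrite !inE; apply/graph_diam_le1/orP => [h|h x y xs ys]; last first.
    rewrite eE /paw4; case: h => /fintype.subsetP sub; have := sub _ xs;
      have := sub _ ys; rewrite !inE -val_eqE /=.
      by move=> /or3P[] /eqP -> /or3P[] /eqP ->.
    by move=> /orP[] /eqP -> /orP[] /eqP ->.
  have [s0|] := boolP (s \subset fib [:: 0; 1; 2]%N); first by left.
  move=> /subsetPn[x xs]; rewrite !inE => xn; right.
  apply/fintype.subsetP => y ys; rewrite !inE.
  have := h x y xs ys; rewrite eE /paw4 -val_eqE /=.
  by case: (num x) (num y) xn => [[|[|[|[|i]]]] hi] // [[|[|[|[|j]]]] hj].
have := pow2_weightU (powerset (fib [:: 0; 1; 2]%N)) (powerset (fib [:: 0; 3]%N)).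
rewrite powersetI (@fibI [:: 0; 1; 2]%N [:: 0; 3]%N [:: 0]%N); last by move=> [|[|[|[|i]]]].
rewrite !pow2_weight_powerset (@fibD [:: 0]%N [:: 1; 2]%N); last by move=> i; rewrite !inE => /eqP ->.
by rewrite (@fibD [:: 0]%N [:: 3]%N)//; move=> i; rewrite !inE => /eqP ->.
Qed.

End Cliques.

Lemma dI_paw_star_ge1 (T : tripod paw_metric (star_metric R)) :
  (1%:E <= dI (VR F (pull_l T)) (VR F (pull_r T)))%E.
Proof.
apply: le_ereal_inf_tmp => _ [delta [d0 il] <-]; rewrite lee_fin leNgt; apply/negP => d1.
have [f [g [ff fg gf fgK]]] := interleaved_global il.
(* No distance lies strictly between [1] and [2], so a shift by less than [1] adds no simplex to the
   sublevel at [1]. *)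
have gap (W : fin_pmetric R) (num : W -> 'I_4) e : (forall x y : W,
    pm_dist x y = graph_dist R e (num x) (num y)) ->
    forall t : {set W}, diam t <= 1 + delta -> diam t <= 1.
  move=> dE t /diam_leP h; apply/(@diam_leP R W t 1 ler01) => x y xt yt.
  have := h _ x y xt yt; rewrite dE /graph_dist; case: ifP => // _; case: ifP => // _.
  by move=> /(_ _); rewrite addr_ge0// => /(_ isT); lra.
have gapX := gap (pull_l T) (@tri_l _ _ _ T) paw4 (fun x y => erefl).
have gapY := gap (pull_r T) (@tri_r _ _ _ T) star4 (fun x y => erefl).
have cnt m : #|[set s : {set tri_set T} | (#|s| == m) && (@diam R (pull_l T) s <= 1)%R]| =
    #|[set s : {set tri_set T} | (#|s| == m) && (@diam R (pull_r T) s <= 1)%R]|.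
  case: m => [|k].
    apply: eq_card => s; rewrite !inE; have [s0|//] := eqVneq #|s| 0%N.
    by move/cards0_eq: s0 => ->; rewrite /diam !big_set0.
  apply/eqP; rewrite eqn_leq; apply/andP; split.
    exact: (@sublevel_card_le R F (pull_l T) (pull_r T) delta 1 1 f g k ff fg gf gapY).
  exact: (@sublevel_card_le R F (pull_r T) (pull_l T) delta 1 1 g f k fg ff fgK gapX).
have := pow2_weight_count cnt.
have [a [b [c [d ha]]]] := @star_weight (pull_r T) (@tri_r _ _ _ T) star4
  (@tri_r_surj _ _ _ T) (fun x y => erefl) (fun x y => erefl).
have [r [m [s hr]]] := @paw_weight (pull_l T) (@tri_l _ _ _ T) paw4
  (@tri_l_surj _ _ _ T) (fun x y => erefl) (fun x y => erefl).
move=> e; apply: (star_paw_weights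
  (W := pow2_weight [set s : {set tri_set T} | (@diam R (pull_r T) s <= 1)%R]) ha).
rewrite -e; exact: hr.
Qed.

End PawStar.

(** * Barcodes in the presence of a cone vertex *)

(** At most one pair of points is closer than [1]. Doubling a vertex creates such a pair, at
    distance [0]. *)
Definition few_short (R : realType) (W : fin_pmetric R) :=
  exists t0 : {set W}, forall x y : W, x != y -> pm_dist x y < 1 -> [set x; y] = t0.

Section ConeVertex.
Context (R : realType) (F : fieldType) (Z : finType) (Z0 Z0' : (0 < #|Z|)%N).
Variables (dX dY : Z -> Z -> R).
Hypotheses (rX : forall x, dX x x = 0) (sX : forall x y, dX x y = dX y x)
  (tX : forall x y z, dX x z <= dX x y + dX y z).
Hypotheses (rY : forall x, dY x x = 0) (sY : forall x y, dY x y = dY y x)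
  (tY : forall x y z, dY x z <= dY x y + dY y z).
Let ZX := FinPMetric Z0 rX sX tX.
Let ZY := FinPMetric Z0' rY sY tY.

(** Three vertices span several pairs, of which only one can be short. *)
Let chain_ge1 (W : fin_pmetric R) k (c : VR_ch F W k) : few_short W ->
  (forall x y : W, x != y -> 1 <= pm_dist x y) \/ (1 < k)%N -> (0 < k)%N ->
  c != 0 -> (1%:E <= VR_ell c)%E.
Proof.
move=> [t0 ht0] far k0 c0; have /existsP[t ct] : [exists t, c t != 0].
  apply: contraNT c0 => /existsPn h; apply/eqP/ffunP => t.
  by have := h t; rewrite negbK ffunE => /eqP.
apply: le_trans (VR_ell_ge ct); rewrite lee_fin leNgt; apply/negP => t1.
have tk : #|val t| = k.+1 by apply/eqP/(valP t).
have lt x y : x \in val t -> y \in val t -> pm_dist x y < 1.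
  by move=> xt yt; apply: le_lt_trans (diam_ge xt yt) t1.
have [x [y [xt yt xy]]] : exists x y, [/\ x \in val t, y \in val t & x != y].
  by apply: card_ge2; rewrite tk.
case: far => [far|k1]; first by have := far x y xy; rewrite leNgt lt.
have /set0Pn[z] : val t :\ x :\ y != finset.set0.
  rewrite -card_gt0 cardsDS; last by rewrite finset.sub1set !inE eq_sym xy yt.
  rewrite cards1 cardsDS ?finset.sub1set// cards1 tk; move: k1; lia.
rewrite !inE => /and3P[zy zx zt].
have e1 := ht0 _ _ xy (lt _ _ xt yt); have xz : x != z by rewrite eq_sym.
have e2 := ht0 _ _ xz (lt _ _ xt zt).
have : z \in [set x; y] by rewrite e1 -e2 !inE eqxx orbT.
by rewrite !inE (negbTE zx) (negbTE zy).
Qed.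

(** In degree [1], a chain of level below [1] is a multiple of the single short edge, and a nonzero
    multiple is not a cycle. *)
Let cycle_ge1 (W : fin_pmetric R) k (c : VR_ch F W k) : few_short W -> (0 < k)%N ->
  c \in cycles (VR F W) k -> c != 0 -> (1%:E <= VR_ell c)%E.
Proof.
move=> fW k0 cc c0; have [k1|k1] := ltnP 1 k.
  by apply: chain_ge1 => //; right.
have k1' : k = 1%N by lia.
move: k1' c cc c0 => {k0 k1} -> c cc c0; have [t0 ht0] := fW.
rewrite leNgt; apply/negP => c1.
have supp s : cval c s != 0 -> s = t0.
  move=> cs; have [hs ds] := cval_neq0 cs.
  have /cards2P[x [y [xy sE]]] : #|s| == 2%N by rewrite hs.
  rewrite sE; apply: ht0 => //; rewrite -lte_fin; apply: le_lt_trans c1.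
  by apply: le_trans ds; rewrite lee_fin diam_ge// sE !inE eqxx ?orbT.
have /existsP[t ct] : [exists t, c t != 0].
  apply: contraNT c0 => /existsPn h; apply/eqP/ffunP => t.
  by have := h t; rewrite negbK ffunE => /eqP.
have ct' : cval c (val t) != 0 by rewrite cval_val.
have tE := supp _ ct'.
have /cards2P[x [y [xy sE]]] : #|val t| == 2%N by exact: (valP t).
move: cc; rewrite memv_ker => /eqP bc.
have : cval (VR_bd F W 0 c) [set y] = 0 by rewrite /= in bc; rewrite bc cval0.
rewrite cval_bd ?cards1// (bigD1 x) ?inE//= big1 ?addr0 => [/eqP|z /andP[zy zx]].
  by rewrite -sE mulf_eq0 (negbTE (sgn_neq0 _ _ _)) (negbTE ct').
have [-> | cz] := eqVneq (cval c (z |: [set y])) 0; first by rewrite mulr0.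
have := supp _ cz; rewrite -tE sE => /setP/(_ z); rewrite !inE eqxx /= => /esym.
by move: zy; rewrite !inE (negbTE zx) => /negbTE ->.
Qed.

Variable v : Z.
Hypotheses (vX : forall z, dX v z <= 1) (vY : forall z, dY v z <= 1).

Let diam_cone (W : fin_pmetric R) (w : W) (u : {set W}) : (forall z : W, pm_dist w z <= 1) ->
  diam u <= Num.max 1 (diam (u :\ w)).
Proof.
move=> wz; apply/diam_leP; first by rewrite le_max ler01.
move=> x y xu yu; rewrite le_max.
have [->|xw] := eqVneq x w; first by rewrite wz.
have [->|yw] := eqVneq y w; first by rewrite pm_sym wz.
by apply/orP; right; apply: diam_ge; rewrite !inE ?xw ?yw.
Qed.

(** Coning with [v] fills a boundary at level at most [1], and no filling of a nonzero boundary is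
    cheaper. So the identity is a shift map with [delta = 0] in both directions. *)
Lemma dM_cone0 : (forall x y, x != y -> 1 <= dX x y) -> (forall x y, x != y -> 1 <= dY x y) ->
  (dM (ms_of_seq (verbose_barcode (VR F ZX) 0)) (ms_of_seq (verbose_barcode (VR F ZY) 0))
   <= 0)%E.
Proof.
move=> farX farY.
have short (W : fin_pmetric R) : (forall x y : W, x != y -> 1 <= pm_dist x y) -> few_short W.
  by move=> far; exists finset.set0 => x y xy; rewrite ltNge far.
have shift (W1 W2 : fin_pmetric R) (w : W2) (id' : VR_ch F W1 0 -> VR_ch F W2 0) :
    (forall x y : W1, x != y -> 1 <= pm_dist x y) -> (forall z : W2, pm_dist w z <= 1) ->
    linear id' -> (forall c, VR_bd F W2 0 (cone w (id' (VR_bd F W1 0 c))) = id' (VR_bd F W1 0 c)) ->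
    @shift_map R F (VR F W1) (VR F W2) 0 0 id'.
  move=> far wz lid hid; split=> //.
  - by move=> z _; rewrite memvf.
  - move=> z _; rewrite adde0 /=; have [->|z0] := eqVneq z 0.
      by rewrite (lin0 lid) (_ : VR_ell _ = -oo%E) ?leNye//; exact/VR_ell_eqNy.
    by rewrite (VR_ell0 z0) VR_ell0_le.
  - move=> y; rewrite adde0; have [y0|y0] := eqVneq (VR_bd F W1 0 y) 0.
      exists 0; rewrite /= y0 linear0 (lin0 lid) (_ : VR_ell _ = -oo%E) ?leNye//.
      exact/VR_ell_eqNy.
    exists (cone w (id' (VR_bd F W1 0 y))); split; first exact: hid.
    apply: (@le_trans _ _ 1%:E).
      apply: VR_ell_cval => u hu; rewrite cval_cone; case: ifP => [wu _|]; last by rewrite eqxx.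
      rewrite lee_fin; apply: le_trans (diam_cone u wz) _.
      by rewrite diam_single ?ge_max ?lexx ?ler01//; move: hu; rewrite (cardsD1 w) wu => -[].
    apply: chain_ge1 => //; [exact: short|by left|].
    by apply: contraNneq y0 => ->; rewrite linear0.
have fill (W : fin_pmetric R) (w : W) c :
    VR_bd F W 0 (cone w (VR_bd F W 0 c)) = VR_bd F W 0 c.
  by rewrite -[in RHS](bd_cone w c) linearD /= VR_bd_bd add0r.
have s1 := @shift ZX ZY v id farX vY (fun _ _ _ => erefl) (@fill ZX v).
have s2 := @shift ZY ZX v id farY vX (fun _ _ _ => erefl) (@fill ZY v).
have [||phi [bphi H]] := bar_matching (VR_is_verbose F ZX 0) (VR_is_verbose F ZY 0) (lexx 0) s1 s2.
- by [].
- by [].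
by apply: (@dM_le _ (ms_of_seq _) (ms_of_seq _) _ phi); [exact: lexx|exact: bphi|exact: H].
Qed.

Variable sigma : {set Z} -> {set Z}.
Hypotheses (sigmaK : involutive sigma) (card_sigma : forall s, #|sigma s| = #|s|)
  (mem_sigma : forall s, (v \in sigma s) = (v \in s)).

(* A cycle is determined by its values on the simplices avoiding [v], since it
   is the boundary of its cone, and these values may be permuted at will. *)
Lemma dM_cone k : few_short ZX -> few_short ZY -> (0 < k)%N ->
  (forall s : {set Z}, v \notin s -> #|s| = k.+1 ->
     @diam R ZY (sigma s) <= Num.max 1 (@diam R ZX s)) ->
  (forall s : {set Z}, v \notin s -> #|s| = k.+1 ->
     @diam R ZX (sigma s) <= Num.max 1 (@diam R ZY s)) ->
  (dM (ms_of_seq (verbose_barcode (VR F ZX) k)) (ms_of_seq (verbose_barcode (VR F ZY) k))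
   <= 0)%E.
Proof.
move=> shX shY; case: k => // k _ hXY hYX.
pose per (c : VR_ch F ZX k.+1) : VR_ch F ZX k.+1 :=
  [ffun t : simplex ZX k.+1 => cval c (sigma (val t))].
have cval_per c (s : {set ZX}) : #|s| = k.+2 -> cval (per c) s = cval c (sigma s).
  by move=> hs; rewrite (cval_ffun (fun s : {set ZX} => cval c (sigma s))).
have per_lin : linear per.
  by move=> a c d; apply: cval_eq => s hs; rewrite cvalP !cval_per// cvalP.
(* The only cycle that agrees with [per c] on the simplices avoiding [v]. *)
pose f (c : VR_ch F ZX k.+1) : VR_ch F ZX k.+1 := VR_bd F ZX k.+1 (cone (v : ZX) (per c)).
have f_lin : linear f by move=> a c d; rewrite /f per_lin cone_lin linearP.
have cval_f c (s : {set ZX}) : #|s| = k.+2 -> v \notin s -> cval (f c) s = cval c (sigma s).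
  by move=> hs vs; rewrite bd_cone_out// cval_per.
have f_cycle c : VR_bd F ZX k (f c) = 0 by exact: VR_bd_bd.
have ext c d : VR_bd F ZX k c = 0 -> VR_bd F ZX k d = 0 ->
    (forall s : {set ZX}, #|s| = k.+2 -> v \notin s -> cval c s = cval d s) -> c = d.
  move=> bc bd' cd; apply/eqP; rewrite -subr_eq0; apply/eqP.
  rewrite -(bd_cone (v : ZX) (c - d)) linearB /= bc bd' subrr (lin0 (@cone_lin _ _ _ _ _)) addr0.
  suff -> : cone (v : ZX) (c - d) = 0 by rewrite linear0.
  apply: cval_eq => u hu; rewrite cval_cone cval0; case: ifPn => // vu.
  rewrite cvalB cd ?subrr ?mulr0//; first by move: hu; rewrite (cardsD1 v) vu => -[].
  by rewrite !inE eqxx.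
have ffK c : VR_bd F ZX k c = 0 -> f (f c) = c.
  move=> bc; apply: ext => // s hs vs; rewrite !cval_f ?sigmaK ?card_sigma//.
  by rewrite mem_sigma.
(* Here [h] is the cone filling. The [1] in its level bound costs nothing: nonzero cycles in this
   degree, and nonzero chains one degree higher, have level at least [1]. *)
have shift (W1 W2 : fin_pmetric R) (f' : VR_ch F W1 k.+1 -> VR_ch F W2 k.+1)
    (h : VR_ch F W1 k.+1 -> VR_ch F W2 k.+2) :
    few_short W1 -> linear f' ->
    (forall c, f' c = VR_bd F W2 k.+1 (h c)) ->
    (forall c, (VR_ell (h c) <= maxe 1%:E (VR_ell c))%E) ->
    @shift_map R F (VR F W1) (VR F W2) k.+1 0 f'.
  move=> sh lf f'E hl; split=> //.
  - by move=> z _; rewrite memv_ker /= f'E VR_bd_bd.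
  - move=> z zc; rewrite adde0 /=; have [->|z0] := eqVneq z 0.
      by rewrite (lin0 lf) (_ : VR_ell _ = -oo%E) ?leNye//; exact/VR_ell_eqNy.
    rewrite f'E; apply: le_trans (VR_ell_bd _) _; apply: le_trans (hl _) _.
    by rewrite ge_max lexx andbT; exact: (cycle_ge1 sh _ zc).
  - move=> y; rewrite adde0 /=; have [y0|y0] := eqVneq y 0.
      exists 0; rewrite y0 !linear0 (lin0 lf); split=> //.
      by rewrite (_ : VR_ell _ = -oo%E) ?leNye//; exact/VR_ell_eqNy.
    exists (h (VR_bd F W1 k.+1 y)); split; first by rewrite f'E.
    apply: le_trans (hl _) _; rewrite ge_max; apply/andP; split; last exact: VR_ell_bd.
    by apply: chain_ge1 => //; right.
have ell_h (W1 W2 : fin_pmetric R) (c : VR_ch F W1 k.+1) (h : VR_ch F W2 k.+2) (w : W2)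
    (sg : {set W2} -> {set W1}) : (forall z : W2, pm_dist w z <= 1) ->
    (forall s : {set W2}, w \notin s -> #|s| = k.+2 -> diam s <= Num.max 1 (diam (sg s))) ->
    (forall u : {set W2}, cval h u != 0 -> w \in u /\ cval c (sg (u :\ w)) != 0) ->
    (VR_ell h <= maxe 1%:E (VR_ell c))%E.
  move=> wz hd hc; apply: VR_ell_cval => u hu hn; have [wu /cval_neq0[_ cu]] := hc u hn.
  apply: (@le_trans _ _ (maxe 1%:E (diam (sg (u :\ w)))%:E)); last first.
    by rewrite ge_max !le_max lexx /= cu orbT.
  rewrite -EFin_max lee_fin; apply: le_trans (diam_cone u wz) _.
  rewrite ge_max le_max lexx /=; apply: hd; first by rewrite !inE eqxx.
  by move: hu; rewrite (cardsD1 w) wu => -[].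
have supp c (u : {set ZX}) : cval (cone (v : ZX) (per c)) u != 0 ->
    v \in u /\ cval c (sigma (u :\ v)) != 0.
  rewrite cval_cone; case: ifPn => [vu|_]; last by rewrite eqxx.
  rewrite mulf_eq0 negb_or => /andP[_ cn]; split=> //.
  by move: cn; have [hs|hs] := eqVneq #|u :\ v| k.+2;
    [rewrite cval_per|rewrite cval_out ?eqxx].
have dYX (s : {set Z}) : v \notin s -> #|s| = k.+2 -> @diam R ZY s <= Num.max 1 (@diam R ZX (sigma s)).
  by move=> vs hs; rewrite -{1}[s]sigmaK; apply: hXY; rewrite ?mem_sigma ?card_sigma.
have dXY (s : {set Z}) : v \notin s -> #|s| = k.+2 -> @diam R ZX s <= Num.max 1 (@diam R ZY (sigma s)).
  by move=> vs hs; rewrite -{1}[s]sigmaK; apply: hYX; rewrite ?mem_sigma ?card_sigma.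
have s1 := @shift ZX ZY f (fun c => cone (v : ZX) (per c)) shX f_lin (fun=> erefl)
  (fun c => @ell_h ZX ZY c _ v sigma vY dYX (@supp c)).
have s2 := @shift ZY ZX f (fun c => cone (v : ZX) (per c)) shY f_lin (fun=> erefl)
  (fun c => @ell_h ZY ZX c _ v sigma vX dXY (@supp c)).
have [||phi [bphi H]] := bar_matching (VR_is_verbose F ZX k.+1) (VR_is_verbose F ZY k.+1)
  (lexx 0) s1 s2.
- by move=> z; rewrite memv_ker => /eqP; exact: ffK.
- by move=> z; rewrite memv_ker => /eqP; exact: ffK.
by apply: (@dM_le _ (ms_of_seq _) (ms_of_seq _) _ phi); [exact: lexx|exact: bphi|exact: H].
Qed.

End ConeVertex.

(** * The paw and the star: equal barcodes in each degree *)

Section PawStarBarcodes.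
Context (R : realType) (F : fieldType).

Let X := paw_metric R.
Let Y := star_metric R.

(** Encodes points of a tripod by numbers, so that facts about distances become boolean checks on a
    list. *)
Definition code (T : finType) (l r : T -> 'I_4) (z : T) : nat * nat := (val (l z), val (r z)).

Definition paw_dist (a b : nat) : nat :=
  (if a == b then 0 else if [|| a == 0, b == 0 | (a != 3) && (b != 3)] then 1 else 2)%N.

Definition star_dist (a b : nat) : nat :=
  (if a == b then 0 else if (a == 0) || (b == 0) then 1 else 2)%N.

Lemma paw_distE (i j : 'I_4) : graph_dist R paw4 i j = (paw_dist i j)%:R.
Proof. by rewrite /graph_dist /paw_dist -val_eqE /paw4 /=; case: eqP => // _; case: ifP. Qed.

Lemma star_distE (i j : 'I_4) : graph_dist R star4 i j = (star_dist i j)%:R.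
Proof. by rewrite /graph_dist /star_dist -val_eqE /star4 /=; case: eqP => // _; case: ifP. Qed.

Lemma diam_pair (W : fin_pmetric R) (x y : W) : diam [set x; y] = pm_dist x y.
Proof.
apply/eqP; rewrite eq_le diam_ge ?inE ?eqxx ?orbT// andbT.
apply/diam_leP; first exact: pm_dist_ge0.
move=> u w; rewrite !inE => /orP[]/eqP -> /orP[]/eqP ->;
  by rewrite ?pm_refl ?pm_dist_ge0// pm_sym.
Qed.

Section Tripods.
Variable T : tripod X Y.
Let Z := tri_set T.
Let cd (z : Z) := code (@tri_l R X Y T) (@tri_r R X Y T) z.

Let dX (x y : Z) : R := @pm_dist R (pull_l T) x y.
Let dY (x y : Z) : R := @pm_dist R (pull_r T) x y.

Let dXE x y : dX x y = (paw_dist (cd x).1 (cd y).1)%:R.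
Proof. exact: paw_distE. Qed.

Let dYE x y : dY x y = (star_dist (cd x).2 (cd y).2)%:R.
Proof. exact: star_distE. Qed.

Let cone0 := @dM_cone0 R F Z (@pm_nonempty R (pull_l T)) (@pm_nonempty R (pull_r T))
  dX dY (@pm_refl R (pull_l T)) (@pm_sym R (pull_l T)) (@pm_triangle R (pull_l T))
  (@pm_refl R (pull_r T)) (@pm_sym R (pull_r T)) (@pm_triangle R (pull_r T)).

Let cone1 := @dM_cone R F Z (@pm_nonempty R (pull_l T)) (@pm_nonempty R (pull_r T))
  dX dY (@pm_refl R (pull_l T)) (@pm_sym R (pull_l T)) (@pm_triangle R (pull_l T))
  (@pm_refl R (pull_r T)) (@pm_sym R (pull_r T)) (@pm_triangle R (pull_r T)).

Let dist_le2 (x y : Z) : (dX x y <= 2) * (dY x y <= 2).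
Proof. by split; exact: graph_dist_le2. Qed.

Let v_near v : cd v = (0, 0)%N -> (forall z, dX v z <= 1) * (forall z, dY v z <= 1).
Proof.
by move=> cv; split=> z; rewrite ?dXE ?dYE cv lern1; [case: (cd z).1|case: (cd z).2].
Qed.

Variable s4 : seq (nat * nat).
Hypotheses (cdP : forall z, cd z \in s4) (cd_inj : injective cd).
Variable pt : nat * nat -> Z.
Hypothesis ptK : {in s4, forall a, cd (pt a) = a}.

Let cdK z : pt (cd z) = z.
Proof. by apply: cd_inj; rewrite ptK. Qed.

Let cd_eq x y : (x == y) = (cd x == cd y).
Proof. by rewrite (inj_eq cd_inj). Qed.

Let checkP (P : nat * nat -> nat * nat -> bool) :
  all (fun a => all (P a) s4) s4 -> forall x y, P (cd x) (cd y).
Proof. by move=> /allP h x y; have /allP := h _ (cdP x); apply; exact: cdP. Qed.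

Let farX : all (fun a => all (fun b => (a == b) || (0 < paw_dist a.1 b.1)%N) s4) s4 ->
  forall x y, x != y -> 1 <= dX x y.
Proof.
by move=> /checkP h x y; rewrite dXE ler1n cd_eq => /negbTE xy; have := h x y; rewrite xy.
Qed.

Let farY : all (fun a => all (fun b => (a == b) || (0 < star_dist a.2 b.2)%N) s4) s4 ->
  forall x y, x != y -> 1 <= dY x y.
Proof.
by move=> /checkP h x y; rewrite dYE ler1n cd_eq => /negbTE xy; have := h x y; rewrite xy.
Qed.

(** Above degree [1] the only possible simplex avoiding [v] is {1, 2, 3}, of diameter [2] in both
    graphs. In degree [1] the edges avoiding [v] have lengths 1, 2, 2 in the paw and 2, 2, 2 in the
    star. *)
Lemma paw_star_diagonal k : s4 = [:: (0, 0); (1, 1); (2, 2); (3, 3)]%N -> k != 1%N ->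
  (dM (ms_of_seq (verbose_barcode (VR F (pull_l T)) k))
      (ms_of_seq (verbose_barcode (VR F (pull_r T)) k)) <= 0)%E.
Proof.
move=> sE k1; pose v := pt (0, 0)%N.
have cp a : a \in s4 -> cd (pt a) = a by exact: ptK.
have cv : cd v = (0, 0)%N by rewrite cp// sE.
have [vX vY] := v_near cv.
have fX : forall x y, x != y -> 1 <= dX x y by apply: farX; rewrite sE.
have fY : forall x y, x != y -> 1 <= dY x y by apply: farY; rewrite sE.
case: k k1 => [_|[//|k] _]; first exact: (cone0 vX vY fX fY).
have full (s : {set Z}) a : v \notin s -> #|s| = k.+3 -> a \in s4 -> a != (0, 0)%N ->
    pt a \in s.
  move=> vs hs; pose S3 := [set pt (1, 1)%N; pt (2, 2)%N; pt (3, 3)%N].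
  have sS : s \subset S3.
    apply/fintype.subsetP => z zs; have := cdP z; rewrite {1}sE /= 4!in_cons in_nil orbF.
    case/or4P => /eqP cz; last 3 first.
    - by rewrite -[z]cdK cz /S3 !inE eqxx.
    - by rewrite -[z]cdK cz /S3 !inE eqxx ?orbT.
    - by rewrite -[z]cdK cz /S3 !inE eqxx ?orbT.
    by case/negP: vs; rewrite /v -cz cdK.
  have -> : s = S3.
    apply/eqP; rewrite eqEcard sS hs; apply: (@leq_trans 3) => //.
    by rewrite /S3 -finset.setUA !cardsU1 cards1; do 2 case: (_ \notin _).
  by rewrite sE !inE => /or4P[] /eqP ->; rewrite ?eqxx ?orbT.
have le2X (s : {set Z}) : @diam R (pull_l T) s <= 2.
  by apply/diam_leP => // x y _ _; have [] := dist_le2 x y.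
have le2Y (s : {set Z}) : @diam R (pull_r T) s <= 2.
  by apply/diam_leP => // x y _ _; have [] := dist_le2 x y.
have dX13 : dX (pt (1, 1)%N) (pt (3, 3)%N) = 2 by rewrite dXE !cp ?sE.
have dY12 : dY (pt (1, 1)%N) (pt (2, 2)%N) = 2 by rewrite dYE !cp ?sE.
have ge2X (s : {set Z}) : v \notin s -> #|s| = k.+3 -> 2 <= @diam R (pull_l T) s.
  move=> vs hs; rewrite -dX13.
  by apply: (@diam_ge R (pull_l T)); apply: full; rewrite ?sE.
have ge2Y (s : {set Z}) : v \notin s -> #|s| = k.+3 -> 2 <= @diam R (pull_r T) s.
  move=> vs hs; rewrite -dY12.
  by apply: (@diam_ge R (pull_r T)); apply: full; rewrite ?sE.
have shX : few_short (pull_l T).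
  by exists finset.set0 => x y xy; rewrite ltNge [_ <= _](fX x y xy).
have shY : few_short (pull_r T).
  by exists finset.set0 => x y xy; rewrite ltNge [_ <= _](fY x y xy).
have hXY (s : {set Z}) : v \notin s -> #|s| = k.+3 ->
    @diam R (pull_r T) s <= Num.max 1 (@diam R (pull_l T) s).
  move=> vs hs; apply: le_trans (le2Y s) _; rewrite le_max; apply/orP; right.
  exact: ge2X.
have hYX (s : {set Z}) : v \notin s -> #|s| = k.+3 ->
    @diam R (pull_l T) s <= Num.max 1 (@diam R (pull_r T) s).
  move=> vs hs; apply: le_trans (le2X s) _; rewrite le_max; apply/orP; right.
  exact: ge2Y.
exact: (@cone1 v vX vY id (fun=> erefl) (fun=> erefl) (fun=> erefl) k.+2 shX shY isT hXY hYX).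
Qed.

(** The point [(1, 0)] lies over vertex 1 of the paw and over the centre of the star. With lengths
    raised to at least 1, the edges avoiding [v] agree except for [a], of lengths 2 and 1, and [b],
    of lengths 1 and 2; [sigma] exchanges these two. *)
Lemma paw_star_doubled : s4 = [:: (0, 0); (1, 0); (1, 1); (2, 2); (3, 3)]%N ->
  (dM (ms_of_seq (verbose_barcode (VR F (pull_l T)) 1))
      (ms_of_seq (verbose_barcode (VR F (pull_r T)) 1)) <= 0)%E.
Proof.
move=> sE; pose v := pt (0, 0)%N.
have cp a : a \in s4 -> cd (pt a) = a by exact: ptK.
have cv : cd v = (0, 0)%N by rewrite cp// sE.
have [vX vY] := v_near cv.
have ptE a b : a \in s4 -> b \in s4 -> (pt a == pt b) = (a == b).
  by move=> ha hb; rewrite cd_eq !cp.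
pose q := pt (1, 0)%N; pose p := pt (1, 1)%N; pose z2 := pt (2, 2)%N; pose z3 := pt (3, 3)%N.
pose a := [set q; z3]; pose b := [set p; z2].
have ca : #|a| = 2%N by rewrite /a cards2 ptE ?sE.
have cb : #|b| = 2%N by rewrite /b cards2 ptE ?sE.
have va : v \notin a by rewrite /a !inE !ptE ?sE.
have vb : v \notin b by rewrite /b !inE !ptE ?sE.
have shX : few_short (pull_l T).
  exists [set q; p] => x y; rewrite -/(dX x y) dXE ltrn1.
  pose P (a b : nat * nat) := [|| a == b, paw_dist a.1 b.1 != 0%N,
    (a == (1, 0)%N) && (b == (1, 1)%N) | (a == (1, 1)%N) && (b == (1, 0)%N)].
  have : P (cd x) (cd y) by apply: checkP; rewrite sE.
  rewrite /P cd_eq ltnS leqn0 => /or4P[->//|/negbTE ->//|/andP[/eqP cx /eqP cy] _ _|].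
    by rewrite -[x]cdK -[y]cdK cx cy.
  by move=> /andP[/eqP cx /eqP cy] _ _; rewrite -[x]cdK -[y]cdK cx cy finset.setUC.
have shY : few_short (pull_r T).
  exists [set v; q] => x y; rewrite -/(dY x y) dYE ltrn1.
  pose P (a b : nat * nat) := [|| a == b, star_dist a.2 b.2 != 0%N,
    (a == (0, 0)%N) && (b == (1, 0)%N) | (a == (1, 0)%N) && (b == (0, 0)%N)].
  have : P (cd x) (cd y) by apply: checkP; rewrite sE.
  rewrite /P cd_eq ltnS leqn0 => /or4P[->//|/negbTE ->//|/andP[/eqP cx /eqP cy] _ _|].
    by rewrite -[x]cdK -[y]cdK cx cy.
  by move=> /andP[/eqP cx /eqP cy] _ _; rewrite -[x]cdK -[y]cdK cx cy finset.setUC.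
have pairX x y : @diam R (pull_l T) [set x; y] = (paw_dist (cd x).1 (cd y).1)%:R.
  by rewrite (@diam_pair (pull_l T)) -/(dX x y) dXE.
have pairY x y : @diam R (pull_r T) [set x; y] = (star_dist (cd x).2 (cd y).2)%:R.
  by rewrite (@diam_pair (pull_r T)) -/(dY x y) dYE.
have le2X (s : {set Z}) : @diam R (pull_l T) s <= 2.
  by apply/diam_leP => // x y _ _; have [] := dist_le2 x y.
have le2Y (s : {set Z}) : @diam R (pull_r T) s <= 2.
  by apply/diam_leP => // x y _ _; have [] := dist_le2 x y.
have nodd x y : x != y -> v != x -> v != y -> [set x; y] != a -> [set x; y] != b ->
    (star_dist (cd x).2 (cd y).2 <= maxn 1 (paw_dist (cd x).1 (cd y).1))%N &&
    (paw_dist (cd x).1 (cd y).1 <= maxn 1 (star_dist (cd x).2 (cd y).2))%N.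
  move=> xy vx vy xya xyb.
  pose A := [:: ((1, 0), (3, 3)); ((3, 3), (1, 0))]%N.
  pose B := [:: ((1, 1), (2, 2)); ((2, 2), (1, 1))]%N.
  pose P (a b : nat * nat) := [|| a == b, (0, 0)%N == a, (0, 0)%N == b, (a, b) \in A,
    (a, b) \in B | (star_dist a.2 b.2 <= maxn 1 (paw_dist a.1 b.1))%N &&
    (paw_dist a.1 b.1 <= maxn 1 (star_dist a.2 b.2))%N].
  have : P (cd x) (cd y) by apply: checkP; rewrite sE.
  rewrite /P -cd_eq -{1 2}cv -!cd_eq (negbTE xy) (negbTE vx) (negbTE vy) /=.
  case/or3P => //; rewrite !inE => /orP[] /eqP e;
    (have cx : cd x = _ := congr1 fst e); (have cy : cd y = _ := congr1 snd e);
    by move: xya xyb; rewrite -[x]cdK -[y]cdK cx cy /= ?eqxx// finset.setUC ?eqxx.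
have split2 (s : {set Z}) : v \notin s -> #|s| = 2%N -> exists x y,
    [/\ s = [set x; y], x != y, v != x & v != y].
  move=> vs hs; have /cards2P[x [y [xy sxy]]] : #|s| == 2%N by rewrite hs.
  move: vs; rewrite sxy !inE negb_or => /andP[vx vy].
  by exists x, y.
have Da : @diam R (pull_l T) a = 2 by rewrite /a pairX !cp ?sE.
have Db : @diam R (pull_l T) b = 1 by rewrite /b pairX !cp ?sE.
have Ea : @diam R (pull_r T) a = 1 by rewrite /a pairY !cp ?sE.
have Eb : @diam R (pull_r T) b = 2 by rewrite /b pairY !cp ?sE.
have natmax n m : (n <= maxn 1 m)%N -> (n%:R : R) <= Num.max 1 m%:R.
  by move=> nm; rewrite le_max lern1 ler_nat; move: nm; rewrite leq_max.
have one_le2 : (1 : R) <= 2 by lra.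
have hXY (s : {set Z}) : v \notin s -> #|s| = 2%N ->
    @diam R (pull_r T) (tperm a b s) <= Num.max 1 (@diam R (pull_l T) s).
  move=> vs hs; case: tpermP => [->|->|/eqP sa /eqP sb].
  - by rewrite Eb Da le_max lexx orbT.
  - by rewrite Ea le_max lexx.
  have [x [y [sxy xy vx vy]]] := split2 s vs hs.
  have /andP[h _] := nodd x y xy vx vy (eq_ind s (fun t => t != a) sa _ sxy)
    (eq_ind s (fun t => t != b) sb _ sxy).
  by rewrite sxy pairX pairY; exact: natmax.
have hYX (s : {set Z}) : v \notin s -> #|s| = 2%N ->
    @diam R (pull_l T) (tperm a b s) <= Num.max 1 (@diam R (pull_r T) s).
  move=> vs hs; case: tpermP => [->|->|/eqP sa /eqP sb].
  - by rewrite Db le_max lexx.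
  - by rewrite Da Eb le_max lexx orbT.
  have [x [y [sxy xy vx vy]]] := split2 s vs hs.
  have /andP[_ h] := nodd x y xy vx vy (eq_ind s (fun t => t != a) sa _ sxy)
    (eq_ind s (fun t => t != b) sb _ sxy).
  by rewrite sxy pairX pairY; exact: natmax.
have cardS (s : {set Z}) : #|tperm a b s| = #|s|.
  by case: tpermP => [->|->|//]; rewrite ca cb.
have memS (s : {set Z}) : (v \in tperm a b s) = (v \in s).
  by case: tpermP => [->|->|//]; rewrite (negbTE va) (negbTE vb).
exact: (@cone1 v vX vY (tperm a b) (tpermK a b) cardS memS 1 shX shY isT hXY hYX).
Qed.

End Tripods.

Lemma pullback_dB_paw_star k : (pullback_dB F k Map X Y <= 0)%E.
Proof.
have [->|k1] := eqVneq k 1%N.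
  (* Sending vertex 1 of the paw to the centre adds the pair [(1, 0)] to the diagonal, which comes
     from [g = id]. *)
  pose f (i : 'I_4) : 'I_4 := if val i == 1%N then ord0 else i.
  pose T := cor_tripod (@map_corP R X Y f id).
  apply: ge_ereal_inf; eexists; first by exists T; split; [exists f, id|].
  have memS (i j : 'I_4) : ((i, j) \in @map_cor R X Y f id) = (j == f i) || (i == j).
    rewrite finset.in_setU; congr (_ || _).
      by apply/imsetP/eqP => [[x _ [-> ->]]|->]; [|exists i].
    by apply/imsetP/eqP => [[x _ [-> ->]]|->]; [|exists j].
  pose in5 (a : nat * nat) := a \in [:: (0, 0); (1, 0); (1, 1); (2, 2); (3, 3)]%N.
  have mem5 (a : nat * nat) : in5 a ->
      (inord a.1 : 'I_4, inord a.2 : 'I_4) \in @map_cor R X Y f id.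
    rewrite memS /in5 !inE -!val_eqE /f.
    case/or4P => [/eqP ->|/eqP ->|/eqP ->|/orP[]/eqP ->] /=;
      by rewrite ?(fun_if val) /= ?inordK.
  have h0 : (ord0 : 'I_4, ord0 : 'I_4) \in @map_cor R X Y f id by rewrite memS eqxx orbT.
  pose pt (a : nat * nat) : tri_set T :=
    insubd (exist _ (ord0 : 'I_4, ord0 : 'I_4) h0 : tri_set T) (inord a.1 : 'I_4, inord a.2 : 'I_4).
  apply: (@paw_star_doubled T _ _ _ pt) => //.
  - move=> z; have := valP z; rewrite /code /=; move: (val z) => [i j]; rewrite memS /=.
    by move: i j => [[|[|[|[|i]]]] hi] // [[|[|[|[|j]]]] hj].
  - move=> z z' [h1 h2]; apply: val_inj; move: h1 h2 => /=.
    by case: (val z) (val z') => [i j] [i' j'] /= /val_inj -> /val_inj ->.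
  - move=> a a5; rewrite /code /pt /= val_insubd mem5//=.
    by move: a5; rewrite !inE => /or4P[/eqP ->|/eqP ->|/eqP ->|/orP[]/eqP ->] /=; rewrite !inordK.
pose T := cor_tripod (@map_corP R X Y id id).
apply: ge_ereal_inf; eexists; first by exists T; split; [exists id, id|].
have memS (i j : 'I_4) : ((i, j) \in @map_cor R X Y id id) = (i == j).
  rewrite finset.in_setU -[RHS]orbb; congr (_ || _).
    by apply/imsetP/eqP => [[x _ [-> ->]]|->]; [|exists j].
  by apply/imsetP/eqP => [[x _ [-> ->]]|->]; [|exists j].
have hd (i : 'I_4) : (i, i) \in @map_cor R X Y id id by rewrite memS eqxx.
pose pt (a : nat * nat) : tri_set T := exist _ (inord a.1, inord a.1) (hd (inord a.1)).
apply: (@paw_star_diagonal T _ _ _ pt) => //.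
- move=> z; have := valP z; rewrite /code /=; move: (val z) => [i j]; rewrite memS /=.
  by move=> /eqP ->; case: j => [[|[|[|[|j]]]] hj].
- move=> z z' [h1 h2]; apply: val_inj; move: h1 h2 => /=.
  by case: (val z) (val z') => [i j] [i' j'] /= /val_inj -> /val_inj ->.
- move=> a; rewrite /code /pt /= !inE.
  by case/or4P => /eqP -> /=; rewrite !inordK.
Qed.

Lemma pullback_dI_paw_star sq : (1%:E <= pullback_dI F sq X Y)%E.
Proof.
by apply: le_ereal_inf_tmp => _ [T [_ ->]]; exact: dI_paw_star_ge1.
Qed.

Lemma pullback_dB_lt_dI k sq :
  exists X Y : fin_metric R, (pullback_dB F k sq X Y < pullback_dI F sq X Y)%E.
Proof.
exists X, Y; apply: (@le_lt_trans _ _ 0%E).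
  apply: le_trans (pullback_dB_paw_star k).
  by apply: pullback_dB_incl; exact: class_Map.
by apply: lt_le_trans (pullback_dI_paw_star sq); rewrite lte_fin.
Qed.

Lemma sup_pullback_dB_lt_dI sq :
  exists X Y : fin_metric R, (sup_pullback_dB F sq X Y < pullback_dI F sq X Y)%E.
Proof.
exists X, Y; apply: (@le_lt_trans _ _ 0%E).
  apply: ge_ereal_sup => _ [k _ <-]; apply: le_trans (pullback_dB_paw_star k).
  by apply: pullback_dB_incl; exact: class_Map.
by apply: lt_le_trans (pullback_dI_paw_star sq); rewrite lte_fin.
Qed.

End PawStarBarcodes.

(** * Assembly of the three statements *)

Local Open Scope ereal_scope.

Theorem theorem9 (R : realType) (F : fieldType) :
  (* (a) *)
  (forall X Y : fin_metric R,
    [/\ pullback_dI F Tri X Y <= pullback_dI F Cor X Y,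
        pullback_dI F Cor X Y <= pullback_dI F Map X Y &
        pullback_dI F Map X Y <= 2%:E * dGH X Y] /\
    [/\ sup_bottleneck F X Y <= sup_pullback_dB F Tri X Y,
        sup_pullback_dB F Tri X Y <= sup_pullback_dB F Cor X Y &
        sup_pullback_dB F Cor X Y <= sup_pullback_dB F Map X Y] /\
    (forall sq : tripod_class,
        sup_pullback_dB F sq X Y <= pullback_dI F sq X Y)) /\
  (* (b) *)
  ((exists X Y : fin_metric R, pullback_dI F Map X Y < 2%:E * dGH X Y) /\
   (exists X Y : fin_metric R,
      sup_bottleneck F X Y < sup_pullback_dB F Tri X Y) /\
   (forall sq : tripod_class, exists X Y : fin_metric R,
      sup_pullback_dB F sq X Y < pullback_dI F sq X Y)) /\
  (* (c) *)
  (forall k : nat,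
    (forall X Y : fin_metric R,
      [/\ pullback_dI F Tri X Y <= pullback_dI F Cor X Y,
          pullback_dI F Cor X Y <= pullback_dI F Map X Y &
          pullback_dI F Map X Y <= 2%:E * dGH X Y] /\
      [/\ bottleneck F k X Y <= pullback_dB F k Tri X Y,
          pullback_dB F k Tri X Y <= pullback_dB F k Cor X Y &
          pullback_dB F k Cor X Y <= pullback_dB F k Map X Y] /\
      (forall sq : tripod_class,
          pullback_dB F k sq X Y <= pullback_dI F sq X Y)) /\
    ((exists X Y : fin_metric R, pullback_dI F Map X Y < 2%:E * dGH X Y) /\
     (exists X Y : fin_metric R,
        bottleneck F k X Y < pullback_dB F k Tri X Y) /\
     (forall sq : tripod_class, exists X Y : fin_metric R,
        pullback_dB F k sq X Y < pullback_dI F sq X Y))).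
Proof.
have dB_mono k (X Y : fin_metric R) :
    pullback_dB F k Tri X Y <= pullback_dB F k Cor X Y /\
    pullback_dB F k Cor X Y <= pullback_dB F k Map X Y.
  by split; apply: pullback_dB_incl; [exact: class_Tri|exact: class_Map].
have sup_mono (u w : nat -> \bar R) : (forall k, u k <= w k) ->
    ereal_sup (range u) <= ereal_sup (range w).
  move=> uw; apply: ge_ereal_sup => _ [k _ <-].
  by apply: le_trans (uw k) _; apply: ereal_sup_ubound; exists k.
have dIs (X Y : fin_metric R) :
    [/\ pullback_dI F Tri X Y <= pullback_dI F Cor X Y,
        pullback_dI F Cor X Y <= pullback_dI F Map X Y &
        pullback_dI F Map X Y <= 2%:E * dGH X Y].
  split; last exact: pullback_dI_le_dGH.
    exact/pullback_dI_incl/class_Tri.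
  exact/pullback_dI_incl/class_Map.
split; [|split].
- move=> X Y; split; first exact: dIs; split.
    by split; apply: sup_mono => k; [exact: bottleneck_le_pullback|
      exact: (dB_mono k X Y).1|exact: (dB_mono k X Y).2].
  move=> sq; apply: ge_ereal_sup => _ [k _ <-]; exact: pullback_dB_le_dI.
- split; first exact: pullback_dI_lt_dGH.
  by split; [exact: sup_bottleneck_lt_pullback|exact: sup_pullback_dB_lt_dI].
move=> k; split.
  move=> X Y; split; first exact: dIs; split; last by move=> sq; exact: pullback_dB_le_dI.
  by split; [exact: bottleneck_le_pullback|exact: (dB_mono k X Y).1|exact: (dB_mono k X Y).2].
split; first exact: pullback_dI_lt_dGH.
by split; [exact: bottleneck_lt_pullback|exact: pullback_dB_lt_dI].
Qed.
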